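(* Let $(X_t\colon t\in\mathbb{Z})$ be a weakly stationary zero-mean process with values in $H=L^2([0,1])$ whose lag-$h$ autocovariance operators satisfy $\sum_{h\in\mathbb{Z}}\|C_h\|_{\mathcal{S}}<\infty$, and let $Y_{mt}=\sum_{\ell\in\mathbb{Z}}\langle X_{t-\ell},\phi_{m\ell}\rangle$, $m\ge 1$, $t\in\mathbb{Z}$, be its dynamic functional principal component scores. Then, for every $t\in\mathbb{Z}$, $$X_t(u)=\sum_{m\geq 1}X_{mt}(u)\quad\text{with}\quad X_{mt}(u):=\sum_{\ell\in\mathbb{Z}}Y_{m,t+\ell}\,\phi_{m\ell}(u),$$ where the convergence of the series is in mean square (i.e. in the sense $E\|\cdot\|^2\to0$).
   Context: $H=L^2([0,1])$ is the Hilbert space of complex-valued square-integrable functions on $[0,1]$, with $\langle x,y\rangle=\int_0^1x(u)\overline{y(u)}\,du$ and $\|x\|=\langle x,x\rangle^{1/2}$. A zero-mean $H$-valued process $(X_t\colon t\in\mathbb{Z})$ is weakly stationary if $E\|X_t\|^2<\infty$, $EX_t=0$ and $c_h(u,v):=E[X_{t+h}(u)\overline{X_t(v)}]$ does not depend on $t$. $C_h$ is the operator with kernel $c_h$, i.e. $C_h(x)(u)=\int_0^1c_h(u,v)x(v)\,dv$, and $\|\cdot\|_{\mathcal{S}}$ is the Hilbert--Schmidt norm. Spectral density operator: $\mathcal{F}^X_\theta:=\frac{1}{2\pi}\sum_{h\in\mathbb{Z}}C_he^{-\mathrm{i}h\theta}$, $\theta\in[-\pi,\pi]$. Under $\sum_h\|C_h\|_{\mathcal{S}}<\infty$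 it is, for each $\theta$, a non-negative self-adjoint Hilbert--Schmidt operator, with spectral representation $\mathcal{F}^X_\theta(x)=\sum_{m\ge1}\lambda_m(\theta)\langle x,\varphi_m(\theta)\rangle\varphi_m(\theta)$, where $\lambda_1(\theta)\ge\lambda_2(\theta)\ge\cdots\ge0$ and the eigenfunctions $\varphi_m(\theta)=\varphi_m(\cdot|\theta)$ are orthonormal. The eigenfunctions are only determined up to unit complex factors; a version is fixed such that $(u,\theta)\mapsto\varphi_m(u|\theta)$ is jointly measurable. Dynamic FPC filter coefficients: $\phi_{m\ell}(u):=\frac{1}{2\pi}\int_{-\pi}^{\pi}\varphi_m(u|s)e^{-\mathrm{i}\ell s}\,ds$ for (almost every) $u$ such that $\varphi_m(u|\cdot)\in L^2([-\pi,\pi])$, and $\phi_{m\ell}(u):=0$ otherwise. The $m$-th dynamic functional principal component score is $Y_{mt}:=\sum_{\ell\in\mathbb{Z}}\langle X_{t-\ell},\phi_{m\ell}\rangle$ (mean-square convergent). Series over $\ell\in\mathbb{Z}$ are limits of the partial sums over $|\ell|\le N$ as $N\to\infty$. *)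

(* Defs.v *)
From HB Require Import structures.
From mathcomp Require Import all_boot all_order all_algebra.
From mathcomp Require Import all_classical all_reals all_analysis.
From mathcomp Require Import complex.

Set Implicit Arguments.
Unset Strict Implicit.
Unset Printing Implicit Defensive.

Import Order.TTheory GRing.Theory Num.Theory.
Import numFieldNormedType.Exports.
Import ComplexField.Normc.

Local Open Scope classical_set_scope.
Local Open Scope ring_scope.

Definition cmeasurable (d : measure_display) (U : measurableType d)
    (R : realType) (D : set U) (f : U -> R[i]) : Prop :=
  measurable_fun D (fun x => complex.Re (f x)) /\
  measurable_fun D (fun x => complex.Im (f x)).

Definition cintegral (d : measure_display) (U : measurableType d)
    (R : realType) (mu : {measure set U -> \bar R}) (D : set U)
    (f : U -> R[i]) : R[i] :=
  Complex (\int[mu]_(x in D) complex.Re (f x))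
          (\int[mu]_(x in D) complex.Im (f x)).

Definition L2normsq (d : measure_display) (U : measurableType d)
    (R : realType) (mu : {measure set U -> \bar R}) (D : set U)
    (f : U -> R[i]) : \bar R :=
  (\int[mu]_(x in D) (normc (f x) ^+ 2)%:E)%E.

Definition L2 (d : measure_display) (U : measurableType d)
    (R : realType) (mu : {measure set U -> \bar R}) (D : set U) :
    set (U -> R[i]) :=
  [set f | cmeasurable D f /\ (L2normsq mu D f < +oo)%E].

Definition cis (R : realType) (x : R) : R[i] := Complex (cos x) (sin x).

(* Symmetric partial sum over the integers l with |l| <= N. *)
Definition zsum (R : realType) (N : nat) (f : int -> R[i]) : R[i] :=
  \sum_(k < N.*2.+1) f (k%:Z - N%:Z).

(* Convergence, inside a class B of functions, with respect to a squared
   seminorm q.  Functions are representatives of their almost-everywhere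
   classes, so limits are unique only almost everywhere; [limit] selects
   one of them, and is 0 if there is none. *)
Definition converges (R : realType) (V : zmodType) (B : set V) (q : V -> \bar R)
    (s : nat -> V) (l : V) : Prop :=
  B l /\ (q (s n - l) @[n --> \oo] --> 0%E).

Definition limit (R : realType) (V : zmodType) (B : set V) (q : V -> \bar R)
    (s : nat -> V) : V :=
  xget 0 (converges B q s).

Section Hilbert.
Variable R : realType.
Implicit Types (x y : R -> R[i]) (A : (R -> R[i]) -> (R -> R[i])).

Definition leb : {measure set (measurableTypeR R) -> \bar R} :=
  @lebesgue_measure R.
Definition I01 : set R := `[0, 1].
Definition Ipi : set R := `[- pi, pi].

Definition Hsp : set (R -> R[i]) := L2 leb I01.
Definition Hnormsq x : \bar R := L2normsq leb I01 x.
Definition inner x y : R[i] := cintegral leb I01 (fun u => x u * (y u)^*%C).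

Definition orthonormal (e : nat -> R -> R[i]) : Prop :=
  (forall k, Hsp (e k)) /\ (forall j k, inner (e j) (e k) = (j == k)%:R).

Definition orthonormal_basis (e : nat -> R -> R[i]) : Prop :=
  orthonormal e /\
  forall x, Hsp x ->
    converges Hsp Hnormsq
      (fun n u => \sum_(k < n) inner x (e k) * e k u) x.

(* The sum of the ||A e_k||^2 is the same for every orthonormal basis e, so
   the infimum below is a way of naming this common value. *)
Definition HSnorm A : \bar R :=
  ereal_inf [set sqrte (\sum_(0 <= k <oo) Hnormsq (A (e k)))%E
            | e in orthonormal_basis].

End Hilbert.

Section Process.
Context (R : realType) (d : measure_display) (T : measurableType d).
Variable P : probability T R.

(* An H-valued random element, given by a jointly measurable version, so that
   the kernels E[X_{t+h}(u) (X_t(v))^*] make sense pointwise. *)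
Definition random_element (Z : T -> R -> R[i]) : Prop :=
  cmeasurable ([set: T] `*` @I01 R)
    (fun z : T * measurableTypeR R => Z z.1 z.2) /\
  (forall w, Hsp (Z w)).

Definition Enormsq (Z : T -> R -> R[i]) : \bar R :=
  (\int[P]_w Hnormsq (Z w))%E.

Definition L2H : set (T -> R -> R[i]) :=
  [set Z | random_element Z /\ (Enormsq Z < +oo)%E].

Definition cexpectation (Z : T -> R[i]) : R[i] := cintegral P setT Z.

Variable X : int -> T -> R -> R[i].

Definition autocov (t h : int) (u v : R) : R[i] :=
  cexpectation (fun w => X (t + h) w u * (X t w v)^*%C).

Definition zero_mean : Prop :=
  forall t, {ae @leb R, forall u, I01 u -> cexpectation (fun w => X t w u) = 0}.

(* c_h is an element of L^2([0,1]^2): its independence of t is required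
   almost everywhere. *)
Definition weakly_stationary : Prop :=
  (forall t, L2H (X t)) /\
  zero_mean /\
  (forall t h,
    {ae (@lebesgue_measure R \x @lebesgue_measure R)%E,
      forall z : R * R, I01 z.1 -> I01 z.2 ->
        autocov t h z.1 z.2 = autocov 0 h z.1 z.2}).

Definition covop (h : int) (x : R -> R[i]) : R -> R[i] :=
  fun u => cintegral (@leb R) (@I01 R) (fun v => autocov 0 h u v * x v).

(* The operator series is summed strongly: F_theta x is the limit in Hsp of
   the partial sums applied to x. *)
Definition spectral_density (theta : R) (x : R -> R[i]) : R -> R[i] :=
  limit (@Hsp R) (@Hnormsq R) (fun N u =>
    ((2 * pi)^-1)%:C%C *
      zsum N (fun h => covop h x u * cis (- (h%:~R * theta)))).

(* The component of rank m >= 1 has index m - 1; phi m theta u stands for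
   the value at u of the eigenfunction at frequency theta. *)
Definition spectral_representation (lambda : nat -> R -> R)
    (phi : nat -> R -> R -> R[i]) : Prop :=
  forall theta, Ipi theta ->
    (forall m, 0 <= lambda m.+1 theta <= lambda m theta) /\
    orthonormal (fun m => phi m theta) /\
    (forall x, Hsp x ->
      converges (@Hsp R) (@Hnormsq R)
        (fun M u => \sum_(m < M)
           (lambda m theta)%:C%C * inner x (phi m theta) * phi m theta u)
        (spectral_density theta x)).

Definition jointly_measurable (phi : nat -> R -> R -> R[i]) : Prop :=
  forall m, cmeasurable (@I01 R `*` @Ipi R)
    (fun z : measurableTypeR R * measurableTypeR R => phi m z.2 z.1).

Variable phi : nat -> R -> R -> R[i].

Definition fpc_filter (m : nat) (l : int) : R -> R[i] := fun u =>
  if `[< L2 (@leb R) (@Ipi R) (fun s => phi m s u) >] then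
    ((2 * pi)^-1)%:C%C *
      cintegral (@leb R) (@Ipi R) (fun s => phi m s u * cis (- (l%:~R * s)))
  else 0.

Definition score_sum (m : nat) (t : int) (N : nat) : T -> R[i] :=
  fun w => zsum N (fun l => inner (X (t - l) w) (fpc_filter m l)).

Definition score (m : nat) (t : int) : T -> R[i] :=
  limit (L2 P setT) (L2normsq P setT) (score_sum m t).

Definition component_sum (m : nat) (t : int) (N : nat) : T -> R -> R[i] :=
  fun w u => zsum N (fun l => score m (t + l) w * fpc_filter m l u).

Definition component (m : nat) (t : int) : T -> R -> R[i] :=
  limit L2H Enormsq (component_sum m t).

End Process.

(* Main.v *)
From HB Require Import structures.
From mathcomp Require Import all_boot all_order all_algebra.
From mathcomp Require Import all_classical all_reals all_analysis.
From mathcomp Require Import complex.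
From mathcomp Require Import measurable_realfun.
From mathcomp Require Import ring lra zify.
Require Import Defs.
Set Implicit Arguments.
Unset Strict Implicit.
Unset Printing Implicit Defensive.
Import Order.TTheory GRing.Theory Num.Theory.
Import numFieldNormedType.Exports.
Import ComplexField.Normc.
Local Open Scope classical_set_scope.
Local Open Scope ring_scope.

(** The theorem is an orthogonal expansion in the space of square-integrable
    random elements, governed by the spectral density [F_t].

    For a filter with coefficients in the Hilbert space, the scalar series built
    from the process has covariances obtained by integrating over the frequency
    the spectral density against the transfer function of the filter. The
    transfer function of the [m]-th filter is the eigenfunction [phi m], and
    [F_t] acts on it as multiplication by [lambda m t]. Hence two scores of
    different rank are uncorrelated at all times, while the [m]-th score process
    has spectral density [lambda m] ([score_cov], [score_cov2]): it behaves like
    the functions [cis (l * t)] of the frequency, in the space with weight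
    [lambda m]. Under this correspondence the partial sums of the [m]-th
    component become the Fourier sums of [phi m] ([fip_psum]). As these converge
    in mean square ([fourier_series_cvg]) and the weight is bounded ([lambda_le]),
    the components exist ([component_converges]), those of different rank are
    orthogonal, and both the squared norm of the [m]-th one and its inner product
    with the process are the integral of [lambda m] ([fip_component],
    [fip_component_process]).

    So the squared norm of the remainder after [M] components is the variance of
    the process minus the integrals of the first [M] eigenvalues
    ([remainder_nsq]). It tends to 0 because both quantities compute the trace of
    the covariance operator at lag 0: the variance as the sum of the variances
    along a fixed orthonormal basis, and the eigenvalues as the trace of the
    spectral density, which integrates over the frequencies to the covariance at
    lag 0 ([trace_formula]).

    The scores themselves converge since the covariances of the scalar series
    are dominated by the summable Hilbert-Schmidt norms of the covariance
    operators, so that a square-summable filter acts boundedly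
    ([filter_nsq_le]), and the filter is square-summable by Bessel's inequality
    ([fourier_bessel]).

    Three ingredients come from real analysis: the completeness of the spaces of
    square-integrable functions ([L2_complete]), Fubini's theorem on rectangles,
    and the uniqueness of Fourier coefficients of integrable functions
    ([fourier_unique]), from which the convergence of Fourier series with values
    in the Hilbert space is deduced one coordinate at a time. *)

(** * Complex numbers and complex-valued integrals *)

Section ComplexFacts.
Variable R : realType.
Implicit Types (z w : R[i]) (s : nat -> R[i]).
Local Notation Re := (@complex.Re R).
Local Notation Im := (@complex.Im R).

Lemma cReD z w : Re (z + w) = Re z + Re w. Proof. by case: z w => [a b] [c d]. Qed.
Lemma cImD z w : Im (z + w) = Im z + Im w. Proof. by case: z w => [a b] [c d]. Qed.
Lemma cReN z : Re (- z) = - Re z. Proof. by case: z. Qed.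
Lemma cImN z : Im (- z) = - Im z. Proof. by case: z. Qed.
Lemma cReM z w : Re (z * w) = Re z * Re w - Im z * Im w.
Proof. by case: z w => [a b] [c d]. Qed.
Lemma cImM z w : Im (z * w) = Re z * Im w + Im z * Re w.
Proof. by case: z w => [a b] [c d]. Qed.
Lemma cReJ z : Re (conjc z) = Re z. Proof. by case: z. Qed.
Lemma cImJ z : Im (conjc z) = - Im z. Proof. by case: z. Qed.

Lemma conjcM z w : conjc (z * w) = conjc z * conjc w. Proof. exact: rmorphM. Qed.
Lemma conjcD z w : conjc (z + w) = conjc z + conjc w. Proof. exact: rmorphD. Qed.
Lemma conjcB z w : conjc (z - w) = conjc z - conjc w. Proof. exact: rmorphB. Qed.
Lemma conjc_sum I (r : seq I) (Q : pred I) (f : I -> R[i]) :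
  conjc (\sum_(i <- r | Q i) f i) = \sum_(i <- r | Q i) conjc (f i).
Proof. exact: rmorph_sum. Qed.

Lemma cRe_sum I (r : seq I) (Q : pred I) (f : I -> R[i]) :
  Re (\sum_(i <- r | Q i) f i) = \sum_(i <- r | Q i) Re (f i).
Proof. by apply: (big_morph Re cReD). Qed.

Lemma complex_eq z w : Re z = Re w -> Im z = Im w -> z = w.
Proof. by case: z w => [a b] [c d] /= -> ->. Qed.

Lemma sqr_normcE z : normc z ^+ 2 = Re z ^+ 2 + Im z ^+ 2.
Proof. by case: z => a b; rewrite /normc sqr_sqrtr // addr_ge0 ?sqr_ge0. Qed.

Lemma normc_ge0 z : 0 <= normc z. Proof. by case: z => a b; exact: sqrtr_ge0. Qed.

Lemma normc_conj z : normc (conjc z) = normc z.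
Proof. by case: z => a b; rewrite /normc /= sqrrN. Qed.

Lemma normc_Re z : `|Re z| <= normc z.
Proof.
by rewrite -(@ler_pXn2r _ 2) ?nnegrE ?normc_ge0 ?normr_ge0//
  sqr_normcE real_normK ?num_real// lerDl sqr_ge0.
Qed.

Lemma normc_Im z : `|Im z| <= normc z.
Proof.
by rewrite -(@ler_pXn2r _ 2) ?nnegrE ?normc_ge0 ?normr_ge0//
  sqr_normcE real_normK ?num_real// lerDr sqr_ge0.
Qed.

Lemma normc_le_ReIm z : normc z <= `|Re z| + `|Im z|.
Proof.
rewrite -(@ler_pXn2r _ 2) ?nnegrE ?normc_ge0 ?addr_ge0 ?normr_ge0//.
rewrite sqr_normcE -(real_normK (num_real (Re z))) -(real_normK (num_real (Im z))).
by rewrite sqrrD lerD2r lerDl mulrn_wge0 ?mulr_ge0.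
Qed.

Lemma normc_real (x : R) : normc (x%:C)%C = `|x|.
Proof. by rewrite /normc /= expr0n addr0 sqrtr_sqr. Qed.

Lemma mulcJE z : z * conjc z = ((normc z ^+ 2)%:C)%C.
Proof.
apply: complex_eq; rewrite ?sqr_normcE /= ?cReM ?cImM ?cReJ ?cImJ; first by ring.
by ring.
Qed.

Lemma normc_eq0P z : normc z = 0 -> z = 0. Proof. exact: eq0_normc. Qed.

Lemma normc_sq0 z : normc z ^+ 2 = 0 -> z = 0.
Proof. by move=> /eqP; rewrite sqrf_eq0 => /eqP /normc_eq0P. Qed.

Lemma normcD_le z w : normc (z + w) <= normc z + normc w.
Proof. exact: le_normcD. Qed.

Lemma normc_opp z : normc (- z) = normc z.
Proof. exact: normcN. Qed.

Lemma normc_sum_le I (r : seq I) (Q : pred I) (f : I -> R[i]) :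
  normc (\sum_(i <- r | Q i) f i) <= \sum_(i <- r | Q i) normc (f i).
Proof.
elim/big_rec2 : _ => [|i x y _ le]; first by rewrite normc0.
by rewrite (le_trans (normcD_le _ _))// lerD2l.
Qed.

Lemma sqr_normcD_le z w : normc (z + w) ^+ 2 <= 2 * (normc z ^+ 2 + normc w ^+ 2).
Proof.
rewrite !sqr_normcE cReD cImD.
have := sqr_ge0 (Re z - Re w); have := sqr_ge0 (Im z - Im w).
by rewrite !sqrrD !sqrrN; lra.
Qed.

Lemma cisD (x y : R) : cis (x + y) = cis x * cis y.
Proof. by apply: complex_eq; rewrite ?cReM ?cImM /= ?cosD ?sinD; ring. Qed.
Lemma cis0 : cis (0 : R) = 1. Proof. by rewrite /cis cos0 sin0. Qed.
Lemma cisJ (x : R) : conjc (cis x) = cis (- x).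
Proof. by rewrite /cis /= cosN sinN. Qed.
Lemma normc_cis (x : R) : normc (cis x) = 1.
Proof. by rewrite /normc /cis cos2Dsin2 sqrtr1. Qed.
(** Componentwise convergence, as [R[i]] is used here without a topology. *)
Definition ccvg s (l : R[i]) : Prop :=
  (Re (s n) @[n --> \oo] --> Re l) /\ (Im (s n) @[n --> \oo] --> Im l).

Lemma ccvg_unique s l l' : ccvg s l -> ccvg s l' -> l = l'.
Proof.
by move=> [r1 i1] [r2 i2]; apply: complex_eq; [apply: cvg_unique r1 r2|apply: cvg_unique i1 i2].
Qed.

Lemma ccvg_cst l : ccvg (fun=> l) l.
Proof. by split; exact: cvg_cst. Qed.

Lemma ccvgD s l s' l' : ccvg s l -> ccvg s' l' -> ccvg (fun n => s n + s' n) (l + l').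
Proof.
move=> [a b] [a' b']; split; rewrite ?cReD ?cImD.
  by under eq_fun do rewrite cReD; exact: cvgD.
by under eq_fun do rewrite cImD; exact: cvgD.
Qed.

Lemma ccvgM s l s' l' : ccvg s l -> ccvg s' l' -> ccvg (fun n => s n * s' n) (l * l').
Proof.
move=> [a b] [a' b']; split; rewrite ?cReM ?cImM.
  by under eq_fun do rewrite cReM; apply: cvgB; exact: cvgM.
by under eq_fun do rewrite cImM; apply: cvgD; exact: cvgM.
Qed.

Lemma ccvgJ s l : ccvg s l -> ccvg (fun n => conjc (s n)) (conjc l).
Proof.
move=> [a b]; split; rewrite ?cReJ ?cImJ.
  by under eq_fun do rewrite cReJ.
by under eq_fun do rewrite cImJ; exact: cvgN.
Qed.

Lemma ccvgZ c s l : ccvg s l -> ccvg (fun n => c * s n) (c * l).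
Proof. exact: (ccvgM (ccvg_cst c)). Qed.

Lemma ccvgN s l : ccvg s l -> ccvg (fun n => - s n) (- l).
Proof.
move=> /(ccvgZ (-1)); rewrite mulN1r.
by under eq_fun do rewrite mulN1r.
Qed.

Lemma ccvg_squeeze s l (e : nat -> R) :
  (forall n, normc (s n - l) <= e n) -> e n @[n --> \oo] --> (0 : R) -> ccvg s l.
Proof.
move=> le e0; split; apply/subr_cvg0; apply/norm_cvg0P.
  apply: (@squeeze_cvgr _ _ _ _ (fun=> 0) e) => //; last exact: cvg_cst.
  apply: nearW => n; rewrite normr_ge0 /= (le_trans _ (le n))//.
  by rewrite -cReN -cReD normc_Re.
apply: (@squeeze_cvgr _ _ _ _ (fun=> 0) e) => //; last exact: cvg_cst.
apply: nearW => n; rewrite normr_ge0 /= (le_trans _ (le n))//.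
by rewrite -cImN -cImD normc_Im.
Qed.

Lemma ccvg_normc_sub s l : ccvg s l -> normc (s n - l) @[n --> \oo] --> (0 : R).
Proof.
move=> [a b].
have h : `|Re (s n) - Re l| + `|Im (s n) - Im l| @[n --> \oo] --> (0 : R).
  by rewrite -(addr0 0); apply: cvgD; apply/norm_cvg0P/subr_cvg0.
apply: (@squeeze_cvgr _ _ _ _ (fun=> 0) _ _ _ _ _ h); last exact: cvg_cst.
apply: nearW => n; rewrite normc_ge0 /= (le_trans (normc_le_ReIm _))//.
by rewrite cReD cImD cReN cImN.
Qed.

Lemma ccvg_shift k s l : ccvg s l -> ccvg (fun n => s (n + k)%N) l.
Proof. move=> [a b]; split.
  by rewrite (cvg_shiftn k (fun n => Re (s n)) (nbhs (Re l))).
by rewrite (cvg_shiftn k (fun n => Im (s n)) (nbhs (Im l))). Qed.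

Lemma ccvg_eq s s' l : (forall n, s n = s' n) -> ccvg s l -> ccvg s' l.
Proof. by move=> e; rewrite (_ : s = s')//; apply/funext. Qed.

Lemma ccvg_normc_le s l (K : R) : (forall n, normc (s n) <= K) -> ccvg s l -> normc l <= K.
Proof.
move=> le /ccvg_normc_sub h.
apply/ler_addgt0Pr => e e0.
have /cvgrPdist_lt /(_ _ e0) [N _ /(_ N (leqnn N))] := h.
rewrite sub0r normrN ger0_norm ?normc_ge0// => lt.
rewrite -(subrK (s N) l) (le_trans (normcD_le _ _))// addrC lerD//.
by rewrite -normc_opp opprB ltW.
Qed.

Lemma ccvg_normc2 s l : ccvg s l -> normc (s n) ^+ 2 @[n --> \oo] --> normc l ^+ 2.
Proof.
move=> [a b]; rewrite sqr_normcE; under eq_fun do rewrite sqr_normcE.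
by apply: cvgD; apply: cvgM.
Qed.

Lemma cvg_realC (u : nat -> R) (l : R) : u n @[n --> \oo] --> l -> ccvg (fun n => ((u n)%:C)%C) (l%:C)%C.
Proof. by move=> ul; split => //=; exact: cvg_cst. Qed.

Lemma cvg_sqrt0 (u : nat -> R) : u n @[n --> \oo] --> (0 : R) ->
  Num.sqrt (u n) @[n --> \oo] --> (0 : R).
Proof.
move=> u0; rewrite -[X in _ --> X](sqrtr0 R).
exact: (cvg_comp _ _ u0 (@sqrt_continuous R 0)).
Qed.

End ComplexFacts.
#[global] Hint Extern 0 (is_true (0 <= normc _)) => exact: normc_ge0 : core.

Section ComplexIntegral.
Context (d : measure_display) (U : measurableType d) (R : realType).
Implicit Types (f g : U -> R[i]) (D : set U).

Lemma cmeasurable_cst D c : cmeasurable D (fun=> c : R[i]).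
Proof. by split; exact: measurable_cst. Qed.

Lemma cmeasurableD D f g : cmeasurable D f -> cmeasurable D g ->
  cmeasurable D (fun x => f x + g x).
Proof.
move=> [a b] [a' b']; split.
  by under eq_fun do rewrite cReD; exact: measurable_funD.
by under eq_fun do rewrite cImD; exact: measurable_funD.
Qed.

Lemma cmeasurableM D f g : cmeasurable D f -> cmeasurable D g ->
  cmeasurable D (fun x => f x * g x).
Proof.
move=> [a b] [a' b']; split.
  by under eq_fun do rewrite cReM; apply: measurable_funB; exact: measurable_funM.
by under eq_fun do rewrite cImM; apply: measurable_funD; exact: measurable_funM.
Qed.

Lemma cmeasurableZ D c f : cmeasurable D f -> cmeasurable D (fun x => c * f x).
Proof. by apply: cmeasurableM; exact: cmeasurable_cst. Qed.

Lemma cmeasurableJ D f : cmeasurable D f -> cmeasurable D (fun x => conjc (f x)).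
Proof.
move=> [a b]; split.
  by under eq_fun do rewrite cReJ.
by under eq_fun do rewrite cImJ; exact: measurable_funN.
Qed.

Lemma cmeasurableB D f g : cmeasurable D f -> cmeasurable D g ->
  cmeasurable D (fun x => f x - g x).
Proof.
move=> mf /(cmeasurableZ (-1)) mg.
by under eq_fun do rewrite -mulN1r; exact: cmeasurableD.
Qed.

Lemma cmeasurable_sum D I (r : seq I) (Q : pred I) (f : I -> U -> R[i]) :
  (forall i, cmeasurable D (f i)) ->
  cmeasurable D (fun x => \sum_(i <- r | Q i) f i x).
Proof.
move=> mf; elim: r => [|i r ih].
  by under eq_fun do rewrite big_nil; exact: cmeasurable_cst.
under eq_fun do rewrite big_cons; case: (Q i) => //.
exact: cmeasurableD.
Qed.

Lemma cmeasurable_real D (u : U -> R) : measurable_fun D u -> cmeasurable D (fun x => ((u x)%:C)%C).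
Proof. by move=> mu; split => //=; exact: measurable_cst. Qed.

Lemma measurable_normc2 D f : cmeasurable D f ->
  measurable_fun D (fun x => normc (f x) ^+ 2).
Proof.
move=> [a b]; under eq_fun do rewrite sqr_normcE.
by apply: measurable_funD; exact: measurable_funX.
Qed.

Lemma measurable_normc D f : cmeasurable D f -> measurable_fun D (fun x => normc (f x)).
Proof.
move=> mf; rewrite (_ : (fun _ => _) = (@Num.sqrt R) \o (fun x => normc (f x) ^+ 2)); last first.
  by apply/funext => x /=; rewrite sqrtr_sqr ger0_norm.
apply: measurableT_comp; last exact: measurable_normc2.
exact: continuous_measurable_fun (@sqrt_continuous R).
Qed.

Lemma cmeasurable_eq D f g : (forall x, D x -> f x = g x) ->
  cmeasurable D f -> cmeasurable D g.
Proof.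
move=> e [a b]; split.
  by apply: eq_measurable_fun a => x /set_mem Dx; rewrite e.
by apply: eq_measurable_fun b => x /set_mem Dx; rewrite e.
Qed.

Lemma cmeasurable_cvg D (f_ : nat -> U -> R[i]) f :
  measurable D -> (forall n, cmeasurable D (f_ n)) ->
  (forall x, D x -> ccvg (f_ ^~ x) (f x)) -> cmeasurable D f.
Proof.
move=> mD mf h; split.
  by apply: (measurable_fun_cvg (fun n => (mf n).1)) => x Dx; case: (h x Dx).
by apply: (measurable_fun_cvg (fun n => (mf n).2)) => x Dx; case: (h x Dx).
Qed.

Lemma cmeasurable_if D (G : set U) f : measurable G -> cmeasurable D f ->
  cmeasurable D (fun x => if x \in G then f x else 0).
Proof.
move=> mG mf; apply: (@cmeasurable_eq _ (fun x => ((\1_G x : R)%:C)%C * f x)).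
  by move=> x _; rewrite indicE; case: (x \in G); rewrite ?mul1r ?mul0r.
by apply: cmeasurableM => //; apply: cmeasurable_real; exact: measurable_indic.
Qed.

Variable mu : {measure set U -> \bar R}.

(** [filterS] with the filter determined by the measure in the statement, also
    for [leb], which is a measure on an alias of [R]. *)
Lemma aeS1 (P W : U -> Prop) : (forall x, P x -> W x) ->
  {ae mu, forall x, P x} -> {ae mu, forall x, W x}.
Proof. exact: filterS. Qed.

Lemma aeS2 (P Q W : U -> Prop) : (forall x, P x -> Q x -> W x) ->
  {ae mu, forall x, P x} -> {ae mu, forall x, Q x} -> {ae mu, forall x, W x}.
Proof. exact: filterS2. Qed.

Lemma aeS3 (P Q V W : U -> Prop) : (forall x, P x -> Q x -> V x -> W x) ->
  {ae mu, forall x, P x} -> {ae mu, forall x, Q x} -> {ae mu, forall x, V x} ->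
  {ae mu, forall x, W x}.
Proof. exact: filterS3. Qed.

Definition cintegrable D f : Prop :=
  mu.-integrable D (fun x => (complex.Re (f x))%:E) /\
  mu.-integrable D (fun x => (complex.Im (f x))%:E).

Section OnD.
Variable D : set U.
Hypothesis mD : measurable D.
Local Notation cint := (cintegral mu D).

Lemma cintegrable_cmeasurable f : cintegrable D f -> cmeasurable D f.
Proof. by move=> [/measurable_int/measurable_EFinP a /measurable_int/measurable_EFinP b]. Qed.

Lemma cintegrable_le f (g : U -> R) : cmeasurable D f ->
  mu.-integrable D (fun x => (g x)%:E) ->
  (forall x, D x -> normc (f x) <= g x) -> cintegrable D f.
Proof.
move=> [a b] ig le; split; apply: le_integrable ig => //; try exact/measurable_EFinP.
  move=> x Dx; rewrite /= lee_fin (le_trans (normc_Re _))// (le_trans (le x Dx))//.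
  exact: ler_norm.
move=> x Dx; rewrite /= lee_fin (le_trans (normc_Im _))// (le_trans (le x Dx))//.
exact: ler_norm.
Qed.

Lemma integrable_scale (k : R) (u : U -> R) :
  mu.-integrable D (fun x => (u x)%:E) -> mu.-integrable D (fun x => (k * u x)%:E).
Proof.
by move=> h; rewrite (_ : (fun _ => _) = (fun x => k%:E * (u x)%:E)%E)//; exact: integrableZl.
Qed.

Lemma cintegrable_norm f : cintegrable D f -> mu.-integrable D (fun x => (normc (f x))%:E).
Proof.
move=> fi; have [mf [a b]] := (cintegrable_cmeasurable fi, fi).
have := integrableD mD (integrable_norm a) (integrable_norm b).
apply: le_integrable => //; first exact/measurable_EFinP/measurable_normc.
move=> x Dx /=; rewrite lee_fin (ger0_norm (normc_ge0 _)) (le_trans (normc_le_ReIm _))//.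
exact: ler_norm.
Qed.

Lemma cintegrableD f g : cintegrable D f -> cintegrable D g -> cintegrable D (fun x => f x + g x).
Proof.
move=> [a b] [a' b']; split.
  by under eq_fun do rewrite cReD EFinD; exact: integrableD.
by under eq_fun do rewrite cImD EFinD; exact: integrableD.
Qed.

Lemma cintegrableZ c f : cintegrable D f -> cintegrable D (fun x => c * f x).
Proof.
move=> fi; have mf := cintegrable_cmeasurable fi.
apply: (@cintegrable_le _ (fun x => normc c * normc (f x))); first exact: cmeasurableZ.
  by apply: integrable_scale; exact: cintegrable_norm.
by move=> x _; rewrite normcM.
Qed.

Lemma cintegrable_sum I (r : seq I) (Q : pred I) (f : I -> U -> R[i]) :
  (forall i, cintegrable D (f i)) -> cintegrable D (fun x => \sum_(i <- r | Q i) f i x).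
Proof.
move=> h; elim: r => [|i r ih].
  by under eq_fun do rewrite big_nil; split; exact: integrable0.
by under eq_fun do rewrite big_cons; case: (Q i) => //; exact: cintegrableD.
Qed.

Lemma cintegralD f g : cintegrable D f -> cintegrable D g ->
  cint (fun x => f x + g x) = cint f + cint g.
Proof.
move=> [a b] [a' b']; rewrite /cintegral; apply: complex_eq => /=.
  by under eq_Rintegral do rewrite cReD; rewrite RintegralD.
by under eq_Rintegral do rewrite cImD; rewrite RintegralD.
Qed.

Lemma cintegralZ c f : cintegrable D f -> cint (fun x => c * f x) = c * cint f.
Proof.
move=> [a b]; rewrite /cintegral; apply: complex_eq; rewrite ?cReM ?cImM /=.
  under eq_Rintegral do rewrite cReM.
  by rewrite RintegralB ?RintegralZl//; exact: integrable_scale.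
under eq_Rintegral do rewrite cImM.
by rewrite RintegralD ?RintegralZl//; exact: integrable_scale.
Qed.

Lemma cintegralJ f : cintegrable D f -> cint (fun x => conjc (f x)) = conjc (cint f).
Proof.
move=> [a b]; rewrite /cintegral; apply: complex_eq; rewrite ?cReJ ?cImJ /=.
  by under eq_Rintegral do rewrite cReJ.
under eq_Rintegral do rewrite cImJ -mulN1r.
by rewrite RintegralZl// mulN1r.
Qed.

Lemma cintegral_sum I (r : seq I) (Q : pred I) (f : I -> U -> R[i]) :
  (forall i, cintegrable D (f i)) ->
  cint (fun x => \sum_(i <- r | Q i) f i x) = \sum_(i <- r | Q i) cint (f i).
Proof.
move=> h; elim: r => [|i r ih].
  under eq_fun do rewrite big_nil; rewrite big_nil /cintegral.
  by apply: complex_eq; rewrite /= Rintegral_cst// mul0r.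
under eq_fun do rewrite big_cons; rewrite big_cons; case: (Q i) => //.
by rewrite cintegralD ?ih//; exact: cintegrable_sum.
Qed.

Lemma eq_cintegral f g : (forall x, D x -> f x = g x) -> cint f = cint g.
Proof.
by move=> e; rewrite /cintegral; congr Complex; apply: eq_Rintegral => x /set_mem Dx; rewrite e.
Qed.

Lemma ae_eq_cintegral f g : cmeasurable D f -> cmeasurable D g ->
  {ae mu, forall x, D x -> f x = g x} -> cint f = cint g.
Proof.
move=> [a b] [a' b'] e; rewrite /cintegral; congr Complex; congr fine.
  apply: ae_eq_integral => //; try exact/measurable_EFinP.
  by apply: filterS e => x h Dx; rewrite h.
apply: ae_eq_integral => //; try exact/measurable_EFinP.
by apply: filterS e => x h Dx; rewrite h.
Qed.

Lemma Rdominated_convergence_ae (u_ : nat -> U -> R) (u g : U -> R) :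
  (forall n, measurable_fun D (u_ n)) -> measurable_fun D u ->
  {ae mu, forall x, D x -> u_ n x @[n --> \oo] --> u x} ->
  mu.-integrable D (fun x => (g x)%:E) ->
  (forall n x, D x -> `|u_ n x| <= g x) ->
  mu.-integrable D (fun x => (u x)%:E) /\
  \int[mu]_(x in D) u_ n x @[n --> \oo] --> \int[mu]_(x in D) u x.
Proof.
move=> mu_ mu0 h ig le.
have [||||ui _ c] := @dominated_convergence _ _ _ mu D mD
    (fun n x => (u_ n x)%:E) (fun x => (u x)%:E) (fun x => (g x)%:E) _ _ _ ig.
- by move=> n; exact/measurable_EFinP.
- exact/measurable_EFinP.
- apply: filterS h => x h Dx; apply/fine_cvgP; split; first exact: nearW.
  exact: (h Dx).
- by apply: aeW => x n Dx; rewrite lee_fin le.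
split => //; rewrite /Rintegral; apply: fine_cvg; rewrite fineK//.
exact: integrable_fin_num.
Qed.

Lemma cdominated_convergence_ae (f_ : nat -> U -> R[i]) f (g : U -> R) :
  (forall n, cmeasurable D (f_ n)) -> cmeasurable D f ->
  {ae mu, forall x, D x -> ccvg (f_ ^~ x) (f x)} ->
  mu.-integrable D (fun x => (g x)%:E) ->
  (forall n x, D x -> normc (f_ n x) <= g x) ->
  ccvg (fun n => cint (f_ n)) (cint f).
Proof.
move=> mf_ mf h ig le; split.
  apply: (Rdominated_convergence_ae (fun n => (mf_ n).1) mf.1 _ ig _).2.
    by apply: filterS h => x h Dx; case: (h Dx).
  by move=> n x Dx; exact: le_trans (normc_Re _) (le n x Dx).
apply: (Rdominated_convergence_ae (fun n => (mf_ n).2) mf.2 _ ig _).2.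
  by apply: filterS h => x h Dx; case: (h Dx).
by move=> n x Dx; exact: le_trans (normc_Im _) (le n x Dx).
Qed.

Lemma cdominated_convergence (f_ : nat -> U -> R[i]) f (g : U -> R) :
  (forall n, cmeasurable D (f_ n)) ->
  (forall x, D x -> ccvg (f_ ^~ x) (f x)) ->
  mu.-integrable D (fun x => (g x)%:E) ->
  (forall n x, D x -> normc (f_ n x) <= g x) ->
  ccvg (fun n => cint (f_ n)) (cint f).
Proof.
move=> mf_ h ig le; apply: cdominated_convergence_ae ig le => //; last exact: aeW.
exact: cmeasurable_cvg h.
Qed.

End OnD.
End ComplexIntegral.

Lemma Rintegral_sum (d : measure_display) (U : measurableType d) (R : realType)
    (mu : {measure set U -> \bar R}) (D : set U) I (r : seq I) (f : I -> U -> R) : measurable D ->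
  (forall i, mu.-integrable D (fun x => (f i x)%:E)) ->
  mu.-integrable D (fun x => (\sum_(i <- r) f i x)%:E) /\
  \int[mu]_(x in D) (\sum_(i <- r) f i x) = \sum_(i <- r) \int[mu]_(x in D) f i x.
Proof.
move=> mD fi; elim: r => [|i r [ih1 ih2]].
  under eq_fun do rewrite big_nil; under eq_Rintegral do rewrite big_nil.
  by rewrite big_nil Rintegral_cst// mul0r; split => //; exact: integrable0.
under eq_fun do rewrite big_cons; under eq_Rintegral do rewrite big_cons.
split; last by rewrite big_cons -ih2; exact: (@RintegralD _ _ _ mu D (f i) (fun x => \sum_(j <- r) f j x) mD (fi i) ih1).
by under eq_fun do rewrite EFinD; exact: integrableD.
Qed.

Lemma Rcvg_le (R : realType) (u : nat -> R) (l K : R) :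
  (forall n, u n <= K) -> u n @[n --> \oo] --> l -> l <= K.
Proof.
move=> uK c; rewrite -(cvg_lim _ c)//; apply: limr_le; last exact: nearW.
by apply/cvg_ex; exists l.
Qed.

(** * Square-integrable functions *)

Definition ip (d : measure_display) (U : measurableType d) (R : realType)
    (mu : {measure set U -> \bar R}) (D : set U) (f g : U -> R[i]) : R[i] :=
  cintegral mu D (fun x => f x * conjc (g x)).

Definition nsq (d : measure_display) (U : measurableType d) (R : realType)
    (mu : {measure set U -> \bar R}) (D : set U) (f : U -> R[i]) : R :=
  \int[mu]_(x in D) (normc (f x) ^+ 2).

Section L2Theory.
Context (d : measure_display) (U : measurableType d) (R : realType).
Variables (mu : {measure set U -> \bar R}) (D : set U).
Hypothesis mD : measurable D.
Implicit Types (f g h : U -> R[i]).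
Local Notation L := (L2 mu D).
Local Notation ip := (ip mu D).
Local Notation nsq := (nsq mu D).

Lemma L2_meas f : L f -> cmeasurable D f. Proof. by case. Qed.

Lemma L2_int f : L f -> mu.-integrable D (fun x => (normc (f x) ^+ 2)%:E).
Proof.
move=> [mf fi]; apply/integrableP; split; first exact/measurable_EFinP/measurable_normc2.
by under eq_integral do rewrite gee0_abs ?lee_fin ?sqr_ge0//.
Qed.

Lemma L2I f : cmeasurable D f -> mu.-integrable D (fun x => (normc (f x) ^+ 2)%:E) -> L f.
Proof.
move=> mf /integrableP[_ fi]; split => //; rewrite /L2normsq.
by move: fi; under eq_integral do rewrite gee0_abs ?lee_fin ?sqr_ge0//.
Qed.

Lemma L2normsqE f : L f -> L2normsq mu D f = (nsq f)%:E.
Proof. by move=> Lf; rewrite /nsq /Rintegral fineK//; exact: integrable_fin_num (L2_int Lf). Qed.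

Lemma nsq_ge0 f : 0 <= nsq f.
Proof. by apply: Rintegral_ge0 => x _; exact: sqr_ge0. Qed.

Lemma L2_le K f (u : U -> R) : cmeasurable D f -> mu.-integrable D (fun x => (u x)%:E) ->
  (forall x, D x -> normc (f x) ^+ 2 <= K * u x) -> L f.
Proof.
move=> mf ui le; apply: L2I => //.
apply: le_integrable (integrable_scale mD K ui) => //.
  exact/measurable_EFinP/measurable_normc2.
move=> x Dx; rewrite !abse_EFin lee_fin ger0_norm ?sqr_ge0// (le_trans (le x Dx))//.
exact: ler_norm.
Qed.

Lemma L2_le_ae K f (u : U -> R) : cmeasurable D f -> mu.-integrable D (fun x => (u x)%:E) ->
  {ae mu, forall x, D x -> normc (f x) ^+ 2 <= K * u x} -> L f.
Proof.
move=> mf ui le; split => //.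
have /integrableP[mu0 ui0] := integrable_scale mD K ui.
apply: le_lt_trans ui0; apply: ae_ge0_le_integral => //.
- by move=> x _; rewrite lee_fin sqr_ge0.
- exact/measurable_EFinP/measurable_normc2.
- exact: measurableT_comp.
- apply: filterS le => x h Dx; rewrite abse_EFin lee_fin (le_trans (h Dx))//.
  exact: ler_norm.
Qed.

Lemma cintegrable_le_ae f (u : U -> R) : cmeasurable D f ->
  mu.-integrable D (fun x => (u x)%:E) ->
  {ae mu, forall x, D x -> normc (f x) <= u x} -> cintegrable mu D f.
Proof.
move=> [m1 m2] /integrableP[mu0 ui0] le.
split; apply/integrableP; (split; first exact/measurable_EFinP);
    apply: le_lt_trans ui0; apply: ae_ge0_le_integral => //;
    try by apply: measurableT_comp => //; exact/measurable_EFinP.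
- apply: filterS le => x h Dx; rewrite !abse_EFin lee_fin (le_trans (normc_Re _))//.
  by rewrite (le_trans (h Dx))// ler_norm.
- apply: filterS le => x h Dx; rewrite !abse_EFin lee_fin (le_trans (normc_Im _))//.
  by rewrite (le_trans (h Dx))// ler_norm.
Qed.

Lemma L2_eq f g : (forall x, D x -> f x = g x) -> L f -> L g.
Proof.
move=> e Lf; apply: (@L2_le 1 _ (fun x => normc (f x) ^+ 2)).
- exact: cmeasurable_eq e (L2_meas Lf).
- exact: L2_int.
- by move=> x Dx; rewrite e// mul1r.
Qed.

Lemma L2_bounded (K : R) (b : U -> R[i]) f : cmeasurable D b -> L f ->
  (forall x, D x -> normc (b x) <= K) -> L (fun x => b x * f x).
Proof.
move=> mb Lf le; apply: (@L2_le (K ^+ 2) _ (fun x => normc (f x) ^+ 2)).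
- by apply: cmeasurableM => //; exact: L2_meas.
- exact: L2_int.
- move=> x Dx; rewrite normcM exprMn ler_wpM2r ?sqr_ge0//.
  have K0 : 0 <= K by exact: le_trans (le x Dx).
  by rewrite ler_pXn2r ?nnegrE// le.
Qed.

Lemma L2Z c f : L f -> L (fun x => c * f x).
Proof. by move=> Lf; apply: (@L2_bounded (normc c)) => //; exact: cmeasurable_cst. Qed.

Lemma L2D f g : L f -> L g -> L (fun x => f x + g x).
Proof.
move=> Lf Lg.
apply: (@L2_le 2 _ (fun x => normc (f x) ^+ 2 + normc (g x) ^+ 2)).
- by apply: cmeasurableD; exact: L2_meas.
- by under eq_fun do rewrite EFinD; apply: integrableD => //; exact: L2_int.
- by move=> x _; exact: sqr_normcD_le.
Qed.

Lemma L2B f g : L f -> L g -> L (fun x => f x - g x).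
Proof.
move=> Lf Lg; have := L2D Lf (L2Z (-1) Lg).
by under eq_fun do rewrite mulN1r.
Qed.

Lemma L2_0 : L (fun=> 0).
Proof.
apply: L2I; first exact: cmeasurable_cst.
by rewrite normc0 expr0n; exact: integrable0.
Qed.

Lemma L2_sum I (r : seq I) (Q : pred I) (f : I -> U -> R[i]) :
  (forall i, L (f i)) -> L (fun x => \sum_(i <- r | Q i) f i x).
Proof.
move=> Lf; elim: r => [|i r ih].
  by under eq_fun do rewrite big_nil; exact: L2_0.
by under eq_fun do rewrite big_cons; case: (Q i) => //; exact: L2D.
Qed.

Lemma L2_mulJ f g : L f -> L g -> cintegrable mu D (fun x => f x * conjc (g x)).
Proof.
move=> Lf Lg.
apply: (@cintegrable_le _ _ _ _ _ mD _ (fun x => normc (f x) ^+ 2 + normc (g x) ^+ 2)).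
- by apply: cmeasurableM; [exact: L2_meas|exact/cmeasurableJ/L2_meas].
- by under eq_fun do rewrite EFinD; apply: integrableD => //; exact: L2_int.
- move=> x _; rewrite normcM normc_conj.
  have := sqr_ge0 (normc (f x) - normc (g x)); have := normc_ge0 (f x).
  have := normc_ge0 (g x); move: (normc _) (normc _) => a b a0 b0.
  by rewrite sqrrB; have := mulr_ge0 a0 b0; lra.
Qed.

Lemma ipJ f g : L f -> L g -> conjc (ip f g) = ip g f.
Proof.
move=> Lf Lg; rewrite /ip -cintegralJ//; last exact: L2_mulJ.
by apply: eq_cintegral => x _; rewrite conjcM conjcK mulrC.
Qed.

Lemma ipDl f g h : L f -> L g -> L h -> ip (fun x => f x + g x) h = ip f h + ip g h.
Proof.
move=> Lf Lg Lh; rewrite /ip -cintegralD//; try exact: L2_mulJ.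
by apply: eq_cintegral => x _; rewrite mulrDl.
Qed.

Lemma ipZl c f g : L f -> L g -> ip (fun x => c * f x) g = c * ip f g.
Proof.
move=> Lf Lg; rewrite /ip -cintegralZ//; last exact: L2_mulJ.
by apply: eq_cintegral => x _; rewrite mulrA.
Qed.

Lemma ipZr c f g : L f -> L g -> ip f (fun x => c * g x) = conjc c * ip f g.
Proof.
by move=> Lf Lg; rewrite -[LHS]ipJ ?ipZl ?conjcM ?ipJ//; exact: L2Z.
Qed.

Lemma ipDr f g h : L f -> L g -> L h -> ip h (fun x => f x + g x) = ip h f + ip h g.
Proof.
by move=> Lf Lg Lh; rewrite -[LHS]ipJ ?ipDl ?conjcD ?ipJ//; exact: L2D.
Qed.

Lemma ipBl f g h : L f -> L g -> L h -> ip (fun x => f x - g x) h = ip f h - ip g h.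
Proof.
move=> Lf Lg Lh; rewrite -mulN1r -ipZl// -ipDl//; last exact: L2Z.
by apply: eq_cintegral => x _; rewrite mulN1r.
Qed.

Lemma ipBr f g h : L f -> L g -> L h -> ip h (fun x => f x - g x) = ip h f - ip h g.
Proof.
by move=> Lf Lg Lh; rewrite -[LHS]ipJ ?ipBl ?conjcB ?ipJ//; exact: L2B.
Qed.

Lemma ip_suml I (r : seq I) (Q : pred I) (f : I -> U -> R[i]) g :
  (forall i, L (f i)) -> L g ->
  ip (fun x => \sum_(i <- r | Q i) f i x) g = \sum_(i <- r | Q i) ip (f i) g.
Proof.
move=> Lf Lg; rewrite /ip -cintegral_sum//; last by move=> i; exact: L2_mulJ.
by apply: eq_cintegral => x _; rewrite mulr_suml.
Qed.

Lemma ip_sumr I (r : seq I) (Q : pred I) (f : I -> U -> R[i]) g :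
  (forall i, L (f i)) -> L g ->
  ip g (fun x => \sum_(i <- r | Q i) f i x) = \sum_(i <- r | Q i) ip g (f i).
Proof.
move=> Lf Lg; rewrite -[LHS]ipJ// ?ip_suml ?conjc_sum//; last exact: L2_sum.
by apply: eq_bigr => i _; rewrite ipJ.
Qed.

Lemma eq_ip f f' g g' : (forall x, D x -> f x = f' x) -> (forall x, D x -> g x = g' x) ->
  ip f g = ip f' g'.
Proof. by move=> ef eg; apply: eq_cintegral => x Dx; rewrite ef// eg. Qed.

Lemma eq_nsq f g : (forall x, D x -> f x = g x) -> nsq f = nsq g.
Proof. by move=> e; apply: eq_Rintegral => x /set_mem Dx; rewrite e. Qed.

Lemma ipxx f : L f -> ip f f = ((nsq f)%:C)%C.
Proof.
move=> Lf; rewrite /ip /cintegral; apply: complex_eq => /=.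
  by apply: eq_Rintegral => x _; rewrite mulcJE.
rewrite (@eq_Rintegral _ _ _ _ _ (cst 0)) ?Rintegral_cst ?mul0r// => x _.
by rewrite mulcJE.
Qed.

Lemma nsqB f g : L f -> L g ->
  nsq (fun x => f x - g x) = nsq f - 2 * complex.Re (ip f g) + nsq g.
Proof.
move=> Lf Lg; apply: complexI; rewrite -ipxx; last exact: L2B.
rewrite ipBl// ?ipBr//; last exact: L2B.
rewrite !ipxx// -(ipJ Lf Lg); case: (ip f g) => a b.
by apply: complex_eq => /=; ring.
Qed.

Lemma nsqD f g : L f -> L g ->
  nsq (fun x => f x + g x) = nsq f + 2 * complex.Re (ip f g) + nsq g.
Proof.
move=> Lf Lg; apply: complexI; rewrite -ipxx; last exact: L2D.
rewrite ipDl// ?ipDr//; last exact: L2D.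
rewrite !ipxx// -(ipJ Lf Lg); case: (ip f g) => a b.
by apply: complex_eq => /=; ring.
Qed.

Lemma nsqZ c f : L f -> nsq (fun x => c * f x) = normc c ^+ 2 * nsq f.
Proof.
move=> Lf; rewrite /nsq -RintegralZl//; last exact: L2_int.
by apply: eq_Rintegral => x _; rewrite normcM exprMn.
Qed.

Lemma nsqBC f g : nsq (fun x => f x - g x) = nsq (fun x => g x - f x).
Proof. by apply: eq_Rintegral => x _; rewrite -normc_opp opprB. Qed.

Lemma le_nsq f g : L f -> L g -> (forall x, D x -> normc (f x) <= normc (g x)) ->
  nsq f <= nsq g.
Proof.
move=> Lf Lg le; apply: le_Rintegral => //; try exact: L2_int.
move=> x Dx; rewrite -subr_ge0 subr_sqr mulr_ge0 ?subr_ge0 ?addr_ge0//.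
exact: le.
Qed.

(** The discriminant argument for the multiples of [g] by [t * ip f g], with [t]
    real: the quadratic polynomial in [t] is nonnegative. *)
Lemma cauchy_schwarz f g : L f -> L g -> normc (ip f g) ^+ 2 <= nsq f * nsq g.
Proof.
move=> Lf Lg; set w := ip f g.
have key t : 0 <= nsq f - 2 * t * normc w ^+ 2 + t ^+ 2 * normc w ^+ 2 * nsq g.
  have := nsq_ge0 (fun x => f x - (t%:C)%C * w * g x).
  rewrite nsqB//; last exact: L2Z.
  rewrite nsqZ// ipZr// -/w normcM normc_real exprMn real_normK ?num_real//.
  rewrite (_ : complex.Re _ = t * normc w ^+ 2); last first.
    by rewrite sqr_normcE; case: (w) => a b /=; ring.
  by rewrite mulrA.
have g0 := nsq_ge0 g; have f0 := nsq_ge0 f; have w0 := sqr_ge0 (normc w).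
have [ge|gz] := ltP 0 (nsq g).
  have := key (nsq g)^-1.
  have e1 : (nsq g)^-1 ^+ 2 * normc w ^+ 2 * nsq g = (nsq g)^-1 * normc w ^+ 2.
    by rewrite expr2; field; rewrite gt_eqF.
  rewrite e1 => h; rewrite -ler_pdivrMr// mulrC; lra.
have gE : nsq g = 0 by apply/eqP; rewrite eq_le gz.
rewrite gE mulr0; rewrite leNgt; apply/negP => wp.
have := key ((nsq f + 1) / normc w ^+ 2).
rewrite gE mulr0 addr0 -mulrA divfK ?gt_eqF//; lra.
Qed.

Lemma normc_ip_le f g : L f -> L g -> normc (ip f g) <= Num.sqrt (nsq f * nsq g).
Proof.
move=> Lf Lg; rewrite -(ger0_norm (normc_ge0 _)) -sqrtr_sqr ler_wsqrtr//.
exact: cauchy_schwarz.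
Qed.

Lemma ae0_nsq f : cmeasurable D f -> {ae mu, forall x, D x -> f x = 0} -> L f /\ nsq f = 0.
Proof.
move=> mf e.
have h : (\int[mu]_(x in D) (normc (f x) ^+ 2)%:E)%E = 0%E.
  rewrite (@ae_eq_integral _ _ _ mu D (cst 0)%E) ?integral0//.
    exact/measurable_EFinP/measurable_normc2.
  by apply: filterS e => x ex Dx; rewrite ex// normc0 expr0n.
split; first by split => //; rewrite /L2normsq h ltry.
by rewrite /nsq /Rintegral h.
Qed.

(** Contrary to [converges], membership of the terms is included: this is what
    passing to the limit in inner products requires. *)
Definition L2cvg (s : nat -> U -> R[i]) (l : U -> R[i]) : Prop :=
  [/\ forall n, L (s n), L l & nsq (fun x => s n x - l x) @[n --> \oo] --> (0 : R)].

Lemma converges_L2P (s : nat -> U -> R[i]) l : (forall n, L (s n)) ->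
  converges L (L2normsq mu D) s l <-> L2cvg s l.
Proof.
move=> Ls; split => [[Ll h]|[_ Ll h]]; split => //.
  have := h; rewrite (_ : (fun n => L2normsq mu D (s n - l)) =
      (fun n => (nsq (fun x => s n x - l x))%:E)); last first.
    by apply/funext => n; rewrite L2normsqE//; exact: L2B.
  by move=> /fine_cvgP[].
rewrite (_ : (fun n => L2normsq mu D (s n - l)) =
    (fun n => (nsq (fun x => s n x - l x))%:E)); last first.
  by apply/funext => n; rewrite L2normsqE//; exact: L2B.
by apply/fine_cvgP; split => //; exact: nearW.
Qed.

Lemma ip_cvgl s l g : L2cvg s l -> L g -> ccvg (fun n => ip (s n) g) (ip l g).
Proof.
move=> [Ls Ll sl] Lg.
apply: (@ccvg_squeeze _ _ _ (fun n => Num.sqrt (nsq (fun x => s n x - l x) * nsq g))).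
  by move=> n; rewrite -ipBl// normc_ip_le//; exact: L2B.
apply: cvg_sqrt0; rewrite -(mul0r (nsq g)).
exact: cvgMl.
Qed.

Lemma ip_cvgr s l g : L2cvg s l -> L g -> ccvg (fun n => ip g (s n)) (ip g l).
Proof.
move=> sl Lg; have [Ls Ll _] := sl; rewrite -ipJ//.
by apply: ccvg_eq (ccvgJ (ip_cvgl sl Lg)) => n; rewrite ipJ.
Qed.

Lemma nsq_cvg s l : L2cvg s l -> nsq (s n) @[n --> \oo] --> nsq l.
Proof.
move=> sl; have [Ls Ll h] := sl.
have E n : nsq (s n) = nsq (fun x => s n x - l x) + 2 * complex.Re (ip (s n) l) - nsq l.
  by rewrite nsqB//; ring.
rewrite (_ : (fun n => _) = (fun n =>
  nsq (fun x => s n x - l x) + 2 * complex.Re (ip (s n) l) - nsq l)); last exact/funext.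
have e : 0 + 2 * complex.Re (ip l l) - nsq l = nsq l by rewrite ipxx//=; ring.
have [re _] := ip_cvgl sl Ll.
suff : nsq (fun x => s n x - l x) + 2 * complex.Re (ip (s n) l) - nsq l @[n --> \oo]
    --> 0 + 2 * complex.Re (ip l l) - nsq l by rewrite e.
by apply: cvgB; [apply: cvgD => //; exact: cvgMr|exact: cvg_cst].
Qed.

Lemma ip_cvg2 r s f g : L2cvg r f -> L2cvg s g -> ccvg (fun n => ip (r n) (s n)) (ip f g).
Proof.
move=> rf sg; have [Lr Lf h1] := rf; have [Ls Lg h2] := sg.
apply: (@ccvg_eq _ (fun n => ip (fun x => r n x - f x) (s n) + ip f (s n))).
  by move=> n; rewrite -ipDl//; [apply: eq_ip => // x _; rewrite subrK|exact: L2B].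
rewrite -[X in ccvg _ X]add0r; apply: ccvgD; last exact: ip_cvgr.
apply: (@ccvg_squeeze _ _ _ (fun n => Num.sqrt (nsq (fun x => r n x - f x) * nsq (s n)))).
  by move=> n; rewrite subr0 normc_ip_le//; exact: L2B.
apply: cvg_sqrt0; rewrite -(mul0r (nsq g)).
by apply: cvgM => //; exact: nsq_cvg.
Qed.

Lemma cvg_geometric_increments (u : nat -> R) (C : R) :
  (forall k, `|u k.+1 - u k| <= C * 2^-1 ^+ k) -> cvgn u.
Proof.
move=> le.
have c : cvgn (series (fun k => C * (2^-1 : R) ^+ k)).
  by apply: is_cvg_geometric_series; rewrite ger0_norm ?invr_ge0// invf_lt1 ?ltr1n.
have : cvgn (series (telescope u)).
  apply: normed_cvg; apply: series_le_cvg c => k /=; rewrite ?normr_ge0//.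
    exact: le_trans (le k).
  exact: le.
rewrite telescopeK => c'.
rewrite (_ : u = (fun n => (u n - u 0%N) + u 0%N)); last by apply/funext => n; rewrite subrK.
by apply: is_cvgD => //; exact: is_cvg_cst.
Qed.

(** Completeness of the space of square-integrable functions: along a fast
    subsequence the squared increments, even weighted by [4 ^+ k], are summable
    almost everywhere, so that the subsequence converges there at a geometric
    rate; Fatou's lemma then gives the convergence in mean square. *)
Lemma L2_complete (s : nat -> U -> R[i]) : (forall n, L (s n)) ->
  (forall e : R, 0 < e -> exists N, forall n m, (N <= n)%N -> (N <= m)%N ->
    nsq (fun x => s n x - s m x) <= e) ->
  exists l, L2cvg s l.
Proof.
move=> Ls cau.
have /choice [N hN] : forall k, exists N, forall n m, (N <= n)%N -> (N <= m)%N ->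
    nsq (fun x => s n x - s m x) <= 16^-1 ^+ k.
  by move=> k; apply: cau; rewrite exprn_gt0// invr_gt0.
(* Monotone in [k] and at least [k], so that the indices along the subsequence
   eventually exceed any given one. *)
pose sub k := \max_(j < k.+1) maxn (N j) j.
have subM k j : (j <= k)%N -> (maxn (N j) j <= sub k)%N.
  by rewrite -ltnS => jk; exact: (@leq_bigmax _ (fun j : 'I_k.+1 => maxn (N j) j) (Ordinal jk)).
have subN k j : (j <= k)%N -> (N j <= sub k)%N.
  by move=> /subM; exact/leq_trans/leq_maxl.
have subk k : (k <= sub k)%N by apply: leq_trans (subM k k (leqnn _)); exact: leq_maxr.
pose dl k x := s (sub k.+1) x - s (sub k) x.
have Ldl k : L (dl k) by exact: L2B.
have dlle k : nsq (dl k) <= 16^-1 ^+ k by apply: hN; exact: subN.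
pose g k x := ((4 ^+ k * normc (dl k x) ^+ 2)%:E : \bar R).
have mg k : measurable_fun D (g k).
  apply/measurable_EFinP/measurable_funM; first exact: measurable_cst.
  exact/measurable_normc2/L2_meas.
have g0 k x : (0 <= g k x)%E by rewrite lee_fin mulr_ge0 ?exprn_ge0 ?sqr_ge0.
have mG : measurable_fun D (fun x => \sum_(0 <= k <oo) g k x)%E.
  exact: ge0_emeasurable_sum.
have iG : (\int[mu]_(x in D) (\sum_(0 <= k <oo) g k x) < +oo)%E.
  rewrite integral_nneseries//.
  apply: (@le_lt_trans _ _ (\sum_(0 <= k <oo) ((4^-1 : R) ^+ k)%:E)%E).
    apply: lee_nneseries => [k _ _|k _]; first exact: integral_ge0.
    rewrite /g; under eq_integral do rewrite EFinM.
    rewrite ge0_integralZl_EFin ?exprn_ge0//; last 2 first.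
    - by move=> x _; rewrite lee_fin sqr_ge0.
    - exact/measurable_EFinP/measurable_normc2/L2_meas.
    have := L2normsqE (Ldl k); rewrite /L2normsq => ->.
    rewrite -EFinM lee_fin (le_trans (ler_wpM2l _ (dlle k))) ?exprn_ge0//.
    by rewrite -exprMn (_ : 4 * 16^-1 = 4^-1)//; field.
  have c : cvgn (series (fun k => 1 * (4^-1 : R) ^+ k)).
    by apply: is_cvg_geometric_series; rewrite ger0_norm ?invr_ge0// invf_lt1 ?ltr1n.
  rewrite (_ : (\sum_(0 <= k <oo) ((4^-1 : R) ^+ k)%:E)%E =
      (limn (series (fun k => 1 * (4^-1 : R) ^+ k)))%:E) ?ltry//.
  rewrite -EFin_lim//; congr (limn _); apply/funext => n /=.
  by rewrite sumEFin /series /=; congr (_%:E); apply: eq_bigr => k _; rewrite mul1r.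
pose G := [set x | D x /\ (\sum_(0 <= k <oo) g k x < +oo)%E].
have mGs : measurable G by exact: emeasurable_fun_infty_o.
have aeG : {ae mu, forall x, D x -> G x}.
  have : mu.-integrable D (fun x => \sum_(0 <= k <oo) g k x)%E.
    apply/integrableP; split => //.
    under eq_integral => x _ do rewrite gee0_abs ?nneseries_ge0//.
    exact: iG.
  move=> /(integrable_ae mD); apply: filterS => x h Dx; split => //.
  by have := h Dx; rewrite ge0_fin_numE// nneseries_ge0.
pose f k x := if x \in G then s (sub k) x else 0.
have cG x : G x -> exists2 C, 0 <= C & forall k, normc (dl k x) <= C * 2^-1 ^+ k.
  move=> [Dx Gx].
  pose C := fine (\sum_(0 <= k <oo) g k x)%E.
  have CE : (\sum_(0 <= k <oo) g k x)%E = C%:E by rewrite fineK// ge0_fin_numE// nneseries_ge0.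
  have C0 : 0 <= C by rewrite fine_ge0// nneseries_ge0.
  exists (Num.sqrt C); first exact: sqrtr_ge0.
  move=> k.
  have h : 4 ^+ k * normc (dl k x) ^+ 2 <= C.
    rewrite -lee_fin -CE -/(g k x).
    have := @nneseries_lim_ge R (g ^~ x) predT 0 k.+1 (fun n _ _ => g0 n x).
    apply: le_trans; rewrite big_nat_recr//= leeDr// sume_ge0//.
  rewrite -(ger0_norm (normc_ge0 _)) -sqrtr_sqr.
  rewrite -[2^-1 ^+ k](ger0_norm (exprn_ge0 _ _)) ?invr_ge0// -sqrtr_sqr -sqrtrM//.
  rewrite ler_wsqrtr// -(ler_pM2l (exprn_gt0 k (ltr0n R 4))) (le_trans h)//.
  rewrite mulrCA -exprM mulnC exprM -exprMn (_ : 4 * 2^-1 ^+ 2 = 1) ?expr1n ?mulr1//.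
  by field.
pose l x : R[i] := if x \in G then Complex (limn (fun k => complex.Re (s (sub k) x)))
  (limn (fun k => complex.Im (s (sub k) x))) else 0.
have fl x : D x -> ccvg (f ^~ x) (l x).
  move=> Dx; rewrite /f /l; case: ifPn => [/set_mem Gx|_]; last exact: ccvg_cst.
  have [C C0 hC] := cG x Gx; split.
    apply: (@cvg_geometric_increments _ C) => k; apply: le_trans (hC k).
    by rewrite -cReN -cReD; exact: normc_Re.
  apply: (@cvg_geometric_increments _ C) => k; apply: le_trans (hC k).
  by rewrite -cImN -cImD; exact: normc_Im.
have mf k : cmeasurable D (f k).
  by apply: cmeasurable_if => //; exact: L2_meas.
have ml : cmeasurable D l by apply: cmeasurable_cvg fl.
have aef k : {ae mu, forall x, D x -> s (sub k) x = f k x}.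
  apply: filterS aeG => x h Dx; rewrite /f mem_set//; exact: h.
have main n e : (forall m, (n <= m)%N -> nsq (fun x => s n x - s m x) <= e) ->
    (L2normsq mu D (fun x => s n x - l x)%R <= e%:E)%E.
  move=> h.
  have Lf k : L (f k).
    apply: (@L2_le 1 _ (fun x => normc (s (sub k) x) ^+ 2)) => //; first exact: L2_int.
    by move=> x Dx; rewrite /f mul1r; case: ifP => _ //; rewrite normc0 expr0n sqr_ge0.
  pose F k x := ((normc (s n x - f k x) ^+ 2)%:E : \bar R).
  have mF k : measurable_fun D (F k).
    by apply/measurable_EFinP/measurable_normc2/L2_meas; exact: L2B.
  have Fl x : D x -> (normc (s n x - l x) ^+ 2)%:E = limn_einf (F ^~ x).
    move=> Dx; rewrite limn_einf_lim; apply/esym/cvg_lim => //.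
    apply: cvg_einfs; apply/fine_cvgP; split; first exact: nearW.
    apply: ccvg_normc2.
    by apply: ccvgD; [exact: ccvg_cst|apply: ccvgN; exact: fl].
  rewrite /L2normsq (eq_integral (fun x => limn_einf (F ^~ x))); last first.
    by move=> x /set_mem Dx; rewrite Fl.
  apply: (le_trans (fatou mu mD mF _)); first by move=> k x _; rewrite lee_fin sqr_ge0.
  rewrite limn_einf_lim; apply: lime_le; first exact: is_cvg_einfs.
  apply: nearW => k; rewrite /einfs /=.
  pose m := maxn k n.
  apply: (@le_trans _ _ (\int[mu]_(x in D) F m x)%E).
    by apply: ereal_inf_lbound; exists m => //=; exact: leq_maxl.
  have mn : (n <= sub m)%N by apply: leq_trans (subk m); exact: leq_maxr.
  rewrite (_ : (\int[mu]_(x in D) F m x)%E = L2normsq mu D (fun x => s n x - s (sub m) x)).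
    by rewrite L2normsqE ?lee_fin ?h//; exact: L2B.
  rewrite /L2normsq; apply: ae_eq_integral => //.
    by apply/measurable_EFinP/measurable_normc2/L2_meas; exact: L2B.
  by apply: filterS (aef m) => x e' Dx; rewrite /F e'.
have Ll : L l.
  have [M hM] := cau 1 ltr01.
  have LM : L (fun x => s M x - l x).
    split; first by apply: cmeasurableB => //; exact: L2_meas.
    by apply: le_lt_trans (ltry 1); apply: main => m Mm; apply: hM.
  by apply: L2_eq (L2B (Ls M) LM) => x _; rewrite opprB addrCA subrr addr0.
exists l; split => //.
apply/cvgrPdist_le => e e0; have [M hM] := cau e e0.
exists M => // n /= Mn; rewrite sub0r normrN ger0_norm ?nsq_ge0//.
rewrite -lee_fin -L2normsqE; last exact: L2B.
by apply: main => m nm; apply: hM => //; exact: leq_trans nm.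
Qed.

End L2Theory.

(** * Series over the integers *)

(** Generalizes [zsum], which is complex-valued, to the real weights that
    dominate a series. *)
Definition zs (V : nmodType) (N : nat) (f : int -> V) : V :=
  \sum_(k < N.*2.+1) f (k%:Z - N%:Z).

(** The tail of a family: a difference of two symmetric partial sums is the
    symmetric sum of a tail. *)
Definition zmask (V : nmodType) (N : nat) (f : int -> V) : int -> V :=
  fun l => if (N < absz l)%N then f l else 0.

Section SymmetricSums.

Lemma zsumE (R : realType) N (f : int -> R[i]) : zsum N f = zs N f.
Proof. by []. Qed.

Lemma zs0 (V : nmodType) (f : int -> V) : zs 0 f = f 0.
Proof. by rewrite /zs big_ord_recl big_ord0 addr0. Qed.

Lemma zsS (V : nmodType) N (f : int -> V) :
  zs N.+1 f = f (- (N.+1)%:Z) + zs N f + f (N.+1)%:Z.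
Proof.
rewrite /zs doubleS big_ord_recr big_ord_recl /=; congr (f _ + _ + f _).
- by rewrite sub0r.
- by apply: eq_bigr => k _; congr f; rewrite /bump /=; lia.
- by rewrite /bump /=; lia.
Qed.

Lemma eq_zs (V : nmodType) N (f g : int -> V) : (forall l, f l = g l) -> zs N f = zs N g.
Proof. by move=> e; apply: eq_bigr => k _. Qed.

Lemma zs_opp (V : nmodType) N (f : int -> V) : zs N (fun l => f (- l)) = zs N f.
Proof.
elim: N => [|N ih]; first by rewrite !zs0 oppr0.
by rewrite !zsS ih opprK addrAC -addrA addrC.
Qed.

Lemma zs_shift1 (V : zmodType) N (f : int -> V) :
  zs N (fun l => f (l + 1)) = zs N f + f (N.+1)%:Z - f (- N%:Z).
Proof.
elim: N => [|N ih]; first by rewrite !zs0 oppr0 addrAC subrr !add0r.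
rewrite !zsS ih (_ : - (N.+1)%:Z + 1 = - N%:Z); last by lia.
rewrite (_ : (N.+1)%:Z + 1 = (N.+2)%:Z); last by lia.
move: (zs N f) (f _) (f _) (f _) (f _) => a b c d e.
have -> : e + (a + d - e) = a + d by rewrite [LHS]addrC subrK.
by apply/esym; rewrite -!addrA [LHS]addrC !addrA subrK.
Qed.

Lemma zs_split (V : nmodType) N M (f : int -> V) : (N <= M)%N ->
  zs M f = zs N f + zs M (zmask N f).
Proof.
elim: M => [|M ih]; rewrite ?leqn0 => NM.
  by move/eqP : NM => ->; rewrite !zs0 /zmask /= addr0.
have [NM'|MN] := leqP N M.
  rewrite !zsS ih// /zmask abszN /= !ltnS NM'.
  by rewrite addrCA -!addrA.
have -> : N = M.+1 by lia.
rewrite [X in _ = _ + X]/zs big1 ?addr0// => k _.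
by rewrite /zmask; case: ifP => //; have := ltn_ord k; lia.
Qed.

Lemma zs_ge0 (R : numDomainType) N (a : int -> R) : (forall l, 0 <= a l) -> 0 <= zs N a.
Proof. by move=> a0; apply: sumr_ge0. Qed.

Lemma zmask_ge0 (R : numDomainType) N (a : int -> R) :
  (forall l, 0 <= a l) -> forall l, 0 <= zmask N a l.
Proof. by move=> a0 l; rewrite /zmask; case: ifP. Qed.

Lemma zs_mono (R : numDomainType) N M (a : int -> R) : (forall l, 0 <= a l) ->
  (N <= M)%N -> zs N a <= zs M a.
Proof. by move=> a0 NM; rewrite (zs_split _ NM) lerDl zs_ge0//; exact: zmask_ge0. Qed.

(** A window of any position and length is covered by a symmetric one. *)
Lemma zs_window (R : numDomainType) (a : int -> R) C : (forall l, 0 <= a l) ->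
  (forall N, zs N a <= C) -> forall n (c : int), \sum_(k < n) a (k%:Z + c) <= C.
Proof.
move=> a0 aC n c; pose M := (absz c + n)%N.
apply: le_trans (aC M).
have [c0 cE] : exists c0 : nat, c = c0%:Z - M%:Z.
  by exists (absz (c + M%:Z)); rewrite /M; lia.
rewrite /zs -(big_mkord xpredT (fun k => a (k%:Z + c))).
rewrite -(big_mkord xpredT (fun k => a (k%:Z - M%:Z))).
have le : (n + c0 <= M.*2.+1)%N by rewrite /M in cE *; lia.
rewrite [leRHS](@big_cat_nat _ _ _ c0)//=; last by lia.
rewrite [X in _ <= _ + X](@big_cat_nat _ _ _ (n + c0))//=; last by lia.
rewrite -{2}[c0]add0n big_addn addnK.
have -> : \sum_(0 <= i < n) a ((i + c0)%N%:Z - M%:Z) = \sum_(0 <= i < n) a (i%:Z + c).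
  by apply: eq_bigr => k _; congr a; rewrite cE; lia.
by rewrite addrCA lerDl addr_ge0// sumr_ge0.
Qed.

Lemma zmask_tail (R : realType) (a : int -> R) C : (forall l, 0 <= a l) ->
  (forall N, zs N a <= C) ->
  forall e, 0 < e -> exists N, forall n m, (N <= n)%N -> zs m (zmask n a) <= e.
Proof.
move=> a0 aC e e0.
have nd : nondecreasing_seq (fun N => zs N a) by move=> n m nm; exact: zs_mono.
have ub : has_ubound (range (fun N => zs N a)) by exists C => _ [N _ <-].
have cv : cvgn (fun N => zs N a) by exact: nondecreasing_is_cvgn.
have /cvgrPdist_le /(_ e e0) [N _ hN] := cv.
exists N => n m Nn.
have [mn|nm] := leqP m n.
  rewrite (_ : zs m _ = 0) ?ltW// /zs big1// => k _.
  by rewrite /zmask; case: ifP => //; have := ltn_ord k; lia.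
rewrite -(lerD2l (zs n a)) -zs_split; last exact: ltnW.
have h1 := nondecreasing_cvgn_le nd cv m.
have := hN n Nn; rewrite ler_norml => /andP[_]; rewrite lerBlDl.
exact: le_trans.
Qed.

Lemma zs_far (R : realType) (a : int -> R) C : (forall l, 0 <= a l) ->
  (forall N, zs N a <= C) ->
  forall e, 0 < e -> exists N, forall l, (N < absz l)%N -> a l <= e.
Proof.
move=> a0 aC e e0; have [N hN] := zmask_tail a0 aC e0.
exists N => l Nl; apply: le_trans (hN N (absz l) (leqnn N)).
have [n lE] : exists n : 'I_((absz l).*2.+1), l = n%:Z - (absz l)%:Z.
  have lt : (absz (l + (absz l)%:Z)%R < (absz l).*2.+1)%N by lia.
  by exists (Ordinal lt) => /=; lia.
rewrite /zs (bigD1 n)//= -lE /zmask Nl lerDl sumr_ge0// => k _.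
by case: ifP.
Qed.

(** The shift of the summation index contributes boundary terms only, and
    these tend to 0. *)
Lemma ccvg_zs_shift (R : realType) (f : int -> R[i]) (a : int -> R) C L (r : int) :
  (forall l, 0 <= a l) -> (forall N, zs N a <= C) -> (forall l, normc (f l) <= a l) ->
  ccvg (fun N => zs N f) L -> ccvg (fun N => zs N (fun l => f (l + r))) L.
Proof.
move=> a0 aC fa fL.
have f0 (u : nat -> int) : (forall N, exists M, forall n, (M <= n)%N -> (N < absz (u n))%N) ->
    ccvg (fun n => f (u n)) 0.
  move=> hu; apply: (@ccvg_squeeze _ _ _ (fun n => a (u n))) => [n|]; first by rewrite subr0.
  apply/cvgrPdist_le => e e0; have [N hN] := zs_far a0 aC e0.
  have [M hM] := hu N; exists M => // n /= Mn.
  by rewrite sub0r normrN ger0_norm// hN// hM.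
have bnd (g : int -> R[i]) : ccvg (fun n => g n%:Z) 0 -> ccvg (fun n => g (- n%:Z)) 0 ->
    ccvg (fun N => zs N g) L -> ccvg (fun N => zs N (fun l => g (l + 1))) L.
  move=> gp gn gL.
  apply: (@ccvg_eq _ (fun N => zs N g + g (N.+1)%:Z - g (- N%:Z))) => [N|].
    by rewrite zs_shift1.
  rewrite -[X in ccvg _ X]addr0 -[X in ccvg _ X]addr0 -{2}oppr0.
  apply: ccvgD; last exact: ccvgN.
  apply: ccvgD => //; have := ccvg_shift 1 gp.
  by apply: ccvg_eq => n; rewrite addn1.
have pos (g : int -> R[i]) k : (forall c : int, ccvg (fun n => g (n%:Z + c)) 0) ->
    (forall c : int, ccvg (fun n => g (- n%:Z + c)) 0) ->
    ccvg (fun N => zs N g) L -> ccvg (fun N => zs N (fun l => g (l + k%:Z))) L.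
  move=> gp gn gL; elim: k => [|k ih].
    by apply: ccvg_eq gL => N; apply: eq_zs => l; rewrite addr0.
  have := bnd _ (gp k%:Z) (gn k%:Z) ih; apply: ccvg_eq => N; apply: eq_zs => l.
  by congr g; lia.
case: r => k.
  by apply: pos => // c; apply: f0 => N; exists (N + absz c).+1 => n; lia.
apply: (@ccvg_eq _ (fun N => zs N (fun l => f (- (l + k.+1%:Z))))) => [N|].
  by rewrite -zs_opp; apply: eq_zs => l; congr f; lia.
apply: (pos (fun l => f (- l))).
- by move=> c; apply: f0 => N; exists (N + absz c).+1 => n; lia.
- by move=> c; apply: f0 => N; exists (N + absz c).+1 => n; lia.
- by apply: ccvg_eq fL => N; rewrite zs_opp.
Qed.

End SymmetricSums.

(** Cauchy's criterion: a difference of partial sums is the sum of a tail, and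
    the tails of the weights are small. *)
Lemma zsum_L2cvg (d : measure_display) (U : measurableType d) (R : realType)
    (mu : {measure set U -> \bar R}) (D : set U) (f : int -> U -> R[i])
    (a : int -> R) (C K : R) :
  measurable D -> (forall l, L2 mu D (f l)) -> (forall l, 0 <= a l) ->
  (forall N, zs N a <= C) -> 0 <= K ->
  (forall n N, nsq mu D (fun x => zs N (zmask n (f^~ x))) <= K * zs N (zmask n a)) ->
  exists l, L2cvg mu D (fun N x => zsum N (f^~ x)) l.
Proof.
move=> mD Lf a0 aC K0 h.
have Ls N : L2 mu D (fun x => zsum N (f^~ x)) by exact: L2_sum.
apply: (L2_complete mD Ls) => e e0.
have K1 : 0 < K + 1 by rewrite ltr_wpDl.
have [N hN] := zmask_tail a0 aC (divr_gt0 e0 K1).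
exists N.
have key n m : (N <= n)%N -> (n <= m)%N ->
    nsq mu D (fun x => zsum m (f^~ x) - zsum n (f^~ x)) <= e.
  move=> Nn nm.
  rewrite (@eq_nsq _ _ _ _ _ _ (fun x => zs m (zmask n (f^~ x)))); last first.
    by move=> x _; rewrite !zsumE (zs_split _ nm) addrAC subrr add0r.
  apply: le_trans (h n m) _; apply: (@le_trans _ _ ((K + 1) * zs m (zmask n a))).
    by rewrite ler_wpM2r ?lerDl// zs_ge0//; exact: zmask_ge0.
  by rewrite mulrC -ler_pdivlMr// hN.
move=> n m Nn Nm; have [nm|/ltnW mn] := leqP n m; last exact: key.
by rewrite nsqBC; exact: key.
Qed.

(** * Integration on rectangles *)

Section FubiniOnRectangles.
Context (d1 d2 : measure_display) (T1 : measurableType d1) (T2 : measurableType d2) (R : realType).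
Variables (A : set T1) (B : set T2).
Hypotheses (mA : measurable A) (mB : measurable B).

Lemma measurable_rect : measurable (A `*` B).
Proof. exact: measurableX. Qed.

(** An integral over a rectangle is that of the extension by 0 to the whole
    product, where the theorems of Fubini and Tonelli apply. *)
Lemma restrict_rect (f : T1 * T2 -> \bar R) x y :
  (f \_ (A `*` B)) (x, y) = if x \in A then ((fun y => f (x, y)) \_ B) y else 0%E.
Proof.
rewrite !patchE; case: (boolP (x \in A)) => xA; last first.
  by case: ifPn => //; rewrite inE => -[/= xA']; rewrite notin_setE in xA.
congr (if _ then _ else _); move: xA; rewrite inE => xA.
by apply/idP/idP; rewrite !inE => // -[].
Qed.

Lemma integral_restrict_rect (m2 : {measure set T2 -> \bar R}) (f : T1 * T2 -> \bar R) x :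
  (\int[m2]_y (f \_ (A `*` B)) (x, y))%E =
  ((fun x => \int[m2]_(y in B) f (x, y))%E \_ A) x.
Proof.
under eq_integral do rewrite restrict_rect.
rewrite [RHS]patchE; case: (x \in A); first by rewrite -integral_mkcond.
by rewrite integral0.
Qed.

Lemma measurable_restrict_rect (f : T1 * T2 -> \bar R) :
  measurable_fun (A `*` B) f -> measurable_fun setT (f \_ (A `*` B)).
Proof. by move=> mf; apply/(measurable_restrictT _ measurable_rect). Qed.

Lemma measurable_section_ereal (f : T1 * T2 -> \bar R) x : A x ->
  measurable_fun (A `*` B) f -> measurable_fun B (fun y => f (x, y)).
Proof.
move=> Ax /measurable_restrict_rect mf.
apply/(measurable_restrictT _ mB).
rewrite (_ : _ \_ B = (fun y => (f \_ (A `*` B)) (x, y))).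
  exact: (measurableT_comp mf (pair1_measurable x)).
by apply/funext => y; rewrite restrict_rect mem_set.
Qed.

Lemma ge0_restrict_rect (f : T1 * T2 -> \bar R) :
  (forall z, (A `*` B) z -> 0 <= f z)%E -> forall z, (0 <= (f \_ (A `*` B)) z)%E.
Proof. by move=> f0 z; rewrite patchE; case: ifPn => //; rewrite inE => /f0. Qed.

Lemma ge0_measurable_section_integral (m2 : {sigma_finite_measure set T2 -> \bar R})
    (f : T1 * T2 -> \bar R) :
  measurable_fun (A `*` B) f -> (forall z, (A `*` B) z -> 0 <= f z)%E ->
  measurable_fun A (fun x => \int[m2]_(y in B) f (x, y))%E.
Proof.
move=> /measurable_restrict_rect mf f0; apply/(measurable_restrictT _ mA).
have := measurable_fun_fubini_tonelli_F (m2 := m2) _ mf (ge0_restrict_rect f0).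
congr (measurable_fun _ _); apply/funext => x; exact: integral_restrict_rect.
Qed.

Lemma measurable_section_integral (m2 : {sigma_finite_measure set T2 -> \bar R})
    (f : T1 * T2 -> \bar R) :
  measurable_fun (A `*` B) f -> measurable_fun A (fun x => \int[m2]_(y in B) f (x, y))%E.
Proof.
move=> mf.
rewrite (_ : (fun x => _) = (fun x => \int[m2]_(y in B) f^\+ (x, y) -
    \int[m2]_(y in B) f^\- (x, y))%E); last first.
  apply/funext => x; rewrite [LHS]integralE; congr (_ - _)%E; apply: eq_integral => y _.
    exact: (congr1 (fun g => g y) (funepos_comp f (pair x))).
  exact: (congr1 (fun g => g y) (funeneg_comp f (pair x))).
apply: emeasurable_funB; apply: ge0_measurable_section_integral => //.
  exact: measurable_funepos.
exact: measurable_funeneg.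
Qed.

Variables (m1 : {sigma_finite_measure set T1 -> \bar R}).
Variables (m2 : {sigma_finite_measure set T2 -> \bar R}).

Lemma tonelli_rect (f : T1 * T2 -> \bar R) :
  measurable_fun (A `*` B) f -> (forall z, (A `*` B) z -> 0 <= f z)%E ->
  (\int[m1 \x m2]_(z in A `*` B) f z = \int[m1]_(x in A) \int[m2]_(y in B) f (x, y))%E.
Proof.
move=> /measurable_restrict_rect mf f0.
rewrite integral_mkcond (fubini_tonelli1 _ mf (ge0_restrict_rect f0)).
by rewrite [RHS]integral_mkcond; apply: eq_integral => x _; exact: integral_restrict_rect.
Qed.

Lemma Rfubini_rect (u : T1 * T2 -> R) :
  (m1 \x m2)%E.-integrable (A `*` B) (fun z => (u z)%:E) ->
  {ae m1, forall x, A x -> m2.-integrable B (fun y => (u (x, y))%:E)} /\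
  \int[(m1 \x m2)%E]_(z in A `*` B) u z = \int[m1]_(x in A) \int[m2]_(y in B) u (x, y).
Proof.
move=> ui; have mu0 := measurable_int _ ui.
have ri : (m1 \x m2)%E.-integrable setT ((fun z => (u z)%:E) \_ (A `*` B)).
  by rewrite -integrable_mkcond//; exact: measurable_rect.
have ae1 : {ae m1, forall x, A x -> m2.-integrable B (fun y => (u (x, y))%:E)}.
  apply: filterS (ae_integrable1 ri) => x h Ax.
  rewrite integrable_mkcond//; apply: eq_integrable h => // y _.
  by rewrite restrict_rect mem_set.
split => //; rewrite /Rintegral integral_mkcond -integral12_prod_meas1//; congr fine.
rewrite [RHS]integral_mkcond.
rewrite [LHS](eq_integral ((fun x => \int[m2]_(y in B) (u (x, y))%:E)%E \_ A)); last first.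
  by move=> x _; exact: (integral_restrict_rect m2 (fun z => (u z)%:E)).
rewrite -!integral_mkcond; apply: ae_eq_integral => //.
- exact: (@measurable_section_integral m2 (fun z => (u z)%:E)).
- apply/measurable_EFinP; apply: (measurableT_comp (fine_measurable measurableT)).
  exact: (@measurable_section_integral m2 (fun z => (u z)%:E)).
- by apply: filterS ae1 => x h Ax; rewrite fineK//; apply: integrable_fin_num => //; exact: h.
Qed.

Lemma cmeasurable_section (f : T1 * T2 -> R[i]) x : A x -> cmeasurable (A `*` B) f ->
  cmeasurable B (fun y => f (x, y)).
Proof.
move=> Ax [/measurable_EFinP a /measurable_EFinP b]; split; apply/measurable_EFinP.
  exact: (measurable_section_ereal Ax a).
exact: (measurable_section_ereal Ax b).
Qed.

Lemma cmeasurable_section_integral (f : T1 * T2 -> R[i]) : cmeasurable (A `*` B) f ->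
  cmeasurable A (fun x => cintegral m2 B (fun y => f (x, y))).
Proof.
move=> [/measurable_EFinP a /measurable_EFinP b]; split.
  apply: (measurableT_comp (fine_measurable measurableT)).
  exact: measurable_section_integral a.
apply: (measurableT_comp (fine_measurable measurableT)).
exact: measurable_section_integral b.
Qed.

Lemma fubini_rect (f : T1 * T2 -> R[i]) : cintegrable (m1 \x m2)%E (A `*` B) f ->
  {ae m1, forall x, A x -> cintegrable m2 B (fun y => f (x, y))} /\
  cintegral (m1 \x m2)%E (A `*` B) f =
  cintegral m1 A (fun x => cintegral m2 B (fun y => f (x, y))).
Proof.
move=> [/Rfubini_rect[a1 e1] /Rfubini_rect[a2 e2]]; split; last exact: complex_eq.
by apply: filterS2 a1 a2 => x h1 h2 Ax; split; [exact: h1|exact: h2].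
Qed.

Lemma L2_rect (f : T1 * T2 -> R[i]) : cmeasurable (A `*` B) f ->
  L2normsq (m1 \x m2)%E (A `*` B) f =
  (\int[m1]_(x in A) L2normsq m2 B (fun y => f (x, y)))%E.
Proof.
move=> mf; rewrite /L2normsq tonelli_rect//.
  exact/measurable_EFinP/measurable_normc2.
by move=> z _; rewrite lee_fin sqr_ge0.
Qed.

Lemma L2_rect_ae (f : T1 * T2 -> R[i]) : L2 (m1 \x m2)%E (A `*` B) f ->
  {ae m1, forall x, A x -> L2 m2 B (fun y => f (x, y))}.
Proof.
move=> [mf fi]; move: fi; rewrite L2_rect// => fi.
have : m1.-integrable A (fun x => L2normsq m2 B (fun y => f (x, y))).
  apply/integrableP; split.
    apply: (@ge0_measurable_section_integral m2 (fun z => (normc (f z) ^+ 2)%:E)).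
      exact/measurable_EFinP/measurable_normc2.
    by move=> z _; rewrite lee_fin sqr_ge0.
  rewrite (eq_integral (fun x => L2normsq m2 B (fun y => f (x, y))))// => x _.
  by rewrite gee0_abs// integral_ge0// => y _; rewrite lee_fin sqr_ge0.
move=> /(integrable_ae mA); apply: filterS => x h Ax; split; first exact: cmeasurable_section.
have := h Ax; rewrite ge0_fin_numE// integral_ge0// => y _.
by rewrite lee_fin sqr_ge0.
Qed.

Lemma nsq_rect_int (f : T1 * T2 -> R[i]) : L2 (m1 \x m2)%E (A `*` B) f ->
  m1.-integrable A (fun x => (nsq m2 B (fun y => f (x, y)))%:E).
Proof.
move=> Lf; have [mf fi] := Lf.
have mL : measurable_fun A (fun x => L2normsq m2 B (fun y => f (x, y))).
  apply: (@ge0_measurable_section_integral m2 (fun z => (normc (f z) ^+ 2)%:E)).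
    exact/measurable_EFinP/measurable_normc2.
  by move=> z _; rewrite lee_fin sqr_ge0.
have mh : measurable_fun A (fun x => (nsq m2 B (fun y => f (x, y)))%:E).
  by apply/measurable_EFinP; exact: (measurableT_comp (fine_measurable measurableT)).
apply/integrableP; split => //.
rewrite L2_rect// in fi.
apply: le_lt_trans fi; apply: ae_ge0_le_integral => //.
- exact: measurableT_comp.
- by move=> x _; apply: integral_ge0 => y _; rewrite lee_fin sqr_ge0.
- apply: filterS (L2_rect_ae Lf) => x h Ax.
  by rewrite abse_EFin ger0_norm ?nsq_ge0// (L2normsqE mB (h Ax)).
Qed.

Lemma nsq_rect (f : T1 * T2 -> R[i]) : L2 (m1 \x m2)%E (A `*` B) f ->
  nsq (m1 \x m2)%E (A `*` B) f = \int[m1]_(x in A) nsq m2 B (fun y => f (x, y)).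
Proof. move=> Lf; have ui := L2_int Lf.
exact: (@Rfubini_rect (fun z => normc (f z) ^+ 2) ui).2. Qed.

Lemma ip_rect (f g : T1 * T2 -> R[i]) : L2 (m1 \x m2)%E (A `*` B) f ->
  L2 (m1 \x m2)%E (A `*` B) g ->
  ip (m1 \x m2)%E (A `*` B) f g =
  cintegral m1 A (fun x => ip m2 B (fun y => f (x, y)) (fun y => g (x, y))).
Proof. by move=> Lf Lg; rewrite /ip (fubini_rect (L2_mulJ measurable_rect Lf Lg)).2. Qed.

End FubiniOnRectangles.

Section FubiniSwap.
Context (d1 d2 : measure_display) (T1 : measurableType d1) (T2 : measurableType d2) (R : realType).
Variables (A : set T1) (B : set T2).
Hypotheses (mA : measurable A) (mB : measurable B).
Variables (m1 : {sigma_finite_measure set T1 -> \bar R}).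
Variables (m2 : {sigma_finite_measure set T2 -> \bar R}).

Lemma measurable_swap_rect d3 (T3 : measurableType d3) (f : T1 * T2 -> T3) :
  measurable_fun (A `*` B) f -> measurable_fun (B `*` A) (fun z => f (z.2, z.1)).
Proof.
move=> mf.
apply: (@measurable_comp _ _ _ _ _ _ (A `*` B) f (B `*` A) (fun z => (z.2, z.1))) => //.
- exact: measurableX.
- by move=> _ [z [zB zA] <-].
- by apply: measurable_funTS; exact: measurable_swap.
Qed.

Lemma cmeasurable_swap (f : T1 * T2 -> R[i]) :
  cmeasurable (A `*` B) f -> cmeasurable (B `*` A) (fun z => f (z.2, z.1)).
Proof.
by move=> [a b]; split;
  [exact: (@measurable_swap_rect _ _ (fun z => complex.Re (f z)))
  |exact: (@measurable_swap_rect _ _ (fun z => complex.Im (f z)))].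
Qed.

Lemma tonelli_swap (f : T1 * T2 -> \bar R) :
  measurable_fun (A `*` B) f -> (forall z, (A `*` B) z -> 0 <= f z)%E ->
  (\int[m1]_(x in A) \int[m2]_(y in B) f (x, y) =
   \int[m2]_(y in B) \int[m1]_(x in A) f (x, y))%E.
Proof.
move=> mf f0; rewrite -tonelli_rect// integral_mkcond.
rewrite fubini_tonelli2; last 2 first.
- exact: measurable_restrict_rect.
- exact: ge0_restrict_rect.
rewrite [RHS]integral_mkcond; apply: eq_integral => y _.
rewrite -(integral_restrict_rect _ _ m1 (fun z => f (z.2, z.1))).
apply: eq_integral => x _; rewrite !patchE /=; congr (if _ then _ else _).
by apply/idP/idP; rewrite !inE => -[].
Qed.

Lemma integral_restrict_rect2 (f : T1 * T2 -> \bar R) y :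
  (\int[m1]_x (f \_ (A `*` B)) (x, y))%E =
  ((fun y => \int[m1]_(x in A) f (x, y))%E \_ B) y.
Proof.
rewrite -(integral_restrict_rect _ _ m1 (fun z => f (z.2, z.1))).
apply: eq_integral => x _; rewrite !patchE /=; congr (if _ then _ else _).
by apply/idP/idP; rewrite !inE => -[].
Qed.

Lemma Rfubini_swap (u : T1 * T2 -> R) :
  (m1 \x m2)%E.-integrable (A `*` B) (fun z => (u z)%:E) ->
  \int[(m1 \x m2)%E]_(z in A `*` B) u z = \int[m2]_(y in B) \int[m1]_(x in A) u (x, y).
Proof.
move=> ui; have mu0 := measurable_int _ ui.
have ri : (m1 \x m2)%E.-integrable setT ((fun z => (u z)%:E) \_ (A `*` B)).
  by rewrite -integrable_mkcond//; exact: measurable_rect.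
have ae1 : {ae m2, forall y, B y -> m1.-integrable A (fun x => (u (x, y))%:E)}.
  apply: filterS (ae_integrable2 ri) => y h By.
  rewrite integrable_mkcond//; apply: eq_integrable h => // x _.
  rewrite !patchE; case: (boolP (x \in A)) => xA.
    by rewrite mem_set//; split => //=; rewrite inE in xA.
  by case: ifPn => //; rewrite inE => -[/= xA']; rewrite notin_setE in xA.
rewrite /Rintegral integral_mkcond -integral21_prod_meas1//; congr fine.
rewrite [RHS]integral_mkcond.
rewrite [LHS](eq_integral ((fun y => \int[m1]_(x in A) (u (x, y))%:E)%E \_ B)); last first.
  by move=> y _; exact: (integral_restrict_rect2 (fun z => (u z)%:E)).
have ms : measurable_fun B (fun y => \int[m1]_(x in A) (u (x, y))%:E)%E.
  exact: (measurable_section_integral mB mA m1 (measurable_swap_rect mu0)).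
rewrite -!integral_mkcond; apply: ae_eq_integral => //.
- apply/measurable_EFinP; exact: (measurableT_comp (fine_measurable measurableT)).
- by apply: filterS ae1 => y h By; rewrite fineK//; apply: integrable_fin_num => //; exact: h.
Qed.

Lemma fubini_rect2 (f : T1 * T2 -> R[i]) : cintegrable (m1 \x m2)%E (A `*` B) f ->
  cintegral (m1 \x m2)%E (A `*` B) f =
  cintegral m2 B (fun y => cintegral m1 A (fun x => f (x, y))).
Proof. by move=> [/Rfubini_swap e1 /Rfubini_swap e2]; exact: complex_eq. Qed.

(** The product measure integrates the measures of the sections, so that almost
    every section of a null set is null. *)
Lemma ae_rect (Q : T1 -> T2 -> Prop) :
  {ae (m1 \x m2)%E, forall z : T1 * T2, A z.1 -> B z.2 -> Q z.1 z.2} ->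
  {ae m1, forall x, A x -> {ae m2, forall y, B y -> Q x y}}.
Proof.
move=> [N [mN N0 QN]].
have : (\int[m1]_(x in setT) `|m2 (xsection N x)|)%E = 0%E.
  rewrite -[RHS]N0 /product_measure1; apply: eq_integral => x _.
  by rewrite gee0_abs.
move=> /ae_eq_integral_abs -/(_ measurableT (measurable_fun_xsection m2 mN)).
apply: filterS => x h Ax.
exists (xsection N x); split; [exact: measurable_xsection|exact: h|].
move=> y /= Qxy; rewrite /xsection /= inE; apply: QN => /= h'.
by apply: Qxy => By; exact: h'.
Qed.

End FubiniSwap.

(** * Uniqueness of Fourier coefficients *)

Section PowersOfPowers.
Variable R : realType.
Implicit Types (a p : R).

Lemma bernoulli_sub a m : 0 <= a <= 1 -> 1 - m%:R * a <= (1 - a) ^+ m.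
Proof.
move=> /andP[a0 a1]; elim: m => [|m ih]; first by rewrite mul0r subr0 expr0.
rewrite exprS; apply: (@le_trans _ _ ((1 - a) * (1 - m%:R * a))).
  rewrite -natr1 -subr_ge0.
  by rewrite (_ : _ - _ = m%:R * (a * a)) ?mulr_ge0//; ring.
by rewrite ler_wpM2l// subr_ge0.
Qed.

Lemma bernoulli_add a m : 0 <= a -> 1 + m%:R * a <= (1 + a) ^+ m.
Proof.
move=> a0; elim: m => [|m ih]; first by rewrite mul0r addr0 expr0.
rewrite exprS; apply: (@le_trans _ _ ((1 + a) * (1 + m%:R * a))).
  rewrite -natr1 -subr_ge0.
  by rewrite (_ : _ - _ = m%:R * (a * a)) ?mulr_ge0//; ring.
by rewrite ler_wpM2l// addr_ge0.
Qed.

(** The polynomials [(1 - p ^+ n) ^+ (2 ^ n)] separate the values of [p] below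
    1/2, where they tend to 1, from those above 1/2, where they tend to 0. *)
Definition step n p : R := (1 - p ^+ n) ^+ (2 ^ n).

Lemma step_bound n p : 0 <= p <= 1 -> 0 <= step n p <= 1.
Proof.
move=> /andP[p0 p1].
have h0 : 0 <= p ^+ n by exact: exprn_ge0.
have h1 : p ^+ n <= 1 by exact: exprn_ile1.
by rewrite exprn_ge0 ?subr_ge0//= exprn_ile1 ?subr_ge0// lerBlDr lerDl.
Qed.

(** Bernoulli's inequality bounds [step n p] from below by [1 - (2 * p) ^+ n]. *)
Lemma step_lt p : 0 <= p < 2^-1 -> step n p @[n --> \oo] --> (1 : R).
Proof.
move=> /andP[p0 p2].
have p1 : p <= 1 by apply: (le_trans (ltW p2)); rewrite invf_le1 ?ler1n.
have c : 1 - (2 * p) ^+ n @[n --> \oo] --> (1 : R).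
  rewrite -[X in _ --> X]subr0; apply: cvgB; first exact: cvg_cst.
  apply: cvg_expr; rewrite ger0_norm ?mulr_ge0//.
  by rewrite mulrC -ltr_pdivlMr// div1r.
apply: (squeeze_cvgr _ c (cvg_cst _)); apply: nearW => n.
have /andP[_ ->] := step_bound n (introT andP (conj p0 p1)); rewrite andbT.
have h : 0 <= p ^+ n <= 1 by rewrite exprn_ge0//= exprn_ile1.
by rewrite exprMn -natrX; exact: bernoulli_sub.
Qed.

(** As [(1 - p ^+ n) * (1 + p ^+ n) <= 1], Bernoulli's inequality bounds [step n
    p] from above by the inverse of [(2 * p) ^+ n]. *)
Lemma step_gt p : 2^-1 < p <= 1 -> step n p @[n --> \oo] --> (0 : R).
Proof.
move=> /andP[p2 p1].
have p0 : 0 < p by apply: lt_trans p2; rewrite invr_gt0.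
have pp : 0 < 2 * p by rewrite mulr_gt0.
have c : (2 * p)^-1 ^+ n @[n --> \oo] --> (0 : R).
  apply: cvg_expr; rewrite ger0_norm ?invr_ge0 ?(ltW pp)// invf_lt1//.
  by rewrite mulrC -ltr_pdivrMr// div1r.
apply: (squeeze_cvgr _ (cvg_cst _) c); apply: nearW => n.
have pb : 0 <= p <= 1 by rewrite (ltW p0).
have /andP[-> _] := step_bound n pb; rewrite andTb.
have h0 : 0 <= p ^+ n by rewrite exprn_ge0// ltW.
have h1 : p ^+ n <= 1 by rewrite exprn_ile1// ltW.
rewrite exprVn -div1r ler_pdivlMr ?exprn_gt0//.
apply: (@le_trans _ _ (step n p * (1 + p ^+ n) ^+ (2 ^ n))).
  rewrite ler_wpM2l//; first by have /andP[] := step_bound n pb.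
  apply: le_trans (bernoulli_add (2 ^ n) h0).
  by rewrite exprMn -natrX lerDr.
have h2 : 0 <= (p ^+ n) ^+ 2 <= 1 by rewrite exprn_ge0//= exprn_ile1.
rewrite /step -exprMn -subr_sqr expr1n exprn_ile1//; first by rewrite subr_ge0; case/andP : h2.
by rewrite lerBlDr lerDl; case/andP : h2.
Qed.

End PowersOfPowers.

Section FourierUniqueness.
Variable R : realType.
Local Notation mu := (leb R).
Local Notation D := (@Ipi R).

Lemma measurable_Ipi : measurable (D : set (measurableTypeR R)).
Proof. exact: measurable_itv. Qed.

Lemma cmeasurable_cis (E : set R) (k : R) :
  @cmeasurable _ (measurableTypeR R) R E (fun s => cis (k * s)).
Proof.
split; apply: (@measurable_funTS _ _ (measurableTypeR R)) => /=.
  apply: (measurableT_comp (f := @cos R)); last exact: mulrl_measurable.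
  exact: continuous_measurable_fun (@continuous_cos R).
apply: (measurableT_comp (f := @sin R)); last exact: mulrl_measurable.
exact: continuous_measurable_fun (@continuous_sin R).
Qed.

Variable f : R -> R[i].
Hypothesis fi : cintegrable mu D f.
Hypothesis f0 : forall l : int, cintegral mu D (fun s => f s * cis (- (l%:~R * s))) = 0.

(** These functions form a vector space, stable under multiplication by [cos]
    and [sin] and hence by all trigonometric polynomials; their boundedness
    keeps the products with [f] integrable. *)
Definition annihilated (q : R -> R) : Prop :=
  [/\ measurable_fun (D : set (measurableTypeR R)) q, (exists K, forall s, `|q s| <= K) &
      forall l : int, cintegral mu D (fun s => f s * (((q s)%:C)%C * cis (l%:~R * s))) = 0].

Lemma annihilated_int q l : annihilated q ->
  cintegrable mu D (fun s => f s * (((q s)%:C)%C * cis (l%:~R * s))).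
Proof.
move=> [mq [K qK] _].
apply: (@cintegrable_le _ _ _ _ _ measurable_Ipi _ (fun s => K * normc (f s))).
- apply: cmeasurableM; first exact: cintegrable_cmeasurable fi.
  by apply: cmeasurableM; [exact: cmeasurable_real|exact: cmeasurable_cis].
- apply: integrable_scale; first exact: measurable_Ipi.
  by apply: cintegrable_norm => //; exact: measurable_Ipi.
- by move=> s _; rewrite !normcM normc_real normc_cis mulr1 mulrC ler_wpM2r.
Qed.

Lemma annihilated1 : annihilated (fun=> 1).
Proof.
split; [exact: measurable_cst|by exists 1 => s; rewrite normr1|move=> l].
rewrite -[RHS](f0 (- l)); apply: eq_cintegral => s _.
by rewrite mul1r mulrNz mulNr opprK.
Qed.

Lemma annihilatedZD (a b : R) q r : annihilated q -> annihilated r ->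
  annihilated (fun s => a * q s + b * r s).
Proof.
move=> hq hr; have [mq [K qK] q0] := hq; have [mr [K' rK] r0] := hr; split.
- by apply: measurable_funD; apply: measurable_funM => //; exact: measurable_cst.
- exists (`|a| * K + `|b| * K') => s; rewrite (le_trans (ler_normD _ _))//.
  by rewrite lerD// normrM ler_wpM2l.
- move=> l.
  transitivity (cintegral mu D (fun s =>
    (a%:C)%C * (f s * (((q s)%:C)%C * cis (l%:~R * s))) +
    (b%:C)%C * (f s * (((r s)%:C)%C * cis (l%:~R * s))))).
    by apply: eq_cintegral => s _; rewrite rmorphD !rmorphM /=; ring.
  rewrite cintegralD ?cintegralZ ?q0 ?r0 ?mulr0 ?addr0//;
    try exact: measurable_Ipi; try exact: annihilated_int.
  - by apply: cintegrableZ; [exact: measurable_Ipi|exact: annihilated_int].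
  - by apply: cintegrableZ; [exact: measurable_Ipi|exact: annihilated_int].
Qed.

(** Multiplication by [cis s] or [cis (- s)] only shifts the Fourier
    coefficients. *)
Lemma annihilated_trig (h : R -> R) (c c' : R[i]) q :
  measurable_fun (D : set (measurableTypeR R)) h -> (forall s, `|h s| <= 1) ->
  (forall s, ((h s)%:C)%C = c * cis s + c' * cis (- s)) ->
  annihilated q -> annihilated (fun s => h s * q s).
Proof.
move=> mh h1 hE hq; have [mq [K qK] q0] := hq; split.
- exact: measurable_funM.
- by exists K => s; rewrite normrM -[X in _ <= X]mul1r ler_pM.
- move=> l; have mD := measurable_Ipi; have I' := annihilated_int _ hq.
  transitivity (cintegral mu D (fun s =>
    c * (f s * (((q s)%:C)%C * cis ((l + 1)%:~R * s))) +
    c' * (f s * (((q s)%:C)%C * cis ((l - 1)%:~R * s))))).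
    apply: eq_cintegral => s _; rewrite rmorphM /= hE.
    by rewrite !intrD mulrN1z !mulrDl mul1r mulN1r !cisD; ring.
  rewrite cintegralD ?cintegralZ ?q0 ?mulr0 ?addr0//.
  - exact: (cintegrableZ mD c (I' _)).
  - exact: (cintegrableZ mD c' (I' _)).
Qed.

Lemma annihilated_cos q : annihilated q -> annihilated (fun s => cos s * q s).
Proof.
apply: (annihilated_trig (c := 2^-1) (c' := 2^-1)) => [|s|s]; last 1 first.
- rewrite -mulrDr -cisJ; apply: (@mulfI _ 2); first by rewrite pnatr_eq0.
  by rewrite mulrA divff ?pnatr_eq0// mul1r; apply: complex_eq => /=; ring.
- by have [] := cmeasurable_cis D 1; under eq_fun do rewrite /= mul1r.
- exact: cos_max.
Qed.

Lemma annihilated_sin q : annihilated q -> annihilated (fun s => sin s * q s).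
Proof.
apply: (annihilated_trig (c := 2^-1 * (- 'i)%C) (c' := - (2^-1 * (- 'i)%C))) => [|s|s]; last 1 first.
- rewrite mulNr -mulrBr -cisJ; apply: (@mulfI _ 2); first by rewrite pnatr_eq0.
  by rewrite !mulrA divff ?pnatr_eq0// mul1r; apply: complex_eq => /=; ring.
- by have [_] := cmeasurable_cis D 1; under eq_fun do rewrite /= mul1r.
- exact: sin_max.
Qed.

Lemma annihilatedX (p q : R -> R) n :
  (forall r, annihilated r -> annihilated (fun s => p s * r s)) ->
  annihilated q -> annihilated (fun s => p s ^+ n * q s).
Proof.
move=> hp hq; elim: n => [|n ih].
  by under eq_fun do rewrite expr0 mul1r.
by under eq_fun do rewrite exprS -mulrA; exact: hp.
Qed.

Variable x : R.
Hypothesis x_pi : - pi < x < pi.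

(** A trigonometric polynomial with values in [0, 1] which, on the open
    interval of length [2 * pi], is below 1/2 exactly on the left of [x]. *)
Definition sep (s : R) : R := 2^-1 - 2^-1 * (cos (s / 2) * sin ((x - s) / 2)).

(** By the addition formulas [sep] is a trigonometric polynomial of degree 1, to
    which [annihilated_cos] and [annihilated_sin] apply. *)
Lemma sepE s : sep s = (2^-1 - 4^-1 * sin (x / 2)) + (- (4^-1 * sin (x / 2))) * cos s +
  4^-1 * cos (x / 2) * sin s.
Proof.
have e1 : sin (x / 2) = sin ((x - s) / 2) * cos (s / 2) + cos ((x - s) / 2) * sin (s / 2).
  by rewrite -sinD; congr sin; lra.
have e2 : sin (x / 2) * cos s - cos (x / 2) * sin s =
    sin ((x - s) / 2) * cos (s / 2) - cos ((x - s) / 2) * sin (s / 2).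
  by rewrite -!sinB; congr sin; lra.
rewrite /sep; lra.
Qed.

Lemma sep_bound s : 0 <= sep s <= 1.
Proof.
have : `|cos (s / 2) * sin ((x - s) / 2)| <= 1.
  by rewrite normrM -[X in _ <= X]mul1r ler_pM//; [exact: cos_max|exact: sin_max].
by rewrite ler_norml /sep => /andP[? ?]; apply/andP; split; lra.
Qed.

Lemma annihilated_sep q : annihilated q -> annihilated (fun s => sep s * q s).
Proof.
move=> hq.
have h := annihilatedZD 1 (4^-1 * cos (x / 2))
  (annihilatedZD (2^-1 - 4^-1 * sin (x / 2)) (- (4^-1 * sin (x / 2))) hq (annihilated_cos hq))
  (annihilated_sin hq).
rewrite (_ : (fun s => _) = (fun s => 1 * ((2^-1 - 4^-1 * sin (x / 2)) * q s +
   - (4^-1 * sin (x / 2)) * (cos s * q s)) + 4^-1 * cos (x / 2) * (sin s * q s)))//.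
by apply/funext => s; rewrite sepE; ring.
Qed.

Lemma annihilated_step n : annihilated (fun s => step n (sep s)).
Proof.
have h r : annihilated r -> annihilated (fun s => (1 - sep s ^+ n) * r s).
  move=> hr; have := annihilatedZD 1 (-1) hr (annihilatedX n annihilated_sep hr).
  by under eq_fun do rewrite mul1r mulN1r -[X in X - _]mul1r -mulrBl.
have := annihilatedX (2 ^ n) h annihilated1.
by under eq_fun do rewrite mulr1.
Qed.

Lemma sep_lt s : - pi < s < pi -> s < x -> sep s < 2^-1.
Proof.
move=> /andP[s1 s2] sx; rewrite /sep ltrBlDr ltrDl mulr_gt0 ?invr_gt0// mulr_gt0//.
  by apply: cos_gt0_pihalf; apply/andP; split; lra.
by case/andP : x_pi => ? ?; apply: sin_gt0_pi; apply/andP; split; lra.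
Qed.

Lemma sep_gt s : - pi < s < pi -> x < s -> 2^-1 < sep s.
Proof.
move=> /andP[s1 s2] sx; rewrite /sep ltrBrDr gtrDl pmulr_rlt0 ?invr_gt0//.
rewrite pmulr_rlt0; last by apply: cos_gt0_pihalf; apply/andP; split; lra.
rewrite -oppr_gt0 -sinN; case/andP : x_pi => ? ?.
by apply: sin_gt0_pi; apply/andP; split; lra.
Qed.

Lemma step_cvg s : - pi < s < pi -> s != x ->
  step n (sep s) @[n --> \oo] --> (\1_(`]-oo, x] : set R) s : R).
Proof.
move=> sp; have /andP[b0 b1] := sep_bound s; rewrite indicE.
case: ltgtP => // sx _.
  rewrite mem_set /=; last by rewrite in_itv/= ltW.
  by apply: step_lt; rewrite b0 sep_lt.
rewrite memNset /=; last by rewrite in_itv/= leNgt sx.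
by apply: step_gt; rewrite b1 sep_gt.
Qed.

End FourierUniqueness.

Section FourierUniqueness2.
Variable R : realType.
Local Notation mu := (leb R).
Local Notation D := (@Ipi R).

Lemma leb_ae_neq (c : R) : {ae mu, forall s, s != c}.
Proof.
exists [set c]; split; [exact: measurable_set1|exact: lebesgue_measure_set1|].
by move=> s /= /negP; rewrite negbK => /eqP.
Qed.

(** The indicator of a half-line is, at almost every point, the limit of the
    bounded functions [step n (sep x s)], and [f] annihilates all of these. *)
Lemma fourier_primitive0 (f : R -> R[i]) : cintegrable mu D f ->
  (forall l : int, cintegral mu D (fun s => f s * cis (- (l%:~R * s))) = 0) ->
  forall x : R, cintegral mu D (fun s => f s * ((\1_(`]-oo, x] : set R) s)%:C)%C) = 0.
Proof.
move=> fi f0 x; have mf := cintegrable_cmeasurable fi.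
have mi : @cmeasurable _ (measurableTypeR R) R D (fun s => ((\1_(`]-oo, x] : set R) s)%:C)%C).
  apply: (@cmeasurable_real _ (measurableTypeR R) R D (\1_(`]-oo, x] : set R))).
  by apply: measurable_indic; exact: measurable_itv.
have [xl|xg] := leP x (- pi).
  transitivity (cintegral mu D (fun=> 0)).
    apply: ae_eq_cintegral => //; first exact: measurable_Ipi.
      exact: cmeasurableM.
    apply: aeS1 (leb_ae_neq (- pi)) => s sn; rewrite /Ipi /= in_itv /= => /andP[s1 s2].
    rewrite indicE memNset ?mulr0//= in_itv /=; apply/negP; rewrite -ltNge.
    by rewrite (le_lt_trans xl)// lt_neqAle eq_sym sn.
  by apply: complex_eq; rewrite /cintegral /= Rintegral_cst ?mul0r//; exact: measurable_Ipi.
have [xr|xl] := leP pi x.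
  rewrite -[RHS](f0 0); apply: eq_cintegral => s; rewrite /Ipi /= in_itv /= => /andP[s1 s2].
  rewrite indicE mem_set/= ?in_itv/= ?(le_trans s2)//.
  by rewrite mul0r oppr0 cis0.
have xp : - pi < x < pi by rewrite xg xl.
have lim : ccvg (fun n => cintegral mu D (fun s => f s * ((step n (sep x s))%:C)%C))
    (cintegral mu D (fun s => f s * ((\1_(`]-oo, x] : set R) s)%:C)%C)).
  apply: (@cdominated_convergence_ae _ (measurableTypeR R) R mu D (@measurable_Ipi R)
    (fun n s => f s * ((step n (sep x s))%:C)%C)
    (fun s => f s * ((\1_(`]-oo, x] : set R) s)%:C)%C) (fun s => normc (f s))).
  - move=> n; apply: cmeasurableM => //; apply: cmeasurable_real.
    by have [] := annihilated_step fi f0 x n.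
  - exact: cmeasurableM.
  - apply: aeS3 (leb_ae_neq (- pi)) (leb_ae_neq pi) (leb_ae_neq x) => s s1 s2 s3.
    rewrite /Ipi /= in_itv /= => /andP[h1 h2].
    apply: ccvgM; first exact: ccvg_cst.
    by apply: cvg_realC; apply: step_cvg => //; rewrite !lt_neqAle h1 h2 s2 eq_sym s1.
  - by apply: cintegrable_norm => //; exact: measurable_Ipi.
  - move=> n s _; rewrite normcM normc_real.
    have /andP[h0 h1] := step_bound n (sep_bound x s).
    by rewrite ger0_norm// -[X in _ <= X]mulr1 ler_wpM2l.
apply: (ccvg_unique lim); rewrite (_ : (fun n => _) = (fun=> 0)); first exact: ccvg_cst.
apply/funext => n; have [_ _ h] := annihilated_step fi f0 x n.
rewrite -[RHS](h 0); apply: eq_cintegral => s _.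
by rewrite mul0r cis0 mulr1.
Qed.

(** Lebesgue's differentiation theorem: almost everywhere the function is the
    derivative of its primitive, which vanishes. *)
Lemma primitive0_ae (u : R -> R) : mu.-integrable D (fun s => (u s)%:E) ->
  (forall x : R, \int[mu]_(s in D) (u s * \1_(`]-oo, x] : set R) s) = 0) ->
  {ae mu, forall s, D s -> u s = 0}.
Proof.
move=> ui u0.
have loc := integrable_locally (@measurable_Ipi R) ui.
have gi y : (@lebesgue_measure R).-integrable `]-oo, y] (EFin \o (u \_ D)).
  apply: (@integrableS _ _ _ _ setT) => //.
  by rewrite -restrict_EFin -integrable_mkcond//; exact: measurable_Ipi.
have F0 : (fun y => \int[@lebesgue_measure R]_(t in [set` `]-oo, y]]) (u \_ D) t) = cst 0.
  apply/funext => y; rewrite -[RHS](u0 y) Rintegral_mkcond [RHS]Rintegral_mkcond.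
  apply: eq_Rintegral => s _; rewrite !patchE indicE.
  by case: (s \in [set` `]-oo, y]]); case: (s \in D); rewrite ?mulr1 ?mulr0.
have := FTC1Ny gi loc; rewrite F0 /=.
apply: (@aeS1 _ _ _ mu) => s [_]; rewrite derive1_cst => h Ds.
by rewrite h patchE mem_set.
Qed.

(** The primitives of the real and of the imaginary part of [f] vanish by
    [fourier_primitive0]. *)
Lemma fourier_unique (f : R -> R[i]) : cintegrable mu D f ->
  (forall l : int, cintegral mu D (fun s => f s * cis (- (l%:~R * s))) = 0) ->
  {ae mu, forall s, D s -> f s = 0}.
Proof.
move=> fi f0; have h := fourier_primitive0 fi f0; case: (fi) => fr fim.
have h1 : {ae mu, forall s, D s -> complex.Re (f s) = 0}.
  apply: primitive0_ae fr _ => x; have /(congr1 (@complex.Re R)) /= := h x.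
  rewrite /cintegral /= => <-; apply: eq_Rintegral => s _.
  by rewrite cReM /= mulr0 subr0.
have h2 : {ae mu, forall s, D s -> complex.Im (f s) = 0}.
  apply: primitive0_ae fim _ => x; have /(congr1 (@complex.Im R)) /= := h x.
  rewrite /cintegral /= => <-; apply: eq_Rintegral => s _.
  by rewrite cImM /= mulr0 add0r.
by apply: aeS2 h1 h2 => s a b Ds; apply: complex_eq; rewrite /= ?a ?b.
Qed.

End FourierUniqueness2.

(** * Tensor products and orthonormal systems *)

Section Tensor.
Context (d1 d2 : measure_display) (T1 : measurableType d1) (T2 : measurableType d2) (R : realType).
Variables (A : set T1) (B : set T2).
Hypotheses (mA : measurable A) (mB : measurable B).
Variables (m1 : {sigma_finite_measure set T1 -> \bar R}).
Variables (m2 : {sigma_finite_measure set T2 -> \bar R}).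

Lemma measurable_fst_rect d3 (T3 : measurableType d3) (f : T1 -> T3) :
  measurable_fun A f -> measurable_fun (A `*` B) (fun z => f z.1).
Proof.
move=> mf; apply: (@measurable_comp _ _ _ _ _ _ A f (A `*` B) fst) => //.
- by move=> _ [z [zA zB] <-].
- by apply: measurable_funTS; exact: measurable_fst.
Qed.

Lemma measurable_snd_rect d3 (T3 : measurableType d3) (f : T2 -> T3) :
  measurable_fun B f -> measurable_fun (A `*` B) (fun z => f z.2).
Proof.
move=> mf; apply: (@measurable_comp _ _ _ _ _ _ B f (A `*` B) snd) => //.
- by move=> _ [z [zA zB] <-].
- by apply: measurable_funTS; exact: measurable_snd.
Qed.

Lemma cmeasurable_fst (f : T1 -> R[i]) :
  cmeasurable A f -> cmeasurable (A `*` B) (fun z => f z.1).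
Proof. by move=> [a b]; split; [exact: measurable_fst_rect a|exact: measurable_fst_rect b]. Qed.

Lemma cmeasurable_snd (f : T2 -> R[i]) :
  cmeasurable B f -> cmeasurable (A `*` B) (fun z => f z.2).
Proof. by move=> [a b]; split; [exact: measurable_snd_rect a|exact: measurable_snd_rect b]. Qed.

Lemma L2_tensor (a : T1 -> R[i]) (b : T2 -> R[i]) : L2 m1 A a -> L2 m2 B b ->
  L2 (m1 \x m2)%E (A `*` B) (fun z => a z.1 * b z.2).
Proof.
move=> La Lb.
have mm : cmeasurable (A `*` B) (fun z => a z.1 * b z.2).
  by apply: cmeasurableM; [exact: cmeasurable_fst (L2_meas La)|exact: cmeasurable_snd (L2_meas Lb)].
split => //; rewrite L2_rect//.
rewrite (eq_integral (fun x => (nsq m2 B b)%:E * (normc (a x) ^+ 2)%:E)%E); last first.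
  move=> x _ /=; rewrite L2normsqE//; last exact: L2Z.
  by rewrite nsqZ// mulrC.
rewrite ge0_integralZl_EFin ?nsq_ge0//.
- have := L2normsqE mA La; rewrite /L2normsq => ->.
  by rewrite -EFinM ltry.
- by move=> x _; rewrite lee_fin sqr_ge0.
- exact/measurable_EFinP/measurable_normc2/(L2_meas La).
Qed.

Lemma ip_tensor (a a' : T1 -> R[i]) (b b' : T2 -> R[i]) :
  L2 m1 A a -> L2 m1 A a' -> L2 m2 B b -> L2 m2 B b' ->
  ip (m1 \x m2)%E (A `*` B) (fun z => a z.1 * b z.2) (fun z => a' z.1 * b' z.2) =
  ip m1 A a a' * ip m2 B b b'.
Proof.
move=> La La' Lb Lb'; rewrite ip_rect//; try exact: L2_tensor.
rewrite mulrC /(ip m1) -cintegralZ//; last exact: L2_mulJ.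
apply: eq_cintegral => x _ /=.
rewrite ipZl//; last exact: L2Z.
by rewrite ipZr//; ring.
Qed.

Lemma L2_swap (f : T1 * T2 -> R[i]) : L2 (m1 \x m2)%E (A `*` B) f ->
  L2 (m2 \x m1)%E (B `*` A) (fun z => f (z.2, z.1)).
Proof.
move=> [mf fi]; have mf' := cmeasurable_swap mA mB mf.
split => //; rewrite L2_rect// /L2normsq /=.
rewrite -(@tonelli_swap _ _ _ _ _ _ _ mA mB m1 m2 (fun z => (normc (f z) ^+ 2)%:E)).
- by move: fi; rewrite L2_rect.
- exact/measurable_EFinP/measurable_normc2.
- by move=> z _; rewrite lee_fin sqr_ge0.
Qed.

End Tensor.

Section HilbertSpace.
Variable R : realType.
Local Notation H := (@Hsp R).
Local Notation hsq := (nsq (leb R) (@I01 R)).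

Lemma measurable_I01 : measurable (@I01 R : set (measurableTypeR R)).
Proof. exact: measurable_itv. Qed.

Implicit Types (x y z : R -> R[i]).

Lemma innerE x y : inner x y = ip (leb R) (@I01 R) x y. Proof. by []. Qed.

Lemma HspZ c x : H x -> H (fun u => c * x u). Proof. exact: (L2Z measurable_I01). Qed.

Lemma HspB x y : H x -> H y -> H (fun u => x u - y u). Proof. exact: (L2B measurable_I01). Qed.

Lemma Hsp_sum I (r : seq I) (Q : pred I) (f : I -> R -> R[i]) :
  (forall i, H (f i)) -> H (fun u => \sum_(i <- r | Q i) f i u).
Proof. exact: (L2_sum measurable_I01). Qed.

Lemma innerJ x y : H x -> H y -> conjc (inner x y) = inner y x.
Proof. exact: (ipJ measurable_I01). Qed.

Lemma innerZl c x y : H x -> H y -> inner (fun u => c * x u) y = c * inner x y.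
Proof. exact: (ipZl measurable_I01). Qed.

Lemma innerZr c x y : H x -> H y -> inner x (fun u => c * y u) = conjc c * inner x y.
Proof. exact: (ipZr measurable_I01). Qed.

Lemma innerBr x y z : H x -> H y -> H z -> inner z (fun u => x u - y u) = inner z x - inner z y.
Proof. exact: (ipBr measurable_I01). Qed.

Lemma inner_suml I (r : seq I) (Q : pred I) (f : I -> R -> R[i]) y :
  (forall i, H (f i)) -> H y ->
  inner (fun u => \sum_(i <- r | Q i) f i u) y = \sum_(i <- r | Q i) inner (f i) y.
Proof. exact: (ip_suml measurable_I01). Qed.

Lemma inner_sumr I (r : seq I) (Q : pred I) (f : I -> R -> R[i]) y :
  (forall i, H (f i)) -> H y ->
  inner y (fun u => \sum_(i <- r | Q i) f i u) = \sum_(i <- r | Q i) inner y (f i).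
Proof. exact: (ip_sumr measurable_I01). Qed.

Lemma innerxx x : H x -> inner x x = ((hsq x)%:C)%C. Proof. exact: (ipxx measurable_I01). Qed.

Lemma inner_le x y : H x -> H y -> normc (inner x y) ^+ 2 <= hsq x * hsq y.
Proof. exact: (cauchy_schwarz measurable_I01). Qed.

Lemma orthonormal_nsq (e : nat -> R -> R[i]) (c : nat -> R[i]) n : orthonormal e ->
  hsq (fun u => \sum_(k < n) c k * e k u) = \sum_(k < n) normc (c k) ^+ 2.
Proof.
move=> [eH eo].
have L k : H (fun u => c k * e k u) by exact/HspZ/eH.
have Ls : H (fun u => \sum_(k < n) c k * e k u) by exact: Hsp_sum.
apply: complexI; rewrite -innerxx// inner_suml//.
rewrite rmorph_sum; apply: eq_bigr => k _ /=.
rewrite inner_sumr//; rewrite (bigD1 k)//= big1 ?addr0 => [|j jk].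
  by rewrite innerZl// innerZr// eo eqxx mulr1 mulcJE.
rewrite innerZl// innerZr// eo.
rewrite (_ : (_ == _) = false) ?mulr0//; apply/negbTE; rewrite eq_sym.
by apply: contra jk => /eqP jk; apply/eqP/val_inj.
Qed.

Lemma orthonormal_ip (e : nat -> R -> R[i]) (c : nat -> R[i]) n j : orthonormal e ->
  inner (fun u => \sum_(k < n) c k * e k u) (e j) = if (j < n)%N then c j else 0.
Proof.
move=> [eH eo].
have L k : H (fun u => c k * e k u) by exact/HspZ/eH.
rewrite inner_suml//.
have E (k : 'I_n) : inner (fun u => c k * e k u) (e j) = c k * ((k : nat) == j)%:R.
  by rewrite innerZl// eo.
under eq_bigr do rewrite E.
case: ltnP => jn; last first.
  rewrite big1// => k _; rewrite (_ : (_ == _) = false) ?mulr0//.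
  by apply/negbTE; rewrite neq_ltn (leq_trans (ltn_ord k) jn).
rewrite (bigD1 (Ordinal jn))//= eqxx mulr1 big1 ?addr0// => k kj.
rewrite (_ : (_ == _) = false) ?mulr0//; apply/negbTE; apply: contra kj => /eqP kj.
by apply/eqP/val_inj.
Qed.

Lemma bessel (e : nat -> R -> R[i]) x n : orthonormal e -> H x ->
  \sum_(k < n) normc (inner x (e k)) ^+ 2 <= hsq x.
Proof.
move=> eo Hx; have [eH _] := eo.
have L k : H (fun u => inner x (e k) * e k u) by exact/HspZ/eH.
have Ls : H (fun u => \sum_(k < n) inner x (e k) * e k u) by exact: Hsp_sum.
have := nsq_ge0 (leb R) (@I01 R) (fun u => x u - \sum_(k < n) inner x (e k) * e k u).
rewrite (nsqB measurable_I01)// (orthonormal_nsq (fun k => inner x (e k)))//.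
rewrite -innerE inner_sumr//.
have E k : complex.Re (inner x (fun u => inner x (e k) * e k u)) =
    normc (inner x (e k)) ^+ 2.
  by rewrite innerZr// mulrC mulcJE.
rewrite cRe_sum; under [X in _ - 2 * X + _]eq_bigr do rewrite E.
by lra.
Qed.

Lemma parseval (e : nat -> R -> R[i]) x : orthonormal_basis e -> H x ->
  \sum_(k < n) normc (inner x (e k)) ^+ 2 @[n --> \oo] --> hsq x.
Proof.
move=> [eo eb] Hx; have mI := measurable_I01; have [eH _] := eo.
have Ls n : H (fun u => \sum_(k < n) inner x (e k) * e k u).
  by apply: (L2_sum mI) => k; exact/(L2Z mI)/eH.
have /(converges_L2P mI x Ls) c := eb x Hx.
have := nsq_cvg mI c.
rewrite (_ : (fun n => _) = (fun n => \sum_(k < n) normc (inner x (e k)) ^+ 2))//.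
by apply/funext => n; rewrite (orthonormal_nsq (fun k => inner x (e k))).
Qed.

End HilbertSpace.

(** * Fourier series of Hilbert-space-valued functions *)

Section FourierSystem.
Variable R : realType.
Local Notation mu := (leb R).
Local Notation D := (@Ipi R).

Lemma leb_Ipi : mu D = (2 * pi)%:E.
Proof.
rewrite /leb /= /Ipi lebesgue_measure_itv /= lte_fin gtrN ?pi_gt0//.
by rewrite -EFinB; congr (_%:E); ring.
Qed.

Lemma integrable_cst_Ipi (c : R) : mu.-integrable D (fun=> c%:E).
Proof.
apply/integrableP; split; first exact: measurable_cst.
by rewrite integral_cst ?leb_Ipi -?EFinM ?ltry//; exact: measurable_Ipi.
Qed.

Lemma L2_cis (k : R) : L2 mu D (fun s => cis (k * s)).
Proof.
apply: L2I; first exact: cmeasurable_cis.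
by under eq_fun do rewrite normc_cis expr1n; exact: integrable_cst_Ipi.
Qed.

Lemma sin_intpi (l : int) : sin (l%:~R * pi) = 0 :> R.
Proof.
have nat n : sin (n%:R * pi) = 0 :> R.
  elim: n => [|n ih]; first by rewrite mul0r sin0.
  by rewrite -natr1 mulrDl mul1r sinD cospi sinpi ih mul0r mulr0 addr0.
case: l => n; first by rewrite -pmulrn nat.
by rewrite NegzE mulrNz mulNr sinN -pmulrn nat oppr0.
Qed.

Lemma Rintegral_derive0 (F f : R -> R) : (forall s : R, is_derive s 1 F (f s)) ->
  continuous f -> F (- pi) = F pi -> \int[mu]_(s in D) f s = 0.
Proof.
move=> dF cont FE; have contF : continuous F.
  by move=> s; apply: differentiable_continuous; apply/derivable1_diffP; case: (dF s).
rewrite /Rintegral /Ipi (@continuous_FTC2 _ _ F).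
- by rewrite FE subee.
- by rewrite gtrN// pi_gt0.
- exact: continuous_subspaceT.
- split.
  + by move=> s _; case: (dF s).
  + by apply: cvg_at_right_filter; exact: contF.
  + by apply: cvg_at_left_filter; exact: contF.
- by move=> s _; rewrite derive1E; case: (dF s).
Qed.

Let derive_scale (k s : R) : is_derive s 1 (fun s => k * s) k.
Proof. by rewrite -[X in is_derive _ _ _ X](mulr1 k); exact: (is_deriveZ k (is_derive_id s 1)). Qed.

Lemma cos_integral0 (l : int) : l != 0 -> \int[mu]_(s in D) cos (l%:~R * s) = 0.
Proof.
move=> l0; pose k : R := l%:~R; have k0 : k != 0 by rewrite intr_eq0.
apply: (Rintegral_derive0 (F := fun s => k^-1 * sin (k * s))) => [s|s|].
- have h2 := is_derive1_comp (is_derive_sin (k * s)) (derive_scale k s).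
  have e : k^-1 * (cos (k * s) * k) = cos (k * s) by rewrite mulrCA mulVf// mulr1.
  by rewrite -[X in is_derive _ _ _ X]e; exact: (is_deriveZ k^-1 h2).
- by apply: continuous_comp; [exact: mulrl_continuous|exact: continuous_cos].
- by rewrite mulrN sinN sin_intpi oppr0.
Qed.

Lemma sin_integral0 (l : int) : \int[mu]_(s in D) sin (l%:~R * s) = 0.
Proof.
have [->|l0] := eqVneq l 0.
  rewrite (@eq_Rintegral _ _ _ mu D (cst 0)); first by rewrite Rintegral_cst ?mul0r//; exact: measurable_Ipi.
  by move=> s _; rewrite mul0r sin0.
pose k : R := l%:~R; have k0 : k != 0 by rewrite intr_eq0.
apply: (Rintegral_derive0 (F := fun s => - k^-1 * cos (k * s))) => [s|s|].
- have h2 := is_derive1_comp (is_derive_cos (k * s)) (derive_scale k s).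
  have e : - k^-1 * (- sin (k * s) * k) = sin (k * s).
    by rewrite !mulNr mulrN opprK mulrCA mulVf// mulr1.
  by rewrite -[X in is_derive _ _ _ X]e; exact: (is_deriveZ (- k^-1) h2).
- by apply: continuous_comp; [exact: mulrl_continuous|exact: continuous_sin].
- by rewrite mulrN cosN.
Qed.

Lemma cis_integral (l : int) :
  cintegral mu D (fun s => cis (l%:~R * s)) = if l == 0 then (((2 * pi) : R)%:C)%C else 0.
Proof.
rewrite /cintegral /= sin_integral0; case: eqVneq => [->|l0]; last by rewrite cos_integral0.
rewrite (@eq_Rintegral _ _ _ mu D (cst 1)).
  rewrite Rintegral_cst; last exact: measurable_Ipi.
  by rewrite leb_Ipi /= mul1r.
by move=> s _; rewrite mul0r cos0.
Qed.

Lemma ip_cis (l l' : int) :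
  ip mu D (fun s => cis (l%:~R * s)) (fun s => cis (l'%:~R * s)) =
  if l == l' then (((2 * pi) : R)%:C)%C else 0.
Proof.
rewrite -subr_eq0 -cis_integral; apply: eq_cintegral => s _.
by rewrite cisJ -cisD intrB mulrBl.
Qed.

End FourierSystem.

Section Fields.
Context (d : measure_display) (T : measurableType d) (R : realType).
Variables (m1 : {sigma_finite_measure set T -> \bar R}) (D : set T).
Hypothesis mD : measurable D.
Local Notation lam := (lebesgue_measure : {sigma_finite_measure set (measurableTypeR R) -> \bar R}).
Local Notation W := (m1 \x lam)%E.
Local Notation DW := (D `*` (@I01 R : set (measurableTypeR R))).
Local Notation H := (@Hsp R).
Local Notation hsq := (nsq (leb R) (@I01 R)).
Implicit Types (A B : T -> R -> R[i]).

Definition unc A : T * measurableTypeR R -> R[i] := fun z => A z.1 z.2.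
(** Functions of the frequency and random elements are both functions with
    values in the Hilbert space which are square-integrable in the two arguments
    together. The geometry of such fields is that of the square-integrable
    functions for the product measure. *)
Definition field A : Prop := L2 W DW (unc A).
Definition fip A B : R[i] := ip W DW (unc A) (unc B).
Definition fsq A : R := nsq W DW (unc A).

Lemma measurable_DW : measurable DW.
Proof. by apply: measurableX; [exact: mD|exact: measurable_I01]. Qed.

Lemma field_ae A : field A -> {ae m1, forall s, D s -> H (A s)}.
Proof. exact: (L2_rect_ae mD (@measurable_I01 R)). Qed.

Lemma fipE A B : field A -> field B ->
  fip A B = cintegral m1 D (fun s => inner (A s) (B s)).
Proof. exact: (ip_rect mD (@measurable_I01 R)). Qed.

Lemma fsqE A : field A -> fsq A = \int[m1]_(s in D) hsq (A s).
Proof. exact: (nsq_rect mD (@measurable_I01 R)). Qed.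

Lemma field_hsq_int A : field A -> m1.-integrable D (fun s => (hsq (A s))%:E).
Proof. exact: (nsq_rect_int mD (@measurable_I01 R)). Qed.

Lemma fip_meas A B : field A -> field B ->
  cmeasurable D (fun s => inner (A s) (B s)).
Proof.
move=> FA FB.
exact: (cmeasurable_section_integral mD (@measurable_I01 R) lam
    (cintegrable_cmeasurable (L2_mulJ measurable_DW FA FB))).
Qed.

Lemma fip_int A B : field A -> field B -> cintegrable m1 D (fun s => inner (A s) (B s)).
Proof.
move=> FA FB.
apply: (cintegrable_le_ae mD (u := fun s => hsq (A s) + hsq (B s))).
- exact: fip_meas.
- by under eq_fun do rewrite EFinD; apply: integrableD;
    [exact: mD|exact: field_hsq_int|exact: field_hsq_int].
- apply: aeS2 (field_ae FA) (field_ae FB) => s a b Ds.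
  have := inner_le (a Ds) (b Ds); have := nsq_ge0 (leb R) (@I01 R) (A s).
  have := nsq_ge0 (leb R) (@I01 R) (B s); move: (nsq _ _ _) (nsq _ _ _) => q p q0 p0 h.
  rewrite -(@ler_pXn2r _ 2) ?nnegrE ?addr_ge0//; apply: le_trans h _.
  by rewrite sqrrD; have := mulr_ge0 p0 q0; have := sqr_ge0 p; have := sqr_ge0 q; lra.
Qed.

Lemma inner_field_meas A y : field A -> H y -> cmeasurable D (fun s => inner (A s) y).
Proof.
move=> FA Hy.
apply: (cmeasurable_section_integral mD (@measurable_I01 R) lam
  (f := fun z => unc A z * conjc (y z.2))).
apply: cmeasurableM; first exact: (L2_meas FA).
exact/cmeasurableJ/(cmeasurable_snd _ (@measurable_I01 R))/(L2_meas Hy).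
Qed.

Lemma inner_field_L2 A y : field A -> H y -> L2 m1 D (fun s => inner (A s) y).
Proof.
move=> FA Hy.
apply: (L2_le_ae mD (K := hsq y) _ (field_hsq_int FA)).
  exact: inner_field_meas.
apply: aeS1 (field_ae FA) => s h Ds; rewrite mulrC; apply: inner_le => //.
exact: h.
Qed.

(** Fubini's theorem for the pairing of the field with the tensor product of [a]
    and [y]. *)
Lemma inner_field_fubini A y a : field A -> H y -> L2 m1 D a ->
  ip m1 D (fun s => inner (A s) y) a =
  cintegral (leb R) (@I01 R) (fun u => ip m1 D (A^~ u) a * conjc (y u)).
Proof.
move=> FA Hy La.
have FB : field (fun s u => a s * y u).
  exact: (L2_tensor mD (@measurable_I01 R) (m1 := m1) (m2 := lam)).
have h := L2_mulJ measurable_DW FA FB.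
transitivity (fip A (fun s u => a s * y u)).
  rewrite fipE//; apply: ae_eq_cintegral.
  - exact: mD.
  - apply: cmeasurableM; first exact: inner_field_meas.
    exact/cmeasurableJ/(L2_meas La).
  - exact: fip_meas.
  - apply: aeS1 (field_ae FA) => s hs Ds.
    by rewrite (innerZr _ (hs Ds) Hy) mulrC.
rewrite /fip {1}/ip (fubini_rect2 mD (@measurable_I01 R) h).
have FA' := L2_swap mD (@measurable_I01 R) FA.
apply: ae_eq_cintegral.
- exact: measurable_I01.
- apply: (cmeasurable_section_integral (@measurable_I01 R) mD m1
    (f := fun z => unc A (z.2, z.1) * conjc (a z.2 * y z.1))).
  exact: (cmeasurable_swap mD (@measurable_I01 R) (cintegrable_cmeasurable h)).
- apply: cmeasurableM; last exact/cmeasurableJ/(L2_meas Hy).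
  apply: (cmeasurable_section_integral (@measurable_I01 R) mD m1
    (f := fun z => unc A (z.2, z.1) * conjc (a z.2))).
  apply: cmeasurableM; first exact: L2_meas FA'.
  exact/cmeasurableJ/(cmeasurable_snd _ mD)/(L2_meas La).
- apply: aeS1 (L2_rect_ae (@measurable_I01 R) mD FA') => u hu Iu.
  rewrite mulrC -cintegralZ//; last exact: (L2_mulJ mD (hu Iu) La).
  by apply: eq_cintegral => s _; rewrite /unc /= conjcM; ring.
Qed.

Lemma ip_field_L2 A a : field A -> L2 m1 D a -> H (fun u => ip m1 D (A^~ u) a).
Proof.
move=> FA La; have FA' := L2_swap mD (@measurable_I01 R) FA.
apply: (L2_le_ae (@measurable_I01 R) (K := nsq m1 D a) _
  (nsq_rect_int (@measurable_I01 R) mD FA')).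
  apply: (cmeasurable_section_integral (@measurable_I01 R) mD m1
    (f := fun z => unc A (z.2, z.1) * conjc (a z.2))).
  apply: cmeasurableM; first exact: L2_meas FA'.
  exact/cmeasurableJ/(cmeasurable_snd _ mD)/(L2_meas La).
apply: aeS1 (L2_rect_ae (@measurable_I01 R) mD FA') => u hu Iu.
by rewrite mulrC; apply: (cauchy_schwarz mD (hu Iu) La).
Qed.

Lemma fieldZ c A : field A -> field (fun s u => c * A s u).
Proof. exact: (L2Z measurable_DW). Qed.

Lemma fieldB A B : field A -> field B -> field (fun s u => A s u - B s u).
Proof. exact: (L2B measurable_DW). Qed.

Lemma field_sum I (r : seq I) (Q : pred I) (A : I -> T -> R -> R[i]) :
  (forall i, field (A i)) -> field (fun s u => \sum_(i <- r | Q i) A i s u).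
Proof. exact: (L2_sum measurable_DW). Qed.

Lemma fipJ A B : field A -> field B -> conjc (fip A B) = fip B A.
Proof. exact: (ipJ measurable_DW). Qed.

Lemma fipZl c A B : field A -> field B -> fip (fun s u => c * A s u) B = c * fip A B.
Proof. exact: (ipZl measurable_DW). Qed.

Lemma fipZr c A B : field A -> field B -> fip A (fun s u => c * B s u) = conjc c * fip A B.
Proof. exact: (ipZr measurable_DW). Qed.

Lemma fipBl A B C : field A -> field B -> field C ->
  fip (fun s u => A s u - B s u) C = fip A C - fip B C.
Proof. exact: (ipBl measurable_DW). Qed.

Lemma fip_suml I (r : seq I) (Q : pred I) (A : I -> T -> R -> R[i]) B :
  (forall i, field (A i)) -> field B ->
  fip (fun s u => \sum_(i <- r | Q i) A i s u) B = \sum_(i <- r | Q i) fip (A i) B.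
Proof. exact: (ip_suml measurable_DW). Qed.

Lemma fip_sumr I (r : seq I) (Q : pred I) (A : I -> T -> R -> R[i]) B :
  (forall i, field (A i)) -> field B ->
  fip B (fun s u => \sum_(i <- r | Q i) A i s u) = \sum_(i <- r | Q i) fip B (A i).
Proof. exact: (ip_sumr measurable_DW). Qed.

Lemma fipxx A : field A -> fip A A = ((fsq A)%:C)%C.
Proof. exact: (ipxx measurable_DW). Qed.

Lemma fsqB A B : field A -> field B ->
  fsq (fun s u => A s u - B s u) = fsq A - 2 * complex.Re (fip A B) + fsq B.
Proof. exact: (nsqB measurable_DW). Qed.

Lemma eq_fsq A B : (forall s u, A s u = B s u) -> fsq A = fsq B.
Proof. by move=> e; apply: eq_nsq => -[s u] _; rewrite /unc e. Qed.

Lemma fsq_ge0 A : 0 <= fsq A. Proof. exact: nsq_ge0. Qed.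

Lemma field_tensor b x : L2 m1 D b -> H x -> field (fun s u => b s * x u).
Proof.
exact: (@L2_tensor _ _ T (measurableTypeR R) R D (@I01 R)
  mD (@measurable_I01 R) m1 lam).
Qed.

Lemma fip_tensor b b' x x' : L2 m1 D b -> L2 m1 D b' -> H x -> H x' ->
  fip (fun s u => b s * x u) (fun s u => b' s * x' u) = ip m1 D b b' * inner x x'.
Proof.
exact: (@ip_tensor _ _ T (measurableTypeR R) R D (@I01 R)
  mD (@measurable_I01 R) m1 lam).
Qed.

End Fields.

Section FourierSeries.
Variable R : realType.
Local Notation lam := (lebesgue_measure : {sigma_finite_measure set (measurableTypeR R) -> \bar R}).
Local Notation W := (lam \x lam)%E.
Local Notation DW := ((@Ipi R : set (measurableTypeR R)) `*` (@I01 R : set (measurableTypeR R))).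
Local Notation H := (@Hsp R).
Local Notation hsq := (nsq (leb R) (@I01 R)).
Local Notation mu := (leb R).
Local Notation D := (@Ipi R).
Local Notation field := (@field _ (measurableTypeR R) R lam D).
Local Notation fip := (@fip _ (measurableTypeR R) R lam D).
Local Notation fsq := (@fsq _ (measurableTypeR R) R lam D).
Local Notation unc := (@unc _ (measurableTypeR R) R).
Local Notation measurable_DW := (measurable_DW (@measurable_Ipi R)).
Local Notation fieldZ := (fieldZ (@measurable_Ipi R)).
Local Notation fieldB := (fieldB (@measurable_Ipi R)).
Local Notation field_sum := (field_sum (@measurable_Ipi R)).
Local Notation field_ae := (field_ae (@measurable_Ipi R)).
Local Notation fipE := (fipE (@measurable_Ipi R)).
Local Notation fsqE := (fsqE (@measurable_Ipi R)).
Local Notation field_hsq_int := (field_hsq_int (@measurable_Ipi R)).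
Local Notation fip_meas := (fip_meas (@measurable_Ipi R)).
Local Notation fip_int := (fip_int (@measurable_Ipi R)).
Local Notation fipZl := (fipZl (@measurable_Ipi R)).
Local Notation fipZr := (fipZr (@measurable_Ipi R)).
Local Notation fipBl := (fipBl (@measurable_Ipi R)).
Local Notation fip_suml := (fip_suml (@measurable_Ipi R)).
Local Notation fip_sumr := (fip_sumr (@measurable_Ipi R)).
Local Notation fipxx := (fipxx (@measurable_Ipi R)).
Local Notation fsqB := (fsqB (@measurable_Ipi R)).
Local Notation fsq_ge0 := (fsq_ge0 lam D).
Local Notation field_tensor := (field_tensor (m1 := lam) (@measurable_Ipi R)).
Local Notation fip_tensor := (fip_tensor (m1 := lam) (@measurable_Ipi R)).
Implicit Types (A B : R -> R -> R[i]).

Lemma field_cst x : H x -> field (fun _ u => x u).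
Proof.
move=> Hx; have := @L2_tensor _ _ (measurableTypeR R) (measurableTypeR R) R D (@I01 R)
  (@measurable_Ipi R) (@measurable_I01 R) lam lam _ _ (L2_cis 0) Hx.
by apply: (L2_eq measurable_DW) => -[s u] _ /=; rewrite mul0r cis0 mul1r.
Qed.

(** [fpc_filter] depends on a family only through one member; here it is an
    arbitrary function of the frequency. *)
Definition fcoef A (l : int) : R -> R[i] := fpc_filter (fun=> A) 0 l.

Lemma pi2_gt0 : 0 < 2 * pi :> R. Proof. by rewrite mulr_gt0// pi_gt0. Qed.

Lemma pi2_ge1 : 1 <= 2 * pi :> R.
Proof. by have := pi_ge2 R; lra. Qed.

Section Coefficients.
Variable A : R -> R -> R[i].
Hypothesis FA : field A.

Let FA' : L2 W ((@I01 R : set (measurableTypeR R)) `*` (D : set (measurableTypeR R)))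
    (fun z => A z.2 z.1).
Proof. exact: (L2_swap (@measurable_Ipi R) (@measurable_I01 R) FA). Qed.

Let good := [set u | I01 u /\ (L2normsq mu D (fun s => A s u) < +oo)%E].

Let mgood : measurable (good : set (measurableTypeR R)).
Proof.
apply: emeasurable_fun_infty_o => //; first exact: measurable_I01.
apply: (ge0_measurable_section_integral (@measurable_I01 R) (@measurable_Ipi R) lam
  (f := fun z => (normc (A z.2 z.1) ^+ 2)%:E)).
  exact/measurable_EFinP/measurable_normc2/(L2_meas FA').
by move=> z _; rewrite lee_fin sqr_ge0.
Qed.

Let goodP u : I01 u -> good u <-> L2 mu D (fun s => A s u).
Proof.
move=> Iu; split => [[_ h]|[_ h]]; split => //.
exact: (cmeasurable_section (@measurable_I01 R) (@measurable_Ipi R) Iu (L2_meas FA')).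
Qed.

Let good_ae : {ae mu, forall u, I01 u -> good u}.
Proof.
have := L2_rect_ae (@measurable_I01 R) (@measurable_Ipi R) FA'.
by apply: aeS1 => u h Iu; apply/goodP => //; exact: h.
Qed.

Lemma fcoef_in l u : I01 u -> fcoef A l u = if u \in good then
  (((2 * pi)^-1 : R)%:C)%C * cintegral mu D (fun s => A s u * cis (- (l%:~R * s))) else 0.
Proof.
move=> Iu; rewrite /fcoef /fpc_filter; case: asboolP => h.
  by rewrite mem_set//; exact/goodP.
by rewrite memNset// => gu; apply: h; exact/goodP.
Qed.

Let cisN l (s : R) : cis (- (l%:~R * s)) = conjc (cis (l%:~R * s)).
Proof. by rewrite cisJ. Qed.

Let meas_int l : @cmeasurable _ (measurableTypeR R) R (@I01 R)
  (fun u => cintegral mu D (fun s => A s u * cis (- (l%:~R * s)))).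
Proof.
apply: (cmeasurable_section_integral (@measurable_I01 R) (@measurable_Ipi R) lam
  (f := fun z => A z.2 z.1 * cis (- (l%:~R * z.2)))).
apply: cmeasurableM; first exact: (L2_meas FA').
have h0 : @cmeasurable _ (measurableTypeR R) R D (fun s => cis (- (l%:~R * s))).
  by under eq_fun do rewrite -mulNr; exact: cmeasurable_cis.
exact: (cmeasurable_snd (@I01 R : set (measurableTypeR R)) (@measurable_Ipi R) h0).
Qed.

Lemma fcoef_meas l : @cmeasurable _ (measurableTypeR R) R (@I01 R) (fcoef A l).
Proof.
apply: (@cmeasurable_eq _ (measurableTypeR R) R (@I01 R) (fun u => if u \in good then
  (((2 * pi)^-1 : R)%:C)%C * cintegral mu D (fun s => A s u * cis (- (l%:~R * s))) else 0)).
  by move=> u Iu; rewrite fcoef_in.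
by apply: cmeasurable_if => //; exact/cmeasurableZ/meas_int.
Qed.

(** At almost every point the Cauchy-Schwarz inequality bounds the coefficient
    by the norm of the section of the field. *)
Lemma fcoef_L2 l : H (fcoef A l).
Proof.
split; first exact: fcoef_meas.
have fin := FA'.2; rewrite (L2_rect (@measurable_I01 R) (@measurable_Ipi R)) in fin;
  last exact: (L2_meas FA').
apply: le_lt_trans fin; apply: ge0_le_integral => //.
- exact: measurable_I01.
- by move=> u _; rewrite lee_fin sqr_ge0.
- exact/measurable_EFinP/measurable_normc2/fcoef_meas.
- apply: (ge0_measurable_section_integral (@measurable_I01 R) (@measurable_Ipi R) lam
    (f := fun z => (normc (A z.2 z.1) ^+ 2)%:E)).
    exact/measurable_EFinP/measurable_normc2/(L2_meas FA').
  by move=> z _; rewrite lee_fin sqr_ge0.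
- move=> u Iu; rewrite fcoef_in//; case: ifPn => [/set_mem gu|_]; last first.
    by rewrite normc0 expr0n; apply: integral_ge0 => s _; rewrite lee_fin sqr_ge0.
  have Lu := (goodP Iu).1 gu.
  rewrite [leRHS](L2normsqE (@measurable_Ipi R) Lu) lee_fin.
  rewrite normcM exprMn normc_real.
  have -> : cintegral mu D (fun s => A s u * cis (- (l%:~R * s))) =
      ip mu D (fun s => A s u) (fun s => cis (l%:~R * s)).
    by apply: eq_cintegral => s _; rewrite cisN.
  have := cauchy_schwarz (@measurable_Ipi R) Lu (L2_cis (l%:~R)).
  have -> : nsq mu D (fun s => cis (l%:~R * s)) = 2 * pi.
    apply: complexI; rewrite -(ipxx (@measurable_Ipi R)); last exact: L2_cis.
    by rewrite ip_cis eqxx.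
  move=> cs.
  rewrite ger0_norm ?invr_ge0 ?(ltW pi2_gt0)//.
  apply: (@le_trans _ _ ((2 * pi)^-1 ^+ 2 * (nsq mu D (fun s => A s u) * (2 * pi)))).
    by rewrite ler_wpM2l// sqr_ge0.
  have -> : (2 * pi)^-1 ^+ 2 * (nsq mu D (fun s => A s u) * (2 * pi)) =
      (2 * pi)^-1 * nsq mu D (fun s => A s u).
    by rewrite (mulrC (nsq _ _ _)) mulrA expr2 -(mulrA (2 * pi)^-1) mulVf ?mulr1// gt_eqF// pi2_gt0.
  by rewrite -[leRHS]mul1r ler_wpM2r ?nsq_ge0// invf_le1 ?pi2_gt0// pi2_ge1.
Qed.

(** Fubini's theorem. This weak form replaces the pointwise definition of the
    coefficients in all that follows. *)
Lemma fip_fcoef l y : H y ->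
  fip A (fun s u => cis (l%:~R * s) * y u) = ((2 * pi : R)%:C)%C * inner (fcoef A l) y.
Proof.
move=> Hy.
have FB := field_tensor (L2_cis (l%:~R)) Hy.
rewrite /fip /ip (fubini_rect2 (@measurable_Ipi R) (@measurable_I01 R)); last first.
  exact: (L2_mulJ measurable_DW).
rewrite /inner -cintegralZ; last 2 first.
- exact: measurable_I01.
- by apply: L2_mulJ => //; [exact: measurable_I01|exact: fcoef_L2].
have pc : ((2 * pi : R)%:C)%C * (((2 * pi)^-1 : R)%:C)%C = 1.
  by rewrite -rmorphM /= divff// gt_eqF// pi2_gt0.
transitivity (cintegral mu (@I01 R) (fun u =>
    cintegral mu D (fun s => A s u * cis (- (l%:~R * s))) * conjc (y u))).
  apply: ae_eq_cintegral.
  - exact: measurable_I01.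
  - have h := L2_mulJ measurable_DW FA FB.
    apply: (cmeasurable_section_integral (@measurable_I01 R) (@measurable_Ipi R) lam
      (f := fun z => unc A (z.2, z.1) * conjc (unc (fun s u => cis (l%:~R * s) * y u) (z.2, z.1)))).
    exact: (cmeasurable_swap (@measurable_Ipi R) (@measurable_I01 R) (cintegrable_cmeasurable h)).
  - by apply: cmeasurableM; [exact: meas_int|exact/cmeasurableJ/(L2_meas Hy)].
  - apply: aeS1 good_ae => u h Iu; rewrite mulrC -cintegralZ.
    + by apply: eq_cintegral => s _; rewrite /unc /= conjcM cisN; ring.
    + exact: measurable_Ipi.
    + under eq_fun do rewrite cisN.
      by apply: L2_mulJ; [exact: measurable_Ipi|exact/(goodP Iu)/(h Iu)|exact: L2_cis].
apply: ae_eq_cintegral.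
- exact: measurable_I01.
- by apply: cmeasurableM; [exact: meas_int|exact/cmeasurableJ/(L2_meas Hy)].
- apply: cmeasurableZ; apply: cmeasurableM; first exact: fcoef_meas.
  exact/cmeasurableJ/(L2_meas Hy).
- apply: aeS1 good_ae => u h Iu; rewrite fcoef_in// mem_set; last exact: h.
  by rewrite !mulrA pc mul1r.
Qed.

Definition fourier_term l : R -> R -> R[i] := fun s u => cis (l%:~R * s) * fcoef A l u.

Lemma fourier_term_field l : field (fourier_term l).
Proof. exact: (field_tensor (L2_cis l%:~R) (fcoef_L2 l)). Qed.

Lemma fip_fourier_term l l' : fip (fourier_term l) (fourier_term l') =
  if l == l' then ((2 * pi * hsq (fcoef A l))%:C)%C else 0.
Proof.
rewrite /fourier_term fip_tensor; try exact: L2_cis; try exact: fcoef_L2.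
rewrite ip_cis; case: eqP => [<-|_]; last by rewrite mul0r.
by rewrite innerxx -?rmorphM//; exact: fcoef_L2.
Qed.

Definition fweight l : R := 2 * pi * hsq (fcoef A l).

Lemma fweight_ge0 l : 0 <= fweight l.
Proof. by rewrite mulr_ge0 ?(ltW pi2_gt0)// nsq_ge0. Qed.

(** Distinct frequencies are orthogonal. The mask [b] covers partial sums and
    their tails alike. *)
Lemma fsq_fourier_sum (b : int -> bool) N :
  fsq (fun s u => zs N (fun l => (b l)%:R * fourier_term l s u)) =
  zs N (fun l => (b l)%:R * fweight l).
Proof.
have F l : field (fun s u => (b l)%:R * fourier_term l s u).
  exact/fieldZ/fourier_term_field.
have Fs : field (fun s u => zs N (fun l => (b l)%:R * fourier_term l s u)) by exact: field_sum.
have E l l' : fip (fun s u => (b l)%:R * fourier_term l s u)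
    (fun s u => (b l')%:R * fourier_term l' s u) =
    if l == l' then (((b l)%:R * fweight l)%:C)%C else 0.
  rewrite fipZl//; last exact: fourier_term_field.
  rewrite fipZr; try exact: fourier_term_field.
  rewrite fip_fourier_term; case: eqP => [<-|_]; last by rewrite !mulr0.
  by case: (b l); rewrite ?conjc1 ?conjc0 ?mul1r ?mul0r.
apply: complexI; rewrite -fipxx// /zs fip_suml// rmorph_sum; apply: eq_bigr => k _.
rewrite fip_sumr// (bigD1 k)//= big1 ?addr0 => [|j jk]; first by rewrite E eqxx.
rewrite E ifF//; apply/negbTE; apply: contra jk => /eqP e.
by apply/eqP/val_inj => /=; lia.
Qed.

Definition fourier_sum N : R -> R -> R[i] := fun s u => zsum N (fun l => cis (l%:~R * s) * fcoef A l u).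

Lemma fourier_sum_field N : field (fourier_sum N).
Proof. by apply: field_sum => k; exact: fourier_term_field. Qed.

Lemma fsq_fourier_sumT N : fsq (fourier_sum N) = zs N fweight.
Proof.
have := fsq_fourier_sum xpredT N; rewrite (eq_zs N (_ : forall l, true%:R * fweight l = fweight l)) => [<-|l]; last by rewrite mul1r.
by apply: eq_fsq => s u; apply: eq_zs => l; rewrite mul1r.
Qed.

Lemma fourier_bessel N : zs N fweight <= fsq A.
Proof.
have := fsq_ge0 (fun s u => A s u - fourier_sum N s u).
rewrite fsqB//; last exact: fourier_sum_field.
rewrite fsq_fourier_sumT /fourier_sum /zsum fip_sumr//; last first.
  by move=> k; exact: fourier_term_field.
have E l : complex.Re (fip A (fourier_term l)) = fweight l.
  rewrite fip_fcoef; last exact: fcoef_L2.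
  by rewrite innerxx ?cReM /= ?mul0r ?subr0//; exact: fcoef_L2.
rewrite cRe_sum; under [X in _ - 2 * X + _]eq_bigr do rewrite -/(fourier_term _) E.
by rewrite -/(zs N fweight); lra.
Qed.

(** Completeness of the trigonometric system, for functions with values in the
    Hilbert space: the limit of the Fourier series has the same coefficients as
    the field, and the coordinates of their difference in an orthonormal basis
    are functions without Fourier coefficients. *)
Lemma fourier_series_cvg (e : nat -> R -> R[i]) : orthonormal_basis e ->
  fsq (fun s u => fourier_sum N s u - A s u) @[N --> \oo] --> (0 : R).
Proof.
move=> eb; have [[eH eo] _] := eb.
have [L cL] : exists L, L2cvg W DW (fun N z => zsum N (fun l => unc (fourier_term l) z)) L.
  apply: (zsum_L2cvg measurable_DW (a := fweight) (C := fsq A) (K := 1)) => //.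
  - exact: fourier_term_field.
  - exact: fweight_ge0.
  - exact: fourier_bessel.
  - move=> n N; rewrite mul1r.
    have := fsq_fourier_sum (fun l => (n < absz l)%N) N.
    have -> : zs N (fun l => (n < absz l)%N%:R * fweight l) = zs N (zmask n fweight).
      by apply: eq_zs => l; rewrite /zmask; case: ifP; rewrite ?mul1r ?mul0r.
    move=> <-; rewrite le_eqVlt; apply/orP; left; apply/eqP; apply: eq_nsq => z _.
    by apply: eq_zs => l; rewrite /zmask /unc; case: ifP; rewrite ?mul1r ?mul0r.
pose B : R -> R -> R[i] := fun s u => L (s, u).
have LB : L = unc B by apply/funext => -[s u].
have [_ FB0 cB] := cL; have FB : field B by rewrite /field -LB.
have coefB l y : H y -> fip B (fun s u => cis (l%:~R * s) * y u) =
    fip A (fun s u => cis (l%:~R * s) * y u).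
  move=> Hy; have Fy := field_tensor (L2_cis l%:~R) Hy.
  have := ip_cvgl measurable_DW cL Fy; rewrite LB -/(fip _ _) => h.
  apply: (ccvg_unique (ccvg_shift (absz l) h)).
  apply: (@ccvg_eq _ (fun=> fip A (fun s u => cis (l%:~R * s) * y u))); last exact: ccvg_cst.
  move=> n; rewrite -[RHS]/(fip (fourier_sum (n + absz l)) _).
  rewrite /fourier_sum /zsum fip_suml//; last by move=> k; exact: fourier_term_field.
  have E l' : fip (fourier_term l') (fun s u => cis (l%:~R * s) * y u) =
      if l' == l then ((2 * pi : R)%:C)%C * inner (fcoef A l) y else 0.
    rewrite /fourier_term fip_tensor//; try exact: L2_cis; try exact: fcoef_L2.
    by rewrite ip_cis; case: eqP => [->|_]//; rewrite mul0r.
  under eq_bigr do rewrite -/(fourier_term _) E.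
  have [k kE] : exists k : 'I_((n + absz l).*2.+1), l = k%:Z - (n + absz l)%N%:Z.
    have lt : (absz (l + (n + absz l)%N%:Z)%R < (n + absz l).*2.+1)%N by lia.
    by exists (Ordinal lt) => /=; lia.
  rewrite (bigD1 k)//= -kE eqxx big1 ?addr0 ?fip_fcoef// => j jk.
  rewrite ifF//; apply/negbTE; apply: contra jk => /eqP ej.
  by apply/eqP/val_inj => /=; lia.
pose r : R -> R -> R[i] := fun s u => A s u - B s u.
have Fr : field r by exact: fieldB.
have rk k : {ae mu, forall s, D s -> inner (r s) (e k) = 0}.
  apply: fourier_unique => [|l].
    exact: (fip_int Fr (field_cst (eH k))).
  have Fl := field_tensor (L2_cis l%:~R) (eH k).
  have h : fip r (fun s u => cis (l%:~R * s) * e k u) = 0 by rewrite fipBl// coefB// subrr.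
  rewrite -h fipE//; apply: ae_eq_cintegral.
  - exact: measurable_Ipi.
  - apply: cmeasurableM; first exact: (fip_meas Fr (field_cst (eH k))).
    by under eq_fun do rewrite -mulNr; exact: cmeasurable_cis.
  - exact: (fip_meas Fr Fl).
  - apply: aeS1 (field_ae Fr) => s hs Ds; rewrite innerZr; [|exact: hs|exact: eH].
    by rewrite cisJ mulrC.
have r0 : fsq r = 0.
  rewrite fsqE//; transitivity (\int[mu]_(s in D) (0 : R)); last first.
    by rewrite Rintegral_cst ?mul0r//; exact: measurable_Ipi.
  congr fine; apply: ae_eq_integral.
  - exact: measurable_Ipi.
  - exact: measurable_int (field_hsq_int Fr).
  - exact: measurable_cst.
  - apply: aeS2 (field_ae Fr) (ae_foralln rk) => s hs h0 Ds; congr (_%:E).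
    have h : \sum_(k < n) normc (inner (r s) (e k)) ^+ 2 @[n --> \oo] --> (0 : R).
      rewrite (_ : (fun n => _) = (fun=> 0)); first exact: cvg_cst.
      by apply/funext => n; rewrite big1// => k _; rewrite h0// normc0 expr0n.
    exact: cvg_unique (parseval eb (hs Ds)) h.
have E N : fsq (fun s u => fourier_sum N s u - A s u) =
    fsq (fun s u => fourier_sum N s u - B s u).
  have F1 : field (fun s u => fourier_sum N s u - B s u).
    by apply: fieldB => //; exact: fourier_sum_field.
  transitivity (fsq (fun s u => (fourier_sum N s u - B s u) - r s u)).
    by apply: eq_fsq => s u; rewrite /r opprB addrA subrK.
  rewrite fsqB// r0 addr0.
  have := cauchy_schwarz measurable_DW F1 Fr; rewrite -/(fsq r) r0 mulr0 => h.
  have /normc_sq0 -> : normc (fip (fun s u => fourier_sum N s u - B s u) r) ^+ 2 = 0.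
    by apply/eqP; rewrite eq_le h sqr_ge0.
  by rewrite /= mulr0 subr0.
under eq_fun do rewrite E.
by rewrite LB in cB.
Qed.

End Coefficients.

End FourierSeries.

(** * Random elements and covariance operators *)

Section RandomElements.
Context (R : realType) (d : measure_display) (T : measurableType d) (P : probability T R).
Local Notation lam := (lebesgue_measure : {sigma_finite_measure set (measurableTypeR R) -> \bar R}).
Local Notation H := (@Hsp R).
Local Notation hsq := (nsq (leb R) (@I01 R)).
Local Notation field := (field P [set: T]).
Local Notation fip := (fip P [set: T]).
Local Notation fsq := (fsq P [set: T]).
Local Notation mT := (@measurableT _ T).
Implicit Types (Z : T -> R -> R[i]) (x y : R -> R[i]).

Lemma Enormsq_L2 Z : cmeasurable ([set: T] `*` (@I01 R : set (measurableTypeR R))) (unc Z) ->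
  Enormsq P Z = L2normsq (P \x lam)%E ([set: T] `*` @I01 R) (unc Z).
Proof. by move=> mZ; rewrite (L2_rect mT (@measurable_I01 R)). Qed.

Lemma L2H_field Z : L2H P Z -> field Z.
Proof. by move=> [[mZ _] ZE]; split => //; rewrite -Enormsq_L2. Qed.

Lemma field_L2H Z : field Z -> (forall w, H (Z w)) -> L2H P Z.
Proof. by move=> [mZ fZ] ZH; split; [split|rewrite Enormsq_L2]. Qed.

Lemma Enormsq_fsq Z : field Z -> Enormsq P Z = (fsq Z)%:E.
Proof.
move=> FZ; rewrite Enormsq_L2; last exact: (L2_meas FZ).
exact: (L2normsqE (measurable_DW mT) FZ).
Qed.

(** The paths of a field, such as a limit in mean square, are square-integrable
    for almost every outcome only; replacing the other paths by 0 gives a random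
    element. *)
Lemma field_version Z0 : field Z0 -> exists2 Z, L2H P Z &
  forall Z', field Z' -> fsq (fun w u => Z' w u - Z w u) = fsq (fun w u => Z' w u - Z0 w u).
Proof.
move=> F0; have [m0 f0] := F0.
pose good := [set w | (L2normsq (leb R) (@I01 R) (Z0 w) < +oo)%E].
have mgood : measurable good.
  rewrite -[good]setTI; apply: emeasurable_fun_infty_o => //.
  apply: (ge0_measurable_section_integral mT (@measurable_I01 R) lam
    (f := fun z => (normc (unc Z0 z) ^+ 2)%:E)).
    exact/measurable_EFinP/measurable_normc2.
  by move=> z _; rewrite lee_fin sqr_ge0.
have good_ae : {ae P, forall w, good w}.
  by apply: aeS1 (field_ae mT F0) => w h; have [] := h I.
pose Z w u := if w \in good then Z0 w u else 0.
have FZ : field Z.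
  apply: (L2_eq (measurable_DW mT) (f := fun z => ((\1_good z.1 : R)%:C)%C * unc Z0 z)).
    move=> [w u] _; rewrite /unc /Z /= indicE.
    by case: (w \in good); rewrite ?mul1r ?mul0r.
  apply: (L2_bounded (measurable_DW mT) (K := 1)) => //.
    apply: (cmeasurable_fst _ mT (f := fun w => ((\1_good w : R)%:C)%C)).
    by apply: cmeasurable_real; exact: measurable_indic.
  move=> z _; rewrite normc_real indicE; case: (_ \in _); rewrite ?normr1 ?normr0//.
exists Z.
  apply: field_L2H => // w; rewrite /Z; case: (boolP (w \in good)) => [/set_mem gw|_].
    by split => //; exact: (cmeasurable_section mT (@measurable_I01 R) I m0).
  exact: L2_0.
move=> Z' FZ'; rewrite !(fsqE mT); try exact: (fieldB mT).
congr fine; apply: ae_eq_integral => //.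
- exact: measurable_int (field_hsq_int mT (fieldB mT FZ' FZ)).
- exact: measurable_int (field_hsq_int mT (fieldB mT FZ' F0)).
- by apply: aeS1 good_ae => w gw _; rewrite /Z mem_set.
Qed.

Lemma inner_L2 Z x : L2H P Z -> H x -> L2 P setT (fun w => inner (Z w) x).
Proof. by move=> /L2H_field FZ; exact: (inner_field_L2 mT). Qed.

Lemma inner_nsq_le Z x : L2H P Z -> H x ->
  nsq P setT (fun w => inner (Z w) x) <= fsq Z * hsq x.
Proof.
move=> LZ Hx; have FZ := L2H_field LZ; rewrite (fsqE mT FZ) mulrC -RintegralZl//; last first.
  exact: (field_hsq_int mT FZ).
apply: le_Rintegral => //.
- exact: (L2_int (inner_L2 LZ Hx)).
- by apply: integrable_scale => //; exact: (field_hsq_int mT FZ).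
- by move=> w _; rewrite mulrC; apply: inner_le => //; case: LZ => -[].
Qed.

Lemma L2H_cvgP (s : nat -> T -> R -> R[i]) Z : (forall n, field (s n)) -> L2H P Z ->
  fsq (fun w u => s n w u - Z w u) @[n --> \oo] --> (0 : R) <->
  converges (L2H P) (Enormsq P) s Z.
Proof.
move=> Fs LZ; have FZ := L2H_field LZ.
have E : (fun n => Enormsq P (s n - Z)) = (fun n => (fsq (fun w u => s n w u - Z w u))%:E).
  by apply/funext => n; rewrite -(Enormsq_fsq (fieldB mT (Fs n) FZ)).
split=> [c|[_]]; [split => //|]; rewrite E.
  by apply/fine_cvgP; split => //; exact: nearW.
by move/fine_cvgP=> [].
Qed.

End RandomElements.

Section Autocovariance.
Context (R : realType) (d : measure_display) (T : measurableType d) (P : probability T R).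
Variable X : int -> T -> R -> R[i].
Local Notation lam := (lebesgue_measure : {sigma_finite_measure set (measurableTypeR R) -> \bar R}).
Local Notation H := (@Hsp R).
Local Notation hsq := (nsq (leb R) (@I01 R)).
Local Notation fsq := (fsq P [set: T]).
Local Notation mT := (@measurableT _ T).
Local Notation II := ((@I01 R : set (measurableTypeR R)) `*` (@I01 R : set (measurableTypeR R))).
Implicit Types (x y : R -> R[i]).

Hypothesis XL : forall t, L2H P (X t).

Let XF t : field P setT (X t). Proof. exact: L2H_field. Qed.

Let XF' t : L2 (lam \x P)%E ((@I01 R : set (measurableTypeR R)) `*` [set: T]) (fun z => X t z.2 z.1).
Proof. exact: (L2_swap mT (@measurable_I01 R) (XF t)). Qed.

Lemma mII : measurable II.
Proof. by apply: measurableX; exact: measurable_I01. Qed.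

Lemma autocov_meas t h : cmeasurable II (fun z => autocov P X t h z.1 z.2).
Proof.
have m1 (p : measurableTypeR R * measurableTypeR R -> measurableTypeR R) s :
    measurable_fun setT p -> (forall z, II z -> I01 (p z)) ->
    cmeasurable (II `*` [set: T]) (fun z => X s z.2 (p z.1)).
  move=> mp pI.
  have c d3 (T3 : measurableType d3) (g : measurableTypeR R * T -> T3) :
      measurable_fun ((@I01 R : set (measurableTypeR R)) `*` [set: T]) g ->
      measurable_fun (II `*` [set: T]) (fun z => g (p z.1, z.2)).
    move=> mg; apply: (@measurable_comp _ _ _ _ _ _ ((@I01 R : set (measurableTypeR R)) `*` [set: T])
      g _ (fun z => (p z.1, z.2))) => //.
    - by apply: measurableX => //; exact: measurable_I01.
    - by move=> _ [[z w] [/= zI _] <-]; split => //; exact: pI.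
    - apply: measurable_funTS; apply: measurable_fun_pair; last exact: measurable_snd.
      by apply: measurableT_comp => //; exact: measurable_fst.
  have [a b] := L2_meas (XF' s); split.
    exact: (c _ _ (fun z => complex.Re (X s z.2 z.1))).
  exact: (c _ _ (fun z => complex.Im (X s z.2 z.1))).
apply: (cmeasurable_section_integral mII mT P
  (f := fun z => X (t + h) z.2 z.1.1 * conjc (X t z.2 z.1.2))).
apply: cmeasurableM.
  by apply: (m1 fst) => [|z []//]; exact: measurable_fst.
by apply: cmeasurableJ; apply: (m1 snd) => [|z []//]; exact: measurable_snd.
Qed.

Lemma kernel_meas t h x : H x -> @cmeasurable _ (measurableTypeR R) R (@I01 R)
  (fun u => cintegral (leb R) (@I01 R) (fun v => autocov P X t h u v * x v)).
Proof.
move=> Hx; apply: (cmeasurable_section_integral (@measurable_I01 R) (@measurable_I01 R) lam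
  (f := fun z => autocov P X t h z.1 z.2 * x z.2)).
apply: cmeasurableM; first exact: autocov_meas.
exact: (cmeasurable_snd _ (@measurable_I01 R) (L2_meas Hx)).
Qed.

Let XL2_ae t : {ae leb R, forall u, I01 u -> L2 P setT (fun w => X t w u)}.
Proof. exact: (L2_rect_ae (@measurable_I01 R) mT (XF' t)). Qed.

(** Fubini's theorem, at the points where the process is square-integrable:
    there the pointwise kernel can be integrated under the expectation. *)
Lemma kernel_ae t h x : H x -> {ae leb R, forall u, I01 u ->
  cintegral (leb R) (@I01 R) (fun v => autocov P X t h u v * x v) =
  ip P setT (fun w => X (t + h) w u) (fun w => inner (X t w) x)}.
Proof.
move=> Hx; apply: aeS1 (XL2_ae (t + h)) => u hu Iu; have {}hu := hu Iu.
have Lx := inner_L2 (XL t) Hx.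
rewrite -(ipJ mT Lx hu) (inner_field_fubini mT (XF t) Hx hu).
rewrite -cintegralJ; last 2 first.
- exact: measurable_I01.
- exact: (L2_mulJ (@measurable_I01 R) (ip_field_L2 mT (XF t) hu) Hx).
apply: ae_eq_cintegral.
- exact: measurable_I01.
- apply: cmeasurableM; last exact: (L2_meas Hx).
  exact: (cmeasurable_section (@measurable_I01 R) (@measurable_I01 R) Iu (autocov_meas t h)).
- apply: cmeasurableJ; apply: cmeasurableM; first exact: (L2_meas (ip_field_L2 mT (XF t) hu)).
  exact/cmeasurableJ/(L2_meas Hx).
- apply: aeS1 (XL2_ae t) => v hv Iv; rewrite conjcM conjcK; congr (_ * _).
  exact/esym/(ipJ mT (hv Iv) hu).
Qed.

Lemma kernel_H t h x : H x ->
  H (fun u => cintegral (leb R) (@I01 R) (fun v => autocov P X t h u v * x v)).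
Proof.
move=> Hx; have Lx := inner_L2 (XL t) Hx.
apply: (L2_le_ae (@measurable_I01 R) (K := 1) _ (L2_int (ip_field_L2 mT (XF (t + h)) Lx))).
  exact: kernel_meas.
by apply: aeS1 (kernel_ae t h Hx) => u hu Iu; rewrite hu// mul1r.
Qed.

Lemma inner_covariance t h x y : H x -> H y ->
  ip P setT (fun w => inner (X (t + h) w) y) (fun w => inner (X t w) x) =
  inner (fun u => cintegral (leb R) (@I01 R) (fun v => autocov P X t h u v * x v)) y.
Proof.
move=> Hx Hy; have Lx := inner_L2 (XL t) Hx.
rewrite (inner_field_fubini mT (XF (t + h)) Hy Lx).
apply: ae_eq_cintegral.
- exact: measurable_I01.
- apply: cmeasurableM; first exact: (L2_meas (ip_field_L2 mT (XF (t + h)) Lx)).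
  exact/cmeasurableJ/(L2_meas Hy).
- apply: cmeasurableM; last exact/cmeasurableJ/(L2_meas Hy).
  exact: kernel_meas.
- by apply: aeS1 (kernel_ae t h Hx) => u hu Iu; rewrite hu.
Qed.

Hypothesis stat : forall t h,
    {ae (lam \x lam)%E, forall z : R * R, I01 z.1 -> I01 z.2 ->
        autocov P X t h z.1 z.2 = autocov P X 0 h z.1 z.2}.

Lemma covop_H h x : H x -> H (covop P X h x).
Proof. exact: kernel_H. Qed.

(** Stationarity holds at almost every pair of points, hence at almost every
    point of almost every section of the square. *)
Lemma cov_covop t h x y : H x -> H y ->
  ip P setT (fun w => inner (X (t + h) w) y) (fun w => inner (X t w) x) =
  inner (covop P X h x) y.
Proof.
move=> Hx Hy; rewrite (inner_covariance t h Hx Hy) /inner /covop; apply: ae_eq_cintegral.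
- exact: measurable_I01.
- by apply: cmeasurableM; [exact: kernel_meas|exact/cmeasurableJ/(L2_meas Hy)].
- by apply: cmeasurableM; [exact: kernel_meas|exact/cmeasurableJ/(L2_meas Hy)].
- have := @ae_rect _ _ (measurableTypeR R) (measurableTypeR R) R (@I01 R) (@I01 R) lam lam
    (fun u v => autocov P X t h u v = autocov P X 0 h u v) (stat t h).
  apply: aeS1 => u hu Iu.
  apply: (congr1 (fun z => z * conjc (y u))).
  apply: (@ae_eq_cintegral _ _ _ (leb R) _ (@measurable_I01 R)).
  + apply: cmeasurableM; last exact: (L2_meas Hx).
    exact: (cmeasurable_section (@measurable_I01 R) (@measurable_I01 R) Iu (autocov_meas t h)).
  + apply: cmeasurableM; last exact: (L2_meas Hx).
    exact: (cmeasurable_section (@measurable_I01 R) (@measurable_I01 R) Iu (autocov_meas 0 h)).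
  + by apply: aeS1 (hu Iu) => v hv Iv; rewrite hv.
Qed.

Lemma cov_covop_sub s t x y : H x -> H y ->
  ip P setT (fun w => inner (X s w) y) (fun w => inner (X t w) x) =
  inner (covop P X (s - t) x) y.
Proof. by move=> Hx Hy; rewrite -(cov_covop t (s - t) Hx Hy) [t + _]addrC subrK. Qed.

Lemma covop_suml h n (c : nat -> R[i]) (e : nat -> R -> R[i]) y : (forall k, H (e k)) -> H y ->
  inner (covop P X h (fun u => \sum_(k < n) c k * e k u)) y =
  \sum_(k < n) c k * inner (covop P X h (e k)) y.
Proof.
move=> eH Hy.
have L k : H (fun u => c k * e k u) by exact/HspZ/eH.
have Ls : H (fun u => \sum_(k < n) c k * e k u) by exact: Hsp_sum.
have Ly := inner_L2 (XL (0 + h)) Hy.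
rewrite -(cov_covop 0 h Ls Hy).
have LX k : L2 P setT (fun w => inner (X 0 w) (e k)) by exact: inner_L2.
have E : forall w, [set: T] w -> inner (X 0 w) (fun u => \sum_(k < n) c k * e k u) =
    \sum_(k < n) conjc (c k) * inner (X 0 w) (e k).
  move=> w _; have HX : H (X 0 w) by case: (XL 0) => -[].
  rewrite (inner_sumr _ _ (fun k : 'I_n => L k) HX); apply: eq_bigr => k _; exact: (innerZr _ HX (eH k)).
rewrite (eq_ip P (fun _ _ => erefl) E).
rewrite (ip_sumr mT _ _ (fun k : 'I_n => L2Z mT _ (LX k)) Ly).
by apply: eq_bigr => k _; rewrite (ipZr mT _ Ly (LX k)) conjcK (cov_covop 0 h (eH k) Hy).
Qed.

(** The Hilbert-Schmidt norm bounds the operator norm. The continuity needed to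
    expand [x] in the basis comes from [cov_covop], which writes the operator as
    a covariance. *)
Lemma covop_basis_bound h e x (S : R) : orthonormal_basis e -> H x ->
  (forall n, \sum_(k < n) hsq (covop P X h (e k)) <= S) ->
  hsq (covop P X h x) <= S * hsq x.
Proof.
move=> [eo eb] Hx hS; have [eH _] := eo.
have mI := @measurable_I01 R.
pose xn n : R -> R[i] := fun u => \sum_(k < n) inner x (e k) * e k u.
have Hxn n : H (xn n) by apply: Hsp_sum => k; exact/HspZ/eH.
have cx : L2cvg (leb R) (@I01 R) xn x by apply/(converges_L2P mI x Hxn); exact: eb.
have S0 : 0 <= S by have := hS 0%N; rewrite big_ord0.
have key y : H y -> normc (inner (covop P X h x) y) ^+ 2 <= S * hsq x * hsq y.
  move=> Hy.
  have c1 : ccvg (fun n => inner (covop P X h (xn n)) y) (inner (covop P X h x) y).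
    have cw : L2cvg P setT (fun n w => inner (X 0 w) (xn n)) (fun w => inner (X 0 w) x).
      split => [n||]; [exact: inner_L2|exact: inner_L2|].
      have [_ _ c0] := cx.
      apply: (squeeze_cvgr _ (cvg_cst 0) (_ : fsq (X 0) * hsq (fun u => xn n u - x u) @[n --> \oo] --> 0)); last first.
        by rewrite -(mulr0 (fsq (X 0))); exact: cvgMr.
      apply: nearW => n; rewrite nsq_ge0/=; apply: le_trans (inner_nsq_le (XL 0) (HspB (Hxn n) Hx)).
      rewrite le_eqVlt; apply/orP; left; apply/eqP; apply: eq_nsq => w _.
      by rewrite innerBr//; case: (XL 0) => -[].
    have Ly := inner_L2 (XL (0 + h)) Hy.
    have := ip_cvgr mT cw Ly; rewrite cov_covop//; apply: ccvg_eq => n.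
    by rewrite cov_covop.
  have c2 n : normc (inner (covop P X h (xn n)) y) ^+ 2 <= S * hsq x * hsq y.
    rewrite (covop_suml h n (fun k => inner x (e k)))//.
    pose z : R -> R[i] := fun u => \sum_(k < n) conjc (inner (covop P X h (e k)) y) * e k u.
    have Hz : H z by apply: Hsp_sum => k; exact/HspZ/eH.
    have -> : \sum_(k < n) inner x (e k) * inner (covop P X h (e k)) y = inner (xn n) z.
      rewrite /z inner_sumr//; last by move=> k; exact/HspZ/eH.
      apply: eq_bigr => k _; rewrite innerZr// conjcK /xn.
      by rewrite (orthonormal_ip (fun k => inner x (e k)))// ltn_ord mulrC.
    apply: le_trans (inner_le (Hxn n) Hz) _.
    rewrite /xn /z (orthonormal_nsq (fun k => inner x (e k)))//.
    rewrite (orthonormal_nsq (fun k => conjc (inner (covop P X h (e k)) y)))//.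
    rewrite (mulrC S) -mulrA; apply: ler_pM; [| |exact: bessel|].
      by apply: sumr_ge0 => k _; exact: sqr_ge0.
      by apply: sumr_ge0 => k _; exact: sqr_ge0.
    apply: (@le_trans _ _ (\sum_(k < n) hsq (covop P X h (e k)) * hsq y)).
      apply: ler_sum => k _; rewrite normc_conj; apply: inner_le => //.
      exact: covop_H.
    by rewrite -mulr_suml ler_wpM2r ?nsq_ge0.
  have c3 := ccvg_normc2 c1.
  exact: Rcvg_le c2 c3.
(* The image of [x] itself is the vector to test with. *)
have Hc := covop_H h Hx.
have := key _ Hc; rewrite innerxx// normc_real ger0_norm ?nsq_ge0//.
have := nsq_ge0 (leb R) (@I01 R) (covop P X h x); rewrite le_eqVlt => /predU1P[<- _|p].
  by rewrite mulr_ge0// nsq_ge0.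
by rewrite expr2 ler_pM2r.
Qed.

End Autocovariance.

(** * Hilbert-Schmidt norms *)

Section HilbertSchmidt.
Variable R : realType.
Local Notation H := (@Hsp R).
Local Notation hsq := (nsq (leb R) (@I01 R)).

Lemma HSnorm_ge0 (A : (R -> R[i]) -> R -> R[i]) : (0 <= HSnorm A)%E.
Proof. by apply: le_ereal_inf_tmp => _ [e _ <-]; exact: sqrte_ge0. Qed.

(** Bases whose square sums approach the infimum give the bound up to an
    arbitrary positive error. *)
Lemma HSnorm_bound (A : (R -> R[i]) -> R -> R[i]) : (HSnorm A < +oo)%E ->
  (forall x, H x -> H (A x)) ->
  (forall e x S, orthonormal_basis e -> H x ->
     (forall n, \sum_(k < n) hsq (A (e k)) <= S) -> hsq (A x) <= S * hsq x) ->
  forall x, H x -> hsq (A x) <= fine (HSnorm A) ^+ 2 * hsq x.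
Proof.
move=> Afin AH Ab x Hx; have A0 := HSnorm_ge0 A.
have Af : HSnorm A \is a fin_num by rewrite ge0_fin_numE.
set k := fine (HSnorm A); have k0 : 0 <= k by rewrite fine_ge0.
have g0 := nsq_ge0 (leb R) (@I01 R) x; set g := hsq x in g0 *.
have step e : 0 < e -> hsq (A x) <= (k + e) ^+ 2 * g.
  move=> e0; have [_ [b bb <-] lt] := lb_ereal_inf_adherent e0 Af.
  have [bo _] := bb; have [bH _] := bo.
  apply: Ab bb Hx _ => n.
  have S0 : (0 <= \sum_(0 <= j <oo) Hnormsq (A (b j)))%E.
    by apply: nneseries_ge0 => j _ _; apply: integral_ge0 => u _; rewrite lee_fin sqr_ge0.
  rewrite -lee_fin; apply: (@le_trans _ _ (\sum_(0 <= j <oo) Hnormsq (A (b j)))%E).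
    rewrite -sumEFin -(big_mkord xpredT (fun j => (hsq (A (b j)))%:E)).
    rewrite (eq_bigr (fun j => Hnormsq (A (b j)))); last first.
      by move=> j _; rewrite -(L2normsqE (@measurable_I01 R) (AH _ (bH j))).
    apply: nneseries_lim_ge => j _ _.
    by apply: integral_ge0 => u _; rewrite lee_fin sqr_ge0.
  move: lt; rewrite -/(HSnorm A) -(fineK Af) -/k -EFinD.
  case: (\sum_(0 <= j <oo) _)%E S0 => [s||]//=.
  rewrite !lte_fin !lee_fin => s0 lt.
  by rewrite -(sqr_sqrtr s0) ler_sqr ?nnegrE ?sqrtr_ge0 ?addr_ge0// ltW.
apply/ler_addgt0Pr => d d0.
pose c := (2 * k + 1) * g + 1; have c0 : 0 < c by rewrite ltr_wpDl// mulr_ge0//; lra.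
pose e := Num.min 1 (d / c).
have e0 : 0 < e by rewrite lt_min ltr01 divr_gt0.
apply: (le_trans (step e e0)).
have e1 : e <= 1 by rewrite ge_min lexx.
have ed : e * c <= d by rewrite -ler_pdivlMr// ge_min lexx orbT.
apply: (@le_trans _ _ (k ^+ 2 * g + e * c)); last by rewrite lerD2l.
have h : 0 <= e * g * (1 - e) + e.
  by rewrite addr_ge0 ?mulr_ge0 ?subr_ge0// ltW.
rewrite -subr_ge0 (_ : _ - _ = e * g * (1 - e) + e)// /c; ring.
Qed.

Lemma esum_zs (a : int -> \bar R) : (forall l, (0 <= a l)%E) ->
  (\esum_(l in [set: int]) a l < +oo)%E ->
  (forall l, (a l < +oo)%E) /\
  exists C, forall N, zs N (fun l => fine (a l)) <= C.
Proof.
move=> a0 sf.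
have le (r : seq int) : uniq r -> (\sum_(l <- r) a l <= \esum_(l in [set: int]) a l)%E.
  move=> ur; rewrite fsbig_seq//; apply: ereal_sup_ubound; exists [set` r] => //.
  by split => //; exact: finite_seq.
have af l : (a l < +oo)%E.
  by apply: le_lt_trans sf; have := le [:: l] isT; rewrite big_seq1.
split => //; exists (fine (\esum_(l in [set: int]) a l)) => N.
pose r := [seq k%:Z - N%:Z | k <- iota 0 N.*2.+1].
have ur : uniq r by rewrite map_inj_uniq ?iota_uniq// => i j; lia.
rewrite -lee_fin fineK; last first.
  by rewrite ge0_fin_numE// esum_ge0.
apply: le_trans (le r ur); rewrite /zs -sumEFin big_map.
rewrite -[iota _ _]/(index_iota 0 N.*2.+1) big_mkord.
by apply: lee_sum => i _; rewrite fineK// ge0_fin_numE.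
Qed.

End HilbertSchmidt.

(** * Norms of sums and selected limits *)

Section SumBound.
Context (d : measure_display) (U : measurableType d) (R : realType).
Variables (mu : {measure set U -> \bar R}) (D : set U).
Hypothesis mD : measurable D.

(** Minkowski's inequality, for the squared norms. *)
Lemma nsq_sum_le I (r : seq I) (f : I -> U -> R[i]) (b : I -> R) :
  (forall i, L2 mu D (f i)) -> (forall i, 0 <= b i) -> (forall i, nsq mu D (f i) <= b i ^+ 2) ->
  nsq mu D (fun x => \sum_(i <- r) f i x) <= (\sum_(i <- r) b i) ^+ 2.
Proof.
move=> Lf b0 fb; elim: r => [|i r ih].
  have [_ h0] := @ae0_nsq _ _ _ mu D mD (fun=> 0) (cmeasurable_cst _ 0) (aeW mu (fun _ _ => erefl)).
  rewrite (eq_nsq mu (g := fun=> 0)) ?h0 ?big_nil ?expr0n//.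
  by move=> x _; rewrite big_nil.
rewrite (eq_nsq mu (g := fun x => f i x + \sum_(j <- r) f j x)); last first.
  by move=> x _; rewrite big_cons.
have Ls : L2 mu D (fun x => \sum_(j <- r) f j x) by exact: L2_sum.
rewrite big_cons nsqD// sqrrD.
set S := \sum_(j <- r) b j in ih *; have S0 : 0 <= S by apply: sumr_ge0.
have c : complex.Re (ip mu D (f i) (fun x => \sum_(j <- r) f j x)) <= b i * S.
  apply: le_trans (ler_norm _) _; apply: le_trans (normc_Re _) _.
  apply: le_trans (normc_ip_le mD (Lf i) Ls) _.
  rewrite -(ger0_norm (mulr_ge0 (b0 i) S0)) -sqrtr_sqr exprMn.
  by apply: ler_wsqrtr; apply: ler_pM => //; exact: nsq_ge0.
have := fb i; rewrite -mulr_natl; lra.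
Qed.

Lemma L2cvgZ c (s : nat -> U -> R[i]) l : L2cvg mu D s l ->
  L2cvg mu D (fun n x => c * s n x) (fun x => c * l x).
Proof.
move=> [Ls Ll sl]; split => [n||]; [exact: L2Z|exact: L2Z|].
rewrite (_ : (fun n => _) = (fun n => normc c ^+ 2 * nsq mu D (fun x => s n x - l x))).
  by rewrite -(mulr0 (normc c ^+ 2)); exact: cvgMr.
apply/funext => n; rewrite -(nsqZ mD _ (L2B mD (Ls n) Ll)).
by apply: eq_nsq => x _; rewrite mulrBr.
Qed.

Lemma limit_L2cvg (s : nat -> U -> R[i]) l : L2cvg mu D s l ->
  L2cvg mu D s (limit (L2 mu D) (L2normsq mu D) s).
Proof.
move=> sl; have [Ls _ _] := sl.
apply/(converges_L2P mD _ Ls); rewrite /limit; apply: (@xgetPex _ 0 (converges _ _ s)).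
by exists l; apply/(converges_L2P mD _ Ls).
Qed.

End SumBound.

Lemma normc_inner_le (R : realType) (x y : R -> R[i]) : Hsp x -> Hsp y ->
  normc (inner x y) <= Num.sqrt (nsq (leb R) (@I01 R) x * nsq (leb R) (@I01 R) y).
Proof. by move=> Hx Hy; exact: (normc_ip_le (@measurable_I01 R) Hx Hy). Qed.

Section FourierInner.
Variable R : realType.
Local Notation mu := (leb R).
Local Notation D := (@Ipi R).
Local Notation mD := (@measurable_Ipi R).
Local Notation H := (@Hsp R).
Local Notation c2 := ((((2 * pi)^-1 : R)%:C)%C).

Lemma inner0r (x : R -> R[i]) : Hsp x -> inner x (fun=> 0) = 0.
Proof.
move=> Hx; have H0 : H (fun=> 0) by exact: (L2_0 _ _).
transitivity (inner x (fun u => 0 * (fun=> 0 : R[i]) u)).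
  by apply: eq_cintegral => u _; rewrite mul0r.
by rewrite (innerZr 0 Hx H0) conjc0 mul0r.
Qed.

Lemma cis_field (l : int) y : H y -> field mu D (fun s u => cis (l%:~R * s) * y u).
Proof. by move=> Hy; exact: (field_tensor mD (L2_cis l%:~R) Hy). Qed.

Lemma inner_fcoef A l y : field mu D A -> H y -> inner y (fcoef A l) =
  c2 * cintegral mu D (fun t => inner (fun u => cis (l%:~R * t) * y u) (A t)).
Proof.
move=> FA Hy; have FB := cis_field l Hy.
rewrite -(innerJ (fcoef_L2 FA l) Hy) -(fipE mD FB FA) -(fipJ mD FA FB).
rewrite (fip_fcoef FA l Hy) conjcM conjc_real mulrA -rmorphM mulVf ?mul1r//.
by rewrite gt_eqF ?pi2_gt0.
Qed.

End FourierInner.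

Section ArithmeticMean.
Variable R : realType.

Lemma sqrt_mul_le (a b : R) : 0 <= a -> 0 <= b -> Num.sqrt (a * b) <= (a + b) / 2.
Proof.
move=> a0 b0; rewrite sqrtrM// -{2}(sqr_sqrtr a0) -{2}(sqr_sqrtr b0).
have := sqr_ge0 (Num.sqrt a - Num.sqrt b); nra.
Qed.

End ArithmeticMean.

(** * The spectral density *)

Section DynamicComponents.
Context (R : realType) (d : measure_display) (T : measurableType d) (P : probability T R).
Variable X : int -> T -> R -> R[i].
Local Notation lam := (lebesgue_measure : {sigma_finite_measure set (measurableTypeR R) -> \bar R}).
Local Notation H := (@Hsp R).
Local Notation hsq := (nsq (leb R) (@I01 R)).
Local Notation mu := (leb R).
Local Notation D := (@Ipi R).
Local Notation mD := (@measurable_Ipi R).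
Local Notation mT := (@measurableT _ T).
Local Notation C_ := (covop P X).
Local Notation F_ := (spectral_density P X).
Local Notation c2 := ((((2 * pi)^-1 : R)%:C)%C).
Local Notation ipP := (ip P [set: T]).
Local Notation nsqP := (nsq P [set: T]).
Local Notation fieldP := (field P [set: T]).
Local Notation fipP := (fip P [set: T]).
Local Notation fsqP := (fsq P [set: T]).
Local Notation field := (field mu D).
Local Notation fip := (fip mu D).
Local Notation fsq := (fsq mu D).
Implicit Types (x y : R -> R[i]).

(* The bounds are those given by the Hilbert-Schmidt norms [k h] of the covariance
   operators, whose sum is at most [K]. *)
Variables (k : int -> R) (K : R).
Hypotheses (CH : forall h x, H x -> H (C_ h x))
  (Ck : forall h x, H x -> hsq (C_ h x) <= k h ^+ 2 * hsq x)
  (k0 : forall h, 0 <= k h) (kK : forall N, zs N k <= K).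

Let K0 : 0 <= K. Proof. by apply: le_trans (kK 0); exact: zs_ge0. Qed.

Lemma covop_inner_le h x y : H x -> H y ->
  normc (inner (C_ h x) y) <= k h * Num.sqrt (hsq x * hsq y).
Proof.
move=> Hx Hy; apply: le_trans (normc_inner_le (CH h Hx) Hy) _.
rewrite -(ger0_norm (k0 h)) -sqrtr_sqr -sqrtrM ?sqr_ge0// mulrA.
by apply: ler_wsqrtr; apply: ler_wpM2r (Ck h Hx); exact: nsq_ge0.
Qed.

(** The norms of the terms are dominated by the summable weights [k], uniformly
    in the frequency. *)
Lemma spectral_density_cvg theta x : H x ->
  L2cvg (leb R) (@I01 R)
    (fun N u => c2 * zsum N (fun h => C_ h x u * cis (- (h%:~R * theta)))) (F_ theta x).
Proof.
move=> Hx; have mI := @measurable_I01 R.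
pose f h u := C_ h x u * cis (- (h%:~R * theta)).
have fE h u : f h u = cis (- (h%:~R * theta)) * C_ h x u by rewrite /f mulrC.
have Lf h : H (f h).
  by apply: (L2_eq mI (f := fun u => cis (- (h%:~R * theta)) * C_ h x u)) (HspZ _ (CH h Hx)) => u _; rewrite fE.
have nf h : hsq (f h) <= k h ^+ 2 * hsq x.
  rewrite (eq_nsq (leb R) (g := fun u => cis (- (h%:~R * theta)) * C_ h x u)); last first.
    by move=> u _; rewrite fE.
  by rewrite (nsqZ mI _ (CH h Hx)) normc_cis expr1n mul1r; exact: Ck.
have [l cl] : exists l, L2cvg (leb R) (@I01 R) (fun N u => zsum N (f^~ u)) l.
  apply: (zsum_L2cvg (a := k) (C := K) (K := K * hsq x)) => //.
    by rewrite mulr_ge0 ?nsq_ge0.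
  move=> n N; pose b h := zmask n k h * Num.sqrt (hsq x).
  have Lz h : H (fun u => zmask n (f^~ u) h).
    by rewrite /zmask; case: ltnP => _; [exact: Lf|exact: L2_0].
  apply: le_trans (nsq_sum_le mI (index_enum _)
    (f := fun (j : 'I_N.*2.+1) u => zmask n (f^~ u) (j%:Z - N%:Z))
    (b := fun j : 'I_N.*2.+1 => b (j%:Z - N%:Z)) _ _ _) _.
  - by move=> j; exact: Lz.
  - by move=> j; rewrite mulr_ge0 ?sqrtr_ge0// zmask_ge0.
  - move=> j; rewrite /b /zmask exprMn sqr_sqrtr ?nsq_ge0//; case: ltnP => _ //.
    have [_ ->] := @ae0_nsq _ _ _ (leb R) _ mI (fun=> 0) (cmeasurable_cst _ 0) (aeW _ (fun _ _ => erefl)).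
    by rewrite expr0n mul0r.
  (* One of the two factors of the squared tail is bounded by [K]. *)
  rewrite -mulr_suml exprMn sqr_sqrtr ?nsq_ge0// -/(zs N (zmask n k)) expr2.
  rewrite [leRHS]mulrAC; apply: ler_wpM2r; first exact: nsq_ge0.
  apply: ler_wpM2r; first exact/zs_ge0/zmask_ge0.
  apply: le_trans (kK N); apply: ler_sum => j _; rewrite /zmask; case: ltnP => // _.
exact: (limit_L2cvg mI (L2cvgZ mI c2 cl)).
Qed.

Lemma spectral_density_inner theta x y : H x -> H y ->
  ccvg (fun N => c2 * zs N (fun h => inner (C_ h x) y * cis (- (h%:~R * theta))))
    (inner (F_ theta x) y).
Proof.
move=> Hx Hy; have := ip_cvgl (@measurable_I01 R) (spectral_density_cvg theta Hx) Hy.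
apply: ccvg_eq => N.
have L h : H (fun u => cis (- (h%:~R * theta)) * C_ h x u) by exact/HspZ/CH.
rewrite -/(inner _ y).
transitivity (inner (fun u => c2 * \sum_(j < N.*2.+1)
   (cis (- ((j%:Z - N%:Z)%:~R * theta)) * C_ (j%:Z - N%:Z) x u)) y).
  apply: eq_cintegral => u _; apply: (congr1 (fun z => c2 * z * conjc (y u))).
  by apply: eq_bigr => j _; rewrite mulrC.
rewrite (innerZl _ (Hsp_sum _ _ (fun j : 'I_N.*2.+1 => L (j%:Z - N%:Z))) Hy).
rewrite (inner_suml _ _ (fun j : 'I_N.*2.+1 => L (j%:Z - N%:Z)) Hy).
by apply: (congr1 ( *%R c2)); apply: eq_bigr => j _; rewrite (innerZl _ (CH _ Hx) Hy) mulrC.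
Qed.

Lemma spectral_partial_le theta N x y : H x -> H y ->
  normc (c2 * zs N (fun h => inner (C_ h x) y * cis (- (h%:~R * theta)))) <=
  K * Num.sqrt (hsq x * hsq y).
Proof.
move=> Hx Hy; have i0 : 0 <= (2 * pi : R)^-1 by rewrite invr_ge0 ltW ?pi2_gt0.
rewrite normcM normc_real (ger0_norm i0).
have s0 := sqrtr_ge0 (hsq x * hsq y).
rewrite -[leRHS]mul1r; apply: ler_pM => //.
  by rewrite invf_le1 ?pi2_gt0// pi2_ge1.
apply: le_trans (normc_sum_le _ _ _) _.
apply: (@le_trans _ _ (zs N k * Num.sqrt (hsq x * hsq y))); last exact: ler_wpM2r.
rewrite mulr_suml; apply: ler_sum => j _; rewrite normcM normc_cis mulr1.
exact: covop_inner_le.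
Qed.

Lemma spectral_inner_le theta x y : H x -> H y ->
  normc (inner (F_ theta x) y) <= K * Num.sqrt (hsq x * hsq y).
Proof.
move=> Hx Hy; apply: ccvg_normc_le (spectral_density_inner theta Hx Hy) => N.
exact: spectral_partial_le.
Qed.

Hypothesis XL : forall t, L2H P (X t).
Hypothesis cov : forall s t x y, H x -> H y ->
  ipP (fun w => inner (X s w) y) (fun w => inner (X t w) x) = inner (C_ (s - t) x) y.

Let XH t w : H (X t w). Proof. by case: (XL t) => -[]. Qed.

(** Schur's test: the covariances of the scalar series are dominated by the
    convolution kernel [k], whose sums over windows in either argument are at
    most [K]. *)
Lemma filter_nsq_le (a : int -> R -> R[i]) t N : (forall l, H (a l)) ->
  nsqP (fun w => zs N (fun l => inner (X (t - l) w) (a l))) <= K * zs N (fun l => hsq (a l)).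
Proof.
move=> Ha; pose n := N.*2.+1; pose p (i : 'I_n) : int := i%:Z - N%:Z.
have L i : L2 P setT (fun w => inner (X (t - p i) w) (a (p i))) by exact: inner_L2.
have Ls : L2 P setT (fun w => \sum_(i < n) inner (X (t - p i) w) (a (p i))) by exact: (L2_sum mT).
pose s i := hsq (a (p i)); have s0 i : 0 <= s i by exact: nsq_ge0.
have -> : nsqP (fun w => zs N (fun l => inner (X (t - l) w) (a l))) =
    normc (ipP (fun w => \sum_(i < n) inner (X (t - p i) w) (a (p i)))
               (fun w => \sum_(i < n) inner (X (t - p i) w) (a (p i)))).
  by rewrite (ipxx mT Ls) normc_real ger0_norm ?nsq_ge0.
rewrite (ip_suml mT _ _ L Ls).
apply: (@le_trans _ _ (\sum_(i < n) \sum_(j < n) (k (j%:Z - i%:Z) * (s i + s j) / 2))).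
  apply: le_trans (normc_sum_le _ _ _) _; apply: ler_sum => i _.
  rewrite (ip_sumr mT _ _ L (L i)); apply: le_trans (normc_sum_le _ _ _) _.
  apply: ler_sum => j _; rewrite cov//.
  have -> : t - p i - (t - p j) = j%:Z - i%:Z by rewrite /p; ring.
  apply: le_trans (covop_inner_le _ (Ha _) (Ha _)) _.
  by rewrite -mulrA; apply: ler_wpM2l => //; rewrite [s i + _]addrC; apply: sqrt_mul_le; exact: s0.
have k1 i : \sum_(j < n) k (j%:Z - i%:Z) <= K := zs_window k0 kK _ _.
have k2 i : \sum_(j < n) k (i%:Z - j%:Z) <= K.
  have h : forall N, zs N (fun l => k (- l)) <= K by move=> M; rewrite zs_opp.
  apply: le_trans (zs_window (a := fun l => k (- l)) _ h n (- i%:Z)) => //.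
  by apply: ler_sum => j _; rewrite opprD opprK addrC.
have e1 : \sum_(i < n) \sum_(j < n) (k (j%:Z - i%:Z) * s i) <= K * \sum_(i < n) s i.
  by rewrite mulr_sumr; apply: ler_sum => i _; rewrite -mulr_suml ler_wpM2r.
have e2 : \sum_(i < n) \sum_(j < n) (k (j%:Z - i%:Z) * s j) <= K * \sum_(i < n) s i.
  rewrite exchange_big mulr_sumr; apply: ler_sum => i _.
  by rewrite -mulr_suml ler_wpM2r.
have -> : \sum_(i < n) \sum_(j < n) (k (j%:Z - i%:Z) * (s i + s j) / 2) =
    (\sum_(i < n) \sum_(j < n) (k (j%:Z - i%:Z) * s i) +
     \sum_(i < n) \sum_(j < n) (k (j%:Z - i%:Z) * s j)) / 2.
  rewrite -big_split mulr_suml; apply: eq_bigr => i _.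
  by rewrite -big_split mulr_suml; apply: eq_bigr => j _; rewrite mulrDr.
rewrite /zs -/n -/(\sum_(i < n) s i); move: e1 e2; lra.
Qed.

Lemma zs_fcoef_le A N : field A -> zs N (fun l => hsq (fcoef A l)) <= fsq A.
Proof.
move=> FA; apply: le_trans (fourier_bessel FA N).
by apply: ler_sum => j _; rewrite /fweight ler_peMl ?nsq_ge0 ?pi2_ge1.
Qed.

Variables (lambda : nat -> R -> R) (phi : nat -> R -> R -> R[i]).
Hypotheses (sr : spectral_representation P X lambda phi) (jm : jointly_measurable phi).

(** * Eigenvalues and eigenfunctions *)

Lemma lambda_ge0 theta m : D theta -> 0 <= lambda m theta.
Proof. by move=> /sr[+ _] => /(_ m)/andP[h1 h2]; exact: le_trans h2. Qed.

Lemma phi_ortho theta : D theta -> orthonormal (fun m => phi m theta).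
Proof. by move=> /sr[_ []]. Qed.

Lemma phi_H theta m : D theta -> H (phi m theta).
Proof. by move=> /phi_ortho[h _]. Qed.

Lemma inner_phi theta m n : D theta -> inner (phi m theta) (phi n theta) = (m == n)%:R.
Proof. by move=> /phi_ortho[_ h]; exact: h. Qed.

Lemma hsq_phi theta m : D theta -> hsq (phi m theta) = 1.
Proof.
move=> Dt; apply: complexI; rewrite -(innerxx (phi_H m Dt)) (inner_phi m m Dt) eqxx.
by [].
Qed.

Lemma spectral_cvg theta x : D theta -> H x -> L2cvg (leb R) (@I01 R)
  (fun M u => \sum_(m < M) ((lambda m theta)%:C)%C * inner x (phi m theta) * phi m theta u) (F_ theta x).
Proof.
move=> Dt Hx; have [_ [_ /(_ x Hx) h]] := sr Dt.
apply/(converges_L2P (@measurable_I01 R)) => // n.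
by apply: Hsp_sum => m; apply/HspZ/phi_H.
Qed.

Lemma spectral_eigen theta x m : D theta -> H x ->
  inner (F_ theta x) (phi m theta) = ((lambda m theta)%:C)%C * inner x (phi m theta).
Proof.
move=> Dt Hx; have c := ip_cvgl (@measurable_I01 R) (spectral_cvg Dt Hx) (phi_H m Dt).
apply: (ccvg_unique (ccvg_shift m.+1 c)).
apply: ccvg_eq (ccvg_cst _) => n.
transitivity (inner (fun u => \sum_(j < n + m.+1)
   ((lambda j theta)%:C)%C * inner x (phi j theta) * phi j theta u) (phi m theta)) => //.
rewrite (orthonormal_ip (fun m => ((lambda m theta)%:C)%C * inner x (phi m theta)) _ _ (phi_ortho Dt)).
by rewrite addnS ltnS leq_addl.
Qed.

Lemma spectral_quadratic theta x : D theta -> H x ->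
  ccvg (fun M => ((\sum_(m < M) lambda m theta * normc (inner x (phi m theta)) ^+ 2 : R)%:C)%C)
    (inner (F_ theta x) x).
Proof.
move=> Dt Hx; have c := ip_cvgl (@measurable_I01 R) (spectral_cvg Dt Hx) Hx.
apply: ccvg_eq c => M; transitivity (inner (fun u => \sum_(j < M)
   ((lambda j theta)%:C)%C * inner x (phi j theta) * phi j theta u) x) => //.
have L m : H (fun u => ((lambda m theta)%:C)%C * inner x (phi m theta) * phi m theta u).
  exact/HspZ/phi_H.
rewrite (inner_suml _ _ (fun m : 'I_M => L m) Hx) rmorph_sum /=.
apply: eq_bigr => m _; rewrite (innerZl _ (phi_H m Dt) Hx) -(innerJ Hx (phi_H m Dt)).
by rewrite -mulrA mulcJE -rmorphM.
Qed.

(** An eigenvalue is the value of the quadratic form of the spectral density at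
    a unit eigenfunction. *)
Lemma lambda_le theta m : D theta -> lambda m theta <= K.
Proof.
move=> Dt; have Hp := phi_H m Dt.
have := spectral_inner_le theta Hp Hp.
rewrite (spectral_eigen m Dt Hp) (inner_phi m m Dt) eqxx mulr1 normc_real (hsq_phi m Dt).
by rewrite mulr1 sqrtr1 mulr1; apply: le_trans; exact: ler_norm.
Qed.

Lemma phi_meas m : cmeasurable ((D : set (measurableTypeR R)) `*` (@I01 R : set (measurableTypeR R)))
  (unc (phi m)).
Proof.
exact: (cmeasurable_swap (@measurable_I01 R) mD (jm m)).
Qed.

Lemma phi_field m : field (phi m).
Proof.
split; first exact: phi_meas.
have mI := @measurable_I01 R.
rewrite (L2_rect mD mI _ _ (phi_meas m)).
apply: (@le_lt_trans _ _ (\int[leb R]_(t in D) 1)%E).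
  apply: ge0_le_integral => //.
  - exact: mD.
  - by move=> t _; apply: integral_ge0 => u _; rewrite lee_fin sqr_ge0.
  - apply: (ge0_measurable_section_integral mD mI lam
      (f := fun z => (normc (unc (phi m) z) ^+ 2)%:E)).
      exact/measurable_EFinP/measurable_normc2/phi_meas.
    by move=> z _; rewrite lee_fin sqr_ge0.
  - by move=> t Dt; rewrite (L2normsqE mI (phi_H m Dt)) (hsq_phi m Dt).
have /integrableP[_] := integrable_cst_Ipi (1 : R).
by rewrite (eq_integral (cst 1%E))// => t _; rewrite abse1.
Qed.

#[local] Hint Resolve phi_field : core.

Variable e : nat -> R -> R[i].
Hypothesis eb : orthonormal_basis e.

Let eH j : H (e j). Proof. by have [[h _] _] := eb; exact: h. Qed.

Let coef_meas m j : @cmeasurable _ (measurableTypeR R) R D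
  (fun t => ((lambda m t)%:C)%C * inner (e j) (phi m t)).
Proof.
apply: (@cmeasurable_eq _ _ _ _ (fun t => inner (F_ t (e j)) (phi m t))).
  by move=> t Dt; rewrite spectral_eigen.
apply: (cmeasurable_cvg (f_ := fun N t => c2 * zs N (fun h => inner (C_ h (e j)) (phi m t) * cis (- (h%:~R * t))))).
- exact: mD.
- move=> N; apply: cmeasurableZ; apply: cmeasurable_sum => i; apply: cmeasurableM.
    apply: (@cmeasurable_eq _ _ _ _ (fun t => conjc (inner (phi m t) (C_ (i%:Z - N%:Z) (e j))))).
      by move=> t Dt; rewrite innerJ//; [exact: phi_H|exact: CH].
    apply: cmeasurableJ; apply: (inner_field_meas mD (phi_field m)); exact: CH.
  rewrite (_ : (fun t => _) = (fun t => conjc (cis ((i%:Z - N%:Z)%:~R * t)))).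
    exact/cmeasurableJ/cmeasurable_cis.
  by apply/funext => t; rewrite cisJ.
- move=> t Dt; apply: spectral_density_inner => //; exact: phi_H.
Qed.

(** For fixed [x], [lambda m t * inner x (phi m t)] is measurable in [t], as it
    equals [inner (F_ t x) (phi m t)], a limit of measurable functions.
    Parseval's identity for [phi m t], whose norm is 1, recovers the eigenvalue
    from the [x] of a basis. *)
Lemma lambda_meas m : @measurable_fun _ _ (measurableTypeR R) (measurableTypeR R) D (lambda m).
Proof.
have [] // : @cmeasurable _ (measurableTypeR R) R D (fun t => ((lambda m t)%:C)%C).
apply: (cmeasurable_cvg (f_ := fun n t =>
    \sum_(j < n) ((lambda m t)%:C)%C * inner (e j) (phi m t) * inner (phi m t) (e j))).
- exact: mD.
- move=> n; apply: cmeasurable_sum => j; apply: cmeasurableM; first exact: coef_meas.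
  exact: (inner_field_meas mD (phi_field m)).
- move=> t Dt; have Hp := phi_H m Dt.
  have := ccvgZ ((lambda m t)%:C)%C (cvg_realC (parseval eb Hp)).
  rewrite (hsq_phi m Dt) mulr1; apply: ccvg_eq => n.
  rewrite rmorph_sum mulr_sumr; apply: eq_bigr => j _.
  by rewrite -mulrA -(innerJ Hp (eH j)) [_ * inner _ _]mulrC mulcJE.
Qed.

Lemma wphi_field m : field (fun t u => ((lambda m t)%:C)%C * phi m t u).
Proof.
apply: (L2_bounded (measurable_DW mD) (K := K) (b := fun z => ((lambda m z.1)%:C)%C) _ (phi_field m)).
  apply: (cmeasurable_fst _ mD (f := fun t => ((lambda m t)%:C)%C)).
  exact: (@cmeasurable_real _ (measurableTypeR R) R D (lambda m) (lambda_meas m)).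
by move=> [t u] [Dt _]; rewrite normc_real (ger0_norm (lambda_ge0 m Dt)); exact: lambda_le.
Qed.

#[local] Hint Resolve wphi_field : core.

(** * Covariances of the scores *)

(** By Bessel's inequality the filter coefficients are square-summable, and
    Schur's test passes this on to the scalar series. *)
Lemma score_cvg m t : L2cvg P setT (score_sum X phi m t) (score P X phi m t).
Proof.
pose a l := fcoef (phi m) l.
have Ha l : H (a l) by exact: fcoef_L2.
have [l cl] : exists l, L2cvg P setT (score_sum X phi m t) l.
  apply: (zsum_L2cvg (f := fun l w => inner (X (t - l) w) (a l))
    (a := fun l => hsq (a l)) (C := fsq (phi m)) (K := K)) => //.
  - by move=> l; exact: inner_L2.
  - by move=> l; exact: nsq_ge0.
  - by move=> N; exact: zs_fcoef_le.
  move=> n N; pose b l : R -> R[i] := if (n < absz l)%N then a l else (fun=> 0).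
  have Hb l : H (b l) by rewrite /b; case: ifP => _; [exact: Ha|exact: (L2_0 _ _)].
  have := filter_nsq_le t N Hb; congr (_ <= _).
    apply: eq_nsq => w _; apply: eq_zs => l; rewrite /zmask /b.
    by case: ifP => // _; rewrite inner0r.
  apply: (congr1 ( *%R K)); apply: eq_zs => l; rewrite /zmask /b; case: ifP => // _.
  by have [_] := @ae0_nsq _ _ _ (leb R) _ (@measurable_I01 R) (fun=> 0) (cmeasurable_cst _ 0) (aeW _ (fun _ _ => erefl)).
exact: (limit_L2cvg mT cl).
Qed.

Lemma score_L2 m t : L2 P setT (score P X phi m t).
Proof. by have [] := score_cvg m t. Qed.

Local Notation Y := (score P X phi).
Local Notation wphi m := (fun t u => ((lambda m t)%:C)%C * phi m t u).
Local Notation nu m := (\int[mu]_(a in D) lambda m a).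

(** The covariance is a sum over the lags of Fourier coefficients of [phi m],
    that is, of integrals over the frequency. Under the integral sign stand the
    partial sums of the spectral density at [x], reversed and shifted by the lag
    [t - s]; they are bounded, and their limit is computed from the eigenvalue
    equation. *)
Lemma score_cov m t s x : H x ->
  ipP (Y m t) (fun w => inner (X s w) x) =
  cintegral mu D (fun a => cis ((t - s)%:~R * a) * inner x (wphi m a)).
Proof.
move=> Hx; have Lx := inner_L2 (XL s) Hx; set h := t - s.
apply: (ccvg_unique (ip_cvgl mT (score_cvg m t) Lx)).
pose q a j := inner (C_ j x) (phi m a) * cis (- (j%:~R * a)).
pose f N a := cis (h%:~R * a) * (c2 * zs N (fun l => q a (h - l))).
pose g l a := inner (fun u => cis (l%:~R * a) * C_ (h - l) x u) (phi m a).
have Ig l : cintegrable mu D (g l).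
  by apply: (fip_int mD _ (phi_field m)); apply: cis_field; exact: CH.
have Lf l : L2 P setT (fun w => inner (X (t - l) w) (fcoef (phi m) l)).
  by apply: inner_L2 => //; exact: fcoef_L2.
have fE a N : D a -> c2 * \sum_(i < N.*2.+1) g (i%:Z - N%:Z) a = f N a.
  move=> Da; rewrite /f mulrCA; apply: (congr1 ( *%R c2)).
  rewrite /zs mulr_sumr; apply: eq_bigr => i _; rewrite /g /q.
  set l : int := i%:Z - N%:Z.
  rewrite (innerZl _ (CH _ Hx) (phi_H m Da)) mulrCA mulrC.
  by apply: (congr1 ( *%R _)); rewrite -cisD; apply: (congr1 (@cis R)); rewrite intrB; ring.
have ipE N : ipP (score_sum X phi m t N) (fun w => inner (X s w) x) = cintegral mu D (f N).
  transitivity (c2 * \sum_(i < N.*2.+1) cintegral mu D (g (i%:Z - N%:Z))).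
    rewrite (ip_suml mT _ _ (fun i : 'I_N.*2.+1 => Lf (i%:Z - N%:Z)) Lx) mulr_sumr.
    apply: eq_bigr => i _; set l : int := i%:Z - N%:Z.
    rewrite (cov _ _ Hx (fcoef_L2 (phi_field m) l)).
    rewrite (inner_fcoef l (phi_field m) (CH _ Hx)).
    apply: (congr1 ( *%R c2)); rewrite /g.
    by have -> : t - l - s = h - l by rewrite /h; ring.
  rewrite -(cintegral_sum mD _ _ (fun i : 'I_N.*2.+1 => Ig (i%:Z - N%:Z))).
  rewrite -(cintegralZ mD c2 (cintegrable_sum mD _ _ (fun i : 'I_N.*2.+1 => Ig (i%:Z - N%:Z)))).
  by apply: eq_cintegral => a Da; exact: fE.
apply: (ccvg_eq (fun N => esym (ipE N))).
have s0 := sqrtr_ge0 (hsq x).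
have qle a j : D a -> normc (q a j) <= k j * Num.sqrt (hsq x).
  move=> Da; rewrite normcM normc_cis mulr1.
  by have := covop_inner_le j Hx (phi_H m Da); rewrite (hsq_phi m Da) mulr1.
apply: (cdominated_convergence mD (g := fun=> K * Num.sqrt (hsq x))).
- move=> N; apply: (cmeasurable_eq (f := fun a => c2 * \sum_(i < N.*2.+1) g (i%:Z - N%:Z) a)).
    by move=> a Da; exact: fE.
  apply: cmeasurableZ; apply: cmeasurable_sum => i.
  exact: cintegrable_cmeasurable (Ig _).
- move=> a Da; apply: ccvgZ; rewrite (innerZr _ Hx (phi_H m Da)) conjc_real.
  rewrite -(spectral_eigen m Da Hx).
  have := spectral_density_inner a Hx (phi_H m Da).
  have c2n : c2 != 0.
    by apply/eqP => /(congr1 (@complex.Re R)) /= /eqP; rewrite invr_eq0 gt_eqF ?pi2_gt0.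
  move/(ccvgZ c2^-1) => c; rewrite -[inner _ _](mulVKf c2n); apply: ccvgZ.
  have c' : ccvg (fun N => zs N (q a)) (c2^-1 * inner (F_ a x) (phi m a)).
    by apply: ccvg_eq c => N; rewrite mulKf.
  have c'' := ccvg_zs_shift (a := fun j => k j * Num.sqrt (hsq x)) (C := K * Num.sqrt (hsq x)) h
    _ _ (fun j => qle a j Da) c'.
  apply: ccvg_eq (c'' _ _) => [N|j|N].
  + by rewrite -zs_opp; apply: eq_zs => l; rewrite addrC.
  + by rewrite mulr_ge0.
  + by rewrite /zs -mulr_suml ler_wpM2r//; exact: kK.
- exact: integrable_cst_Ipi.
- move=> N a Da; rewrite normcM normc_cis mul1r normcM normc_real.
  have i0 : 0 <= (2 * pi : R)^-1 by rewrite invr_ge0 ltW ?pi2_gt0.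
  rewrite (ger0_norm i0) -[leRHS]mul1r; apply: ler_pM => //.
    by rewrite invf_le1 ?pi2_gt0// pi2_ge1.
  apply: le_trans (normc_sum_le _ _ _) _.
  apply: (@le_trans _ _ ((\sum_(i < N.*2.+1) k (h - (i%:Z - N%:Z))) * Num.sqrt (hsq x))).
    by rewrite mulr_suml; apply: ler_sum => i _; exact: qle.
  apply: ler_wpM2r => //; rewrite -/(zs N (fun l => k (h - l))) -zs_opp.
  apply: le_trans (zs_window k0 kK N.*2.+1 (h - N%:Z)).
  by apply: ler_sum => i _; rewrite opprK addrCA.
Qed.

Let wphi_H m a : D a -> H (wphi m a).
Proof. by move=> Da; exact/HspZ/(phi_H m Da). Qed.

(** The modulation by the lag turns the integrals of [score_cov] into inner
    products of fields. *)
Let mod_field h m : field (fun a u => cis (- (h%:~R * a)) * wphi m a u).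
Proof.
apply: (L2_bounded (measurable_DW mD) (K := 1) (b := fun z => cis (- (h%:~R * z.1))) _ (wphi_field m)).
  apply: (cmeasurable_fst _ mD (f := fun a => cis (- (h%:~R * a)))).
  rewrite (_ : (fun a => _) = (fun a => conjc (cis (h%:~R * a)))).
    exact/cmeasurableJ/cmeasurable_cis.
  by apply/funext => a; rewrite cisJ.
by move=> z _; rewrite normc_cis.
Qed.

Lemma fip_mod h m A : field A ->
  fip A (fun a u => cis (- (h%:~R * a)) * wphi m a u) =
  cintegral mu D (fun a => cis (h%:~R * a) * inner (A a) (wphi m a)).
Proof.
move=> FA; rewrite (fipE mD FA (mod_field h m)); apply: ae_eq_cintegral.
- exact: mD.
- exact: (fip_meas mD FA (mod_field h m)).
- apply: cmeasurableM; first exact: cmeasurable_cis.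
  exact: (fip_meas mD FA (wphi_field m)).
- apply: aeS1 (field_ae mD FA) => a + Da => /(_ Da) HA.
  by rewrite (innerZr _ HA (wphi_H m Da)) cisJ opprK.
Qed.

Lemma fip_fourier_term_mod h m A l : field A ->
  fip (fourier_term A l) (fun a u => cis (- (h%:~R * a)) * wphi m a u) =
  cintegral mu D (fun a => cis ((h + l)%:~R * a) * inner (fcoef A l) (wphi m a)).
Proof.
move=> FA; rewrite (fip_mod h m (fourier_term_field FA l)).
apply: eq_cintegral => a Da; have Hl := fcoef_L2 FA l.
rewrite /fourier_term (innerZl _ Hl (wphi_H m Da)) mulrA -cisD.
by apply: (congr1 (fun z => cis z * _)); rewrite intrD mulrDl.
Qed.

Lemma fourier_sum_cvg A : field A ->
  L2cvg (mu \x lam)%E (D `*` (@I01 R : set (measurableTypeR R)))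
    (fun N => unc (fourier_sum A N)) (unc A).
Proof.
move=> FA; split => //; first by move=> N; exact: fourier_sum_field.
exact: (fourier_series_cvg FA eb).
Qed.

(** Inserting the filter of the second score in [score_cov] makes the Fourier
    sums of [phi n] appear; in the limit the orthogonality of the eigenfunctions
    applies at each frequency. *)
Lemma score_cov2 m n t s :
  ipP (Y m t) (Y n s) = if m == n then
    cintegral mu D (fun a => cis ((t - s)%:~R * a) * ((lambda m a)%:C)%C) else 0.
Proof.
set h := t - s.
transitivity (cintegral mu D (fun a => cis (h%:~R * a) * inner (phi n a) (wphi m a))); last first.
  have [<-|mn] := eqVneq m n.
    apply: eq_cintegral => a Da; apply: (congr1 ( *%R _)).
    by rewrite (innerZr _ (phi_H m Da) (phi_H m Da)) (inner_phi m m Da) eqxx mulr1 conjc_real.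
  transitivity (cintegral mu D (fun a => 0 * cis (0 * a : R))).
    apply: eq_cintegral => a Da.
    by rewrite (innerZr _ (phi_H n Da) (phi_H m Da)) (inner_phi n m Da) eq_sym (negbTE mn) !mulr0 mul0r.
  rewrite cintegralZ ?mul0r//; first exact: mD.
  apply: (cintegrable_le mD (g := fun=> 1)); first exact: cmeasurable_cis.
    exact: integrable_cst_Ipi.
  by move=> a _; rewrite normc_cis.
apply: (ccvg_unique (ip_cvgr mT (score_cvg n s) (score_L2 m t))).
rewrite -(fip_mod h m (phi_field n)).
apply: ccvg_eq (ip_cvgl (measurable_DW mD) (fourier_sum_cvg (phi_field n)) (mod_field h m)) => N.
have Lf l : L2 P setT (fun w => inner (X (s - l) w) (fcoef (phi n) l)).
  by apply: inner_L2 => //; exact: fcoef_L2.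
rewrite (ip_sumr mT _ _ (fun i : 'I_N.*2.+1 => Lf (i%:Z - N%:Z)) (score_L2 m t)).
transitivity (fip (fun a u => \sum_(i < N.*2.+1) fourier_term (phi n) (i%:Z - N%:Z) a u)
  (fun a u => cis (- (h%:~R * a)) * wphi m a u)) => //.
rewrite (fip_suml mD _ _ (fun i : 'I_N.*2.+1 => fourier_term_field (phi_field n) (i%:Z - N%:Z)) (mod_field h m)).
apply: eq_bigr => i _; set l : int := i%:Z - N%:Z.
rewrite (fip_fourier_term_mod h m l (phi_field n)) (score_cov m t (s - l) (fcoef_L2 (phi_field n) l)).
by have -> : t - (s - l) = h + l by rewrite /h; ring.
Qed.

(** * The components and the remainder *)

Local Notation lmul m A := (fun a u => ((lambda m a)%:C)%C * A a u).

Let lambda_b m z : (D `*` @I01 R) z -> normc ((lambda m z.1)%:C)%C <= K.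
Proof.
move=> [Da _]; rewrite (normc_real (lambda m z.1)) (ger0_norm (lambda_ge0 m Da)).
exact: (lambda_le m Da).
Qed.

Let lambda_cm m : @cmeasurable _ (measurableTypeR R) R D (fun a => ((lambda m a)%:C)%C).
Proof.
exact: (@cmeasurable_real _ (measurableTypeR R) R D (lambda m) (lambda_meas m)).
Qed.

Let lmul_field m A : field A -> field (lmul m A).
Proof.
move=> FA; apply: (L2_bounded (measurable_DW mD) (b := fun z => ((lambda m z.1)%:C)%C) _ FA (lambda_b m)).
exact: (cmeasurable_fst _ mD (lambda_cm m)).
Qed.

Lemma fsq_lmul_le m A : field A -> fsq (lmul m A) <= K ^+ 2 * fsq A.
Proof.
move=> FA; rewrite -[K ^+ 2](_ : normc ((K%:C)%C) ^+ 2 = _); last first.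
  by rewrite normc_real ger0_norm.
rewrite -(nsqZ (measurable_DW mD) _ FA).
apply: (le_nsq (measurable_DW mD) (lmul_field m FA) (L2Z (measurable_DW mD) _ FA)) => z Dz.
rewrite [leLHS]normcM [leRHS]normcM ler_wpM2r ?normc_ge0//.
by rewrite [leRHS]normc_real (ger0_norm K0); exact: lambda_b.
Qed.

Let spectral_cis m (h : int) : cintegrable mu D (fun a => cis (h%:~R * a) * ((lambda m a)%:C)%C).
Proof.
apply: (cintegrable_le mD (g := fun=> K)).
- by apply: cmeasurableM; [exact: cmeasurable_cis|exact: lambda_cm].
- exact: integrable_cst_Ipi.
- move=> a Da; rewrite normcM normc_cis mul1r (normc_real (lambda m a)) (ger0_norm (lambda_ge0 m Da)).
  exact: (lambda_le m Da).
Qed.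

Let term m t (l : int) : T -> R -> R[i] := fun w u => Y m (t + l) w * fcoef (phi m) l u.

Let term_field m t l : fieldP (term m t l).
Proof. by apply: (field_tensor mT (score_L2 m (t + l))); exact: fcoef_L2. Qed.

Let fip_term m n t l l' : fipP (term m t l) (term n t l') =
  if m == n then fip (fourier_term (phi m) l) (lmul m (fourier_term (phi m) l')) else 0.
Proof.
have Hm j : H (fcoef (phi m) j) by exact: fcoef_L2.
have Hn j : H (fcoef (phi n) j) by exact: fcoef_L2.
rewrite (fip_tensor mT (score_L2 _ _) (score_L2 _ _) (Hm l) (Hn l')).
rewrite score_cov2.
have [<-|_] := eqVneq m n; last by rewrite mul0r.
rewrite (fipE mD (fourier_term_field (phi_field m) l) (lmul_field m (fourier_term_field (phi_field m) l'))).
rewrite mulrC -(cintegralZ mD _ (spectral_cis m _)); apply: eq_cintegral => a Da.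
have L (c : R) j : H (fun u => cis c * fcoef (phi m) j u) by exact: HspZ.
rewrite /fourier_term (innerZl _ (Hm l) (HspZ _ (L _ l'))) (innerZr _ (Hm l) (L _ l')).
rewrite (innerZr _ (Hm l) (Hm l')) conjc_real cisJ mulrC mulrA -!mulrA.
have -> : cis ((t + l - (t + l'))%:~R * a) = cis (l%:~R * a) * cis (- (l'%:~R * a)).
  rewrite -cisD; apply: (congr1 (@cis R)).
  have -> : t + l - (t + l') = l - l' by ring.
  by rewrite intrB; ring.
by rewrite -!mulrA; apply: (congr1 ( *%R _)); rewrite mulrCA.
Qed.

Let psum (b : int -> bool) m t N : T -> R -> R[i] :=
  fun w u => zs N (fun l => (b l)%:R * term m t l w u).

Let fsum (b : int -> bool) m N : R -> R -> R[i] :=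
  fun a u => zs N (fun l => (b l)%:R * fourier_term (phi m) l a u).

Let psum_field b m t N : fieldP (psum b m t N).
Proof. by apply: (field_sum mT) => i; apply: (fieldZ mT). Qed.

Let fsum_field b m N : field (fsum b m N).
Proof. by apply: (field_sum mD) => i; apply: (fieldZ mD); exact: fourier_term_field. Qed.

(** The scores have the covariances of [cis (l * a)] in the space with weight
    [lambda m]: partial sums of components have the geometry of the Fourier sums
    of the eigenfunctions in that space. *)
Let fip_psum b m n t N : fipP (psum b m t N) (psum b n t N) =
  if m == n then fip (fsum b m N) (lmul m (fsum b m N)) else 0.
Proof.
pose p (i : 'I_N.*2.+1) : int := i%:Z - N%:Z.
have Ft m' i : fieldP (fun w u => (b (p i))%:R * term m' t (p i) w u) by exact: (fieldZ mT).
have FF i : field (fun a u => (b (p i))%:R * fourier_term (phi m) (p i) a u).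
  by apply: (fieldZ mD); exact: fourier_term_field.
have FL i : field (fun a u => (b (p i))%:R * lmul m (fourier_term (phi m) (p i)) a u).
  by apply: (fieldZ mD); apply: lmul_field; exact: fourier_term_field.
have -> : fipP (psum b m t N) (psum b n t N) =
    \sum_i \sum_j (b (p i))%:R * (conjc (b (p j))%:R * fipP (term m t (p i)) (term n t (p j))).
  rewrite (fip_suml mT _ _ (Ft m) (psum_field b n t N)); apply: eq_bigr => i _.
  rewrite (fip_sumr mT _ _ (Ft n) (Ft m i)); apply: eq_bigr => j _.
  by rewrite (fipZl mT _ (term_field _ _ _) (Ft n j)) (fipZr mT _ (term_field _ _ _) (term_field _ _ _)).
have [<-|mn] := eqVneq m n; last first.
  by rewrite big1// => i _; rewrite big1// => j _; rewrite fip_term (negbTE mn) !mulr0.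
transitivity (fip (fsum b m N) (fun a u => \sum_j (b (p j))%:R * lmul m (fourier_term (phi m) (p j)) a u)).
  rewrite (fip_suml mD _ _ FF (field_sum mD _ _ FL)); apply: eq_bigr => i _.
  rewrite (fip_sumr mD _ _ FL (FF i)); apply: eq_bigr => j _; rewrite fip_term eqxx.
  have Fi := fourier_term_field (phi_field m) (p i); have Fj := lmul_field m (fourier_term_field (phi_field m) (p j)).
  by rewrite (fipZl mD _ Fi (FL j)) (fipZr mD _ Fi Fj).
apply: eq_ip => [//|z _]; rewrite /unc /fsum /zs mulr_sumr; apply: eq_bigr => j _.
by rewrite mulrCA.
Qed.

Let fsq_psum_le b m t N : fsqP (psum b m t N) <= K * zs N (fun l => (b l)%:R * fweight (phi m) l).
Proof.
have FS := fsum_field b m N; have FL := lmul_field m FS.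
have -> : fsqP (psum b m t N) = normc (fip (fsum b m N) (lmul m (fsum b m N))).
  have := fip_psum b m m t N; rewrite eqxx => <-.
  by rewrite (fipxx mT (psum_field b m t N)) normc_real ger0_norm ?nsq_ge0.
rewrite -(fsq_fourier_sum (phi_field m)) -/(fsq (fsum b m N)).
apply: le_trans (normc_ip_le (measurable_DW mD) FS FL) _.
have s0 : 0 <= fsq (fsum b m N) by exact: nsq_ge0.
rewrite -(ger0_norm (mulr_ge0 K0 s0)) -sqrtr_sqr; apply: ler_wsqrtr.
rewrite exprMn expr2 [leRHS]mulrA mulrC; apply: ler_wpM2r => //.
by rewrite -expr2; exact: fsq_lmul_le.
Qed.

Let component_sum_field m t N : fieldP (component_sum P X phi m t N).
Proof. by apply: (field_sum mT) => i; exact: term_field. Qed.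

Let component_limit m t : exists2 Z, L2H P Z &
  fsqP (fun w u => component_sum P X phi m t N w u - Z w u) @[N --> \oo] --> (0 : R).
Proof.
pose f (l : int) (z : T * measurableTypeR R) := unc (term m t l) z.
have [z0 [_ Fz cz]] : exists z0, L2cvg (P \x lam)%E ([set: T] `*` (@I01 R : set (measurableTypeR R)))
    (fun N z => zsum N (f^~ z)) z0.
  apply: (zsum_L2cvg (a := fweight (phi m)) (C := fsq (phi m)) (K := K)) => //.
  - exact: (measurable_DW mT).
  - by move=> l; exact: term_field.
  - by move=> l; exact: fweight_ge0.
  - by move=> N; exact: fourier_bessel.
  move=> n N; have := fsq_psum_le (fun l => (n < absz l)%N) m t N; congr (_ <= _).
    apply: eq_nsq => z _; apply: eq_zs => l; rewrite /zmask.
    by case: ifP => _; rewrite ?mul1r ?mul0r.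
  by apply: (congr1 ( *%R K)); apply: eq_zs => l; rewrite /zmask; case: ifP => _; rewrite ?mul1r ?mul0r.
have Fz0 : fieldP (fun w u => z0 (w, u)) by apply: (L2_eq (measurable_DW mT) _ Fz) => -[].
have [Z LZ Zd] := field_version Fz0; exists Z => //.
rewrite (_ : (fun N => _) = (fun N => nsq (P \x lam)%E ([set: T] `*` @I01 R)
   (fun z => zsum N (f^~ z) - z0 z))); first exact: cz.
apply/funext => N; rewrite (Zd _ (component_sum_field m t N)).
by apply: eq_nsq => -[w u] _.
Qed.

Lemma component_converges m t :
  converges (L2H P) (Enormsq P) (component_sum P X phi m t) (component P X phi m t).
Proof.
have [Z LZ c] := component_limit m t.
apply: (@xgetPex _ 0 (converges _ _ _)); exists Z.
by apply/L2H_cvgP => // N; exact: component_sum_field.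
Qed.

Lemma component_L2H m t : L2H P (component P X phi m t).
Proof. by have [] := component_converges m t. Qed.

Let component_field m t : fieldP (component P X phi m t).
Proof. exact: L2H_field (component_L2H m t). Qed.

Let component_cvg m t :
  L2cvg (P \x lam)%E ([set: T] `*` (@I01 R : set (measurableTypeR R)))
    (fun N => unc (component_sum P X phi m t N)) (unc (component P X phi m t)).
Proof.
split => [N||]; [exact: component_sum_field|exact: component_field|].
by apply/L2H_cvgP; [move=> N; exact: component_sum_field|exact: component_L2H|exact: component_converges].
Qed.

Let fip_lmul m : fip (phi m) (lmul m (phi m)) = ((nu m)%:C)%C.
Proof.
rewrite (fipE mD (phi_field m) (wphi_field m)).
transitivity (cintegral mu D (fun a => ((lambda m a)%:C)%C)).
  apply: eq_cintegral => a Da.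
  by rewrite (innerZr _ (phi_H m Da) (phi_H m Da)) (inner_phi m m Da) eqxx mulr1 conjc_real.
apply: complex_eq => //=.
by rewrite (_ : (fun=> _) = cst 0) ?Rintegral_cst ?mul0r//; exact: mD.
Qed.

Let lmul_cvg m : L2cvg (mu \x lam)%E (D `*` (@I01 R : set (measurableTypeR R)))
    (fun N => unc (lmul m (fourier_sum (phi m) N))) (unc (lmul m (phi m))).
Proof.
have [Fs _ c] := fourier_sum_cvg (phi_field m).
split => [N||]; [exact/lmul_field/Fs|exact: wphi_field|].
apply: (squeeze_cvgr _ (cvg_cst 0) (_ : K ^+ 2 * fsq (fun a u => fourier_sum (phi m) N a u - phi m a u) @[N --> \oo] --> 0)); last first.
  by rewrite -(mulr0 (K ^+ 2)); exact: cvgMr.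
apply: nearW => N; rewrite nsq_ge0/=.
apply: le_trans (fsq_lmul_le m (fieldB mD (Fs N) (phi_field m))).
rewrite le_eqVlt; apply/orP; left; apply/eqP; apply: eq_nsq => z _.
by rewrite /unc mulrBr.
Qed.

Lemma fip_component m n t : fipP (component P X phi m t) (component P X phi n t) =
  if m == n then ((nu m)%:C)%C else 0.
Proof.
apply: (ccvg_unique (ip_cvg2 (measurable_DW mT) (component_cvg m t) (component_cvg n t))).
have E N : ip (P \x lam)%E ([set: T] `*` (@I01 R : set (measurableTypeR R)))
   (unc (component_sum P X phi m t N)) (unc (component_sum P X phi n t N)) =
   if m == n then fip (fourier_sum (phi m) N) (lmul m (fourier_sum (phi m) N)) else 0.
  have := fip_psum xpredT m n t N.
  have e1 m' : psum xpredT m' t N = component_sum P X phi m' t N.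
    by apply/funext => w; apply/funext => u; apply: eq_zs => l; rewrite mul1r.
  rewrite !e1; have -> // : fsum xpredT m N = fourier_sum (phi m) N.
  by apply/funext => w; apply/funext => u; apply: eq_zs => l; rewrite mul1r.
apply: (ccvg_eq (fun N => esym (E N))).
case: eqVneq => _; last exact: ccvg_cst.
rewrite -fip_lmul.
exact: (ip_cvg2 (measurable_DW mD) (fourier_sum_cvg (phi_field m)) (lmul_cvg m)).
Qed.

(** The scalar product of the process with a filter coefficient has covariances
    with the scores given by [score_cov], so the process pairs with a partial
    component as [phi m] does with its own Fourier sum in the weighted space. *)
Lemma fip_component_process m t : fipP (component P X phi m t) (X t) = ((nu m)%:C)%C.
Proof.
have FX := L2H_field (XL t).
apply: (ccvg_unique (ip_cvgl (measurable_DW mT) (component_cvg m t) FX)).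
rewrite -fip_lmul.
apply: ccvg_eq (ip_cvgl (measurable_DW mD) (fourier_sum_cvg (phi_field m)) (wphi_field m)) => N.
pose p (i : 'I_N.*2.+1) : int := i%:Z - N%:Z.
transitivity (fip (fun a u => \sum_i fourier_term (phi m) (p i) a u) (lmul m (phi m))) => //.
transitivity (fipP (fun w u => \sum_i term m t (p i) w u) (X t)) => //.
rewrite (fip_suml mD _ _ (fun i => fourier_term_field (phi_field m) (p i)) (wphi_field m)).
rewrite (fip_suml mT _ _ (fun i => term_field m t (p i)) FX).
apply: eq_bigr => i _; have Hi := fcoef_L2 (phi_field m) (p i).
rewrite (fipE mT (term_field m t (p i)) FX).
transitivity (ipP (Y m (t + p i)) (fun w => inner (X t w) (fcoef (phi m) (p i)))); last first.
  apply: eq_cintegral => w _; have HX : H (X t w) by case: (XL t) => -[].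
  by rewrite /term (innerZl _ Hi HX) innerJ.
rewrite (score_cov m (t + p i) t Hi).
have := fip_fourier_term_mod 0 m (p i) (phi_field m).
have -> : t + p i - t = 0 + p i by ring.
move=> <-; apply: eq_ip => [//|z _].
by rewrite /unc mul0r oppr0 cis0 mul1r.
Qed.

(** Pythagoras: distinct components are orthogonal, and a component has the same
    inner product with the process as with itself. *)
Lemma remainder_nsq M t :
  fsqP (fun w u => \sum_(m < M) component P X phi m t w u - X t w u) =
  fsqP (X t) - \sum_(m < M) nu m.
Proof.
have FX := L2H_field (XL t).
have Fs : fieldP (fun w u => \sum_(m < M) component P X phi m t w u).
  by apply: (field_sum mT) => m; exact: component_field.
rewrite (fsqB mT Fs FX).
have e1 : fipP (fun w u => \sum_(m < M) component P X phi m t w u) (X t) = ((\sum_(m < M) nu m)%:C)%C.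
  rewrite (fip_suml mT _ _ (fun m : 'I_M => component_field m t) FX) rmorph_sum.
  by apply: eq_bigr => m _; exact: fip_component_process.
have e2 : fsqP (fun w u => \sum_(m < M) component P X phi m t w u) = \sum_(m < M) nu m.
  apply: complexI; rewrite -(fipxx mT Fs).
  rewrite (fip_suml mT _ _ (fun m : 'I_M => component_field m t) Fs) rmorph_sum.
  apply: eq_bigr => m _.
  rewrite (fip_sumr mT _ _ (fun m : 'I_M => component_field m t) (component_field m t)).
  transitivity (\sum_(n < M) (if (m : nat) == n then ((nu m)%:C)%C else 0)).
    by apply: eq_bigr => n _; exact: fip_component.
  rewrite (bigD1 m isT) eqxx big1; first exact: addr0.
  by move=> n nm; case: eqP => // mn; case/eqP: nm; apply: val_inj.
by rewrite e1 e2 /=; ring.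
Qed.
(** * The trace of the covariance *)

Let cov0 t x : H x -> inner (C_ 0 x) x = ((nsqP (fun w => inner (X t w) x))%:C)%C.
Proof.
move=> Hx; rewrite -(ipxx mT (inner_L2 (XL t) Hx)) (cov t t Hx Hx).
by rewrite subrr.
Qed.

Let energy M x a : R := \sum_(m < M) lambda m a * normc (inner x (phi m a)) ^+ 2.

Let normc_phi m x a : D a -> H x -> normc (inner x (phi m a)) = normc (inner (phi m a) x).
Proof. by move=> Da Hx; rewrite -(innerJ (phi_H m Da) Hx) normc_conj. Qed.

Let energy_ge0 M x a : D a -> 0 <= energy M x a.
Proof. by move=> Da; apply: sumr_ge0 => m _; rewrite mulr_ge0 ?sqr_ge0// lambda_ge0. Qed.

Let energy_le M x a : D a -> H x -> energy M x a <= K * hsq x.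
Proof.
move=> Da Hx; apply: (@le_trans _ _ (K * \sum_(m < M) normc (inner x (phi m a)) ^+ 2)).
  rewrite mulr_sumr; apply: ler_sum => m _; apply: ler_wpM2r; first exact: sqr_ge0.
  exact: lambda_le.
by apply: ler_wpM2l => //; apply: (bessel M (phi_ortho Da) Hx).
Qed.

Let energy_meas M x : H x -> @measurable_fun _ _ (measurableTypeR R) (measurableTypeR R) D (energy M x).
Proof.
move=> Hx; apply: (@eq_measurable_fun _ _ _ _ D (fun a => \sum_(m < M) lambda m a * normc (inner (phi m a) x) ^+ 2)).
  by move=> a /set_mem Da; apply: eq_bigr => m _; rewrite normc_phi.
apply: measurable_sum => m; apply: measurable_funM.
  exact: (lambda_meas m).
exact: measurable_normc2 (inner_field_meas mD (phi_field m) Hx).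
Qed.

Let energy_int M x : H x -> mu.-integrable D (fun a => (energy M x a)%:E).
Proof.
move=> Hx; apply: (le_integrable mD _ _ (integrable_cst_Ipi (K * hsq x))).
  apply/measurable_EFinP; exact: (energy_meas M Hx).
move=> a Da; rewrite !abse_EFin lee_fin ger0_norm ?energy_ge0//.
by apply: le_trans (ler_norm _); exact: energy_le.
Qed.

(** The spectral density integrates to the covariance at lag 0: in each of its
    partial sums only that lag survives the integration. *)
Let variance_spectral t x : H x ->
  \int[mu]_(a in D) energy M x a @[M --> \oo] --> nsqP (fun w => inner (X t w) x).
Proof.
move=> Hx; pose g a : R := complex.Re (inner (F_ a x) x).
have s0 := mulr_ge0 K0 (sqrtr_ge0 (hsq x * hsq x)).
have mp N : @cmeasurable _ (measurableTypeR R) R D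
    (fun a => c2 * zs N (fun h => inner (C_ h x) x * cis (- (h%:~R * a)))).
  apply: cmeasurableZ; apply: cmeasurable_sum => i; apply: cmeasurableZ.
  rewrite (_ : (fun a => _) = (fun a => conjc (cis ((i%:Z - N%:Z)%:~R * a)))).
    exact/cmeasurableJ/cmeasurable_cis.
  by apply/funext => a; rewrite cisJ.
have mF : @cmeasurable _ (measurableTypeR R) R D (fun a => inner (F_ a x) x).
  apply: (cmeasurable_cvg mD mp) => a Da.
  exact: (spectral_density_inner a Hx Hx).
have c1 : ccvg (fun N => cintegral mu D (fun a => c2 * zs N (fun h => inner (C_ h x) x * cis (- (h%:~R * a)))))
    (cintegral mu D (fun a => inner (F_ a x) x)).
  apply: (cdominated_convergence mD mp (g := fun=> K * Num.sqrt (hsq x * hsq x))).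
  - by move=> a Da; exact: (spectral_density_inner a Hx Hx).
  - exact: integrable_cst_Ipi.
  - by move=> N a Da; exact: (spectral_partial_le a N Hx Hx).
have Icis (h : int) : cintegrable mu D (fun a => cis (- (h%:~R * a))).
  apply: (cintegrable_le mD (g := fun=> 1)).
  - rewrite (_ : (fun a => _) = (fun a => conjc (cis (h%:~R * a)))).
      exact/cmeasurableJ/cmeasurable_cis.
    by apply/funext => a; rewrite cisJ.
  - exact: integrable_cst_Ipi.
  - by move=> a _; rewrite normc_cis.
have cisI (h : int) : cintegral mu D (fun a => cis (- (h%:~R * a))) = if h == 0 then (((2 * pi) : R)%:C)%C else 0.
  rewrite -oppr_eq0 -cis_integral; apply: eq_cintegral => a _.
  by rewrite intrN mulNr.
have partE N : cintegral mu D (fun a => c2 * zs N (fun h => inner (C_ h x) x * cis (- (h%:~R * a)))) =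
    inner (C_ 0 x) x.
  have I1 (h : int) : cintegrable mu D (fun a => inner (C_ h x) x * cis (- (h%:~R * a))).
    exact: (cintegrableZ mD _ (Icis h)).
  rewrite (cintegralZ mD c2 (cintegrable_sum mD _ _ (fun i : 'I_N.*2.+1 => I1 (i%:Z - N%:Z)))).
  rewrite (cintegral_sum mD _ _ (fun i : 'I_N.*2.+1 => I1 (i%:Z - N%:Z))).
  have N0 : (N < N.*2.+1)%N by lia.
  rewrite (bigD1 (Ordinal N0) isT) big1 => [|i iN]; last first.
    rewrite (cintegralZ mD _ (Icis _)) cisI; case: eqP => [/eqP|_]; last by rewrite mulr0.
    by rewrite subr_eq0 => /eqP[iN']; case/eqP: iN; exact: val_inj.
  rewrite /= subrr (cintegralZ mD _ (Icis _)) cisI eqxx.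
  rewrite [X in c2 * X](_ : _ = inner (C_ 0 x) x * (((2 * pi) : R)%:C)%C); last exact: addr0.
  rewrite mulrCA -rmorphM mulVf ?mulr1// gt_eqF ?pi2_gt0//.
have c1E : cintegral mu D (fun a => inner (F_ a x) x) = inner (C_ 0 x) x.
  by apply: (ccvg_unique c1); apply: ccvg_eq (ccvg_cst _) => N; rewrite partE.
have -> : nsqP (fun w => inner (X t w) x) = \int[mu]_(a in D) g a.
  exact: etrans (esym (congr1 (@complex.Re R) (cov0 t Hx))) (esym (congr1 (@complex.Re R) c1E)).
have mg : @measurable_fun _ _ (measurableTypeR R) (measurableTypeR R) D g by case: mF.
have [||_] // := Rdominated_convergence_ae mD (u_ := fun M => energy M x) (u := g) (g := fun=> K * hsq x)
  (fun M => energy_meas M Hx) mg _ (integrable_cst_Ipi _) _.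
- apply: aeW => a Da; have [h _] := spectral_quadratic Da Hx; exact: h.
- by move=> M a Da; rewrite ger0_norm ?energy_ge0//; exact: energy_le.
Qed.

(** Parseval's identity for each outcome, integrated under the domination given
    by Bessel's inequality. *)
Let energy_basis t :
  \sum_(j < n) nsqP (fun w => inner (X t w) (e j)) @[n --> \oo] --> fsqP (X t).
Proof.
have FX := L2H_field (XL t).
have L j : L2 P setT (fun w => inner (X t w) (e j)) by exact: inner_L2.
have ih := field_hsq_int mT FX.
have mh : measurable_fun [set: T] (fun w => hsq (X t w)) by apply/measurable_EFinP; exact: measurable_int ih.
have [|||_] := Rdominated_convergence_ae mT
  (u_ := fun n w => \sum_(j < n) normc (inner (X t w) (e j)) ^+ 2)
  (u := fun w => hsq (X t w)) (g := fun w => hsq (X t w)) _ mh _ ih _.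
- by move=> n; apply: measurable_sum => j; exact: measurable_normc2 (L2_meas (L j)).
- by apply: aeW => w _; exact: (parseval eb (XH t w)).
- move=> n w _; rewrite ger0_norm; first by apply: bessel => //; case: eb.
  by apply: sumr_ge0 => j _; exact: sqr_ge0.
rewrite -(fsqE mT FX) (_ : (fun n => \int[P]_(w in setT) _) =
  (fun n => \sum_(j < n) nsqP (fun w => inner (X t w) (e j))))//; apply/funext => n.
by have [_ ->] := Rintegral_sum (index_enum 'I_n) mT (fun j : 'I_n => L2_int (L j)).
Qed.

Let nu_int m : mu.-integrable D (fun a => (lambda m a)%:E).
Proof.
apply: (le_integrable mD _ _ (integrable_cst_Ipi K)).
  apply/measurable_EFinP; exact: (lambda_meas m).
move=> a Da; rewrite !abse_EFin lee_fin ger0_norm ?lambda_ge0//.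
by apply: le_trans (ler_norm _); exact: lambda_le.
Qed.

(** Bessel's inequality for the unit vectors [phi m a]. *)
Let energy_sum_le n M : \sum_(j < n) \int[mu]_(a in D) energy M (e j) a <= \sum_(m < M) nu m.
Proof.
have [i1 <-] := Rintegral_sum (index_enum 'I_n) mD (fun j : 'I_n => energy_int M (eH j)).
have [i2 <-] := Rintegral_sum (index_enum 'I_M) mD (fun m : 'I_M => nu_int m).
apply: (le_Rintegral mD i1 i2).
move=> a Da; rewrite exchange_big; apply: ler_sum => m _.
rewrite -mulr_sumr -[leRHS]mulr1; apply: ler_wpM2l; first exact: lambda_ge0.
rewrite -(hsq_phi m Da); have [eo _] := eb.
apply: le_trans (bessel n eo (phi_H m Da)).
by apply: ler_sum => j _; rewrite normc_phi.
Qed.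

Let cvg_sums n t :
  \sum_(j < n) \int[mu]_(a in D) energy M (e j) a @[M --> \oo] -->
  \sum_(j < n) nsqP (fun w => inner (X t w) (e j)).
Proof.
elim: n => [|n ih].
  by rewrite big_ord0; under eq_fun do rewrite big_ord0; exact: cvg_cst.
rewrite big_ord_recr; under eq_fun do rewrite big_ord_recr.
by apply: cvgD => //; exact: variance_spectral.
Qed.

(** Both sides are the trace of the covariance at lag 0, computed in a fixed
    basis or in the eigenfunctions at each frequency. The squared norm of the
    remainder gives one inequality. For the other, finitely many vectors of the
    basis carry the variance of the process up to a small error, and on these
    the eigenvalues account for it by [energy_sum_le]. *)
Lemma trace_formula t : \sum_(m < M) nu m @[M --> \oo] --> fsqP (X t).
Proof.
have upper M : \sum_(m < M) nu m <= fsqP (X t).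
  rewrite -subr_ge0 -(remainder_nsq M t).
  exact: nsq_ge0.
apply/cvgrPdist_le => d0 d0_gt0; have h0 : 0 < d0 / 2 by lra.
have /cvgrPdist_le /(_ _ h0) [n _ /(_ n (leqnn n)) hn] := @energy_basis t.
have /cvgrPdist_le /(_ _ h0) := @cvg_sums n t; apply: filterS => M hM.
rewrite ger0_norm ?subr_ge0//.
move: hn hM (energy_sum_le n M); rewrite !ler_norml => /andP[_ h1] /andP[_ h2] h3.
by move: h1 h2 h3; rewrite /=; lra.
Qed.
End DynamicComponents.

(** * The expansion *)

Lemma orthonormal_basis_exists (R : realType) (A : (R -> R[i]) -> R -> R[i]) :
  (HSnorm A < +oo)%E -> exists e : nat -> R -> R[i], orthonormal_basis e.
Proof. by move=> /ereal_inf_lt[_ [e eb _] _]; exists e. Qed.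

Theorem theorem1 (R : realType) (d : measure_display) (T : measurableType d)
    (P : probability T R) (X : int -> T -> R -> R[i])
    (lambda : nat -> R -> R) (phi : nat -> R -> R -> R[i]) :
  weakly_stationary P X ->
  (\esum_(h in [set: int]) HSnorm (covop P X h) < +oo)%E ->
  spectral_representation P X lambda phi ->
  jointly_measurable phi ->
  (forall (m : nat) (t : int),
    converges (L2 P setT) (L2normsq P setT)
      (score_sum X phi m t) (score P X phi m t)) /\
  (forall (m : nat) (t : int),
    converges (L2H P) (Enormsq P)
      (component_sum P X phi m t) (component P X phi m t)) /\
  (forall t : int,
    converges (L2H P) (Enormsq P)
      (fun M w u => \sum_(m < M) component P X phi m t w u) (X t)).
Proof.
move=> [XL [_ stat]] Hsum sr jm.
have [HSfin [K kK]] := esum_zs (fun h => HSnorm_ge0 (covop P X h)) Hsum.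
have k0 h : 0 <= fine (HSnorm (covop P X h)) by rewrite fine_ge0// HSnorm_ge0.
have CH h x : Hsp x -> Hsp (covop P X h x) := covop_H XL h (x := x).
have Ck h x (Hx : Hsp x) := HSnorm_bound (HSfin h) (CH h) (covop_basis_bound XL stat (h := h)) Hx.
have cov := cov_covop_sub XL stat.
have [e eb] := orthonormal_basis_exists (HSfin 0).
split => [m t|].
  have [Ls _ _] := score_cvg CH Ck k0 kK XL cov sr jm m t.
  apply/(converges_L2P (@measurableT _ T) _ Ls).
  exact: (score_cvg CH Ck k0 kK XL cov sr jm).
split => [m t|t]; first exact: (component_converges CH Ck k0 kK XL cov sr jm eb).
have Fc m : field P [set: T] (component P X phi m t).
  exact: L2H_field (component_L2H CH Ck k0 kK XL cov sr jm eb m t).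
have Fs M : field P [set: T] (fun w u => \sum_(m < M) component P X phi m t w u).
  by apply: (field_sum (@measurableT _ T)) => m; exact: Fc.
apply/(L2H_cvgP Fs (XL t)).
rewrite (_ : (fun M => _) = (fun M => fsq P [set: T] (X t) - \sum_(m < M) \int[leb R]_(a in @Ipi R) lambda m a)).
  have := cvgB (cvg_cst (fsq P [set: T] (X t))) (trace_formula CH Ck k0 kK XL cov sr jm eb (t := t)).
  by rewrite subrr => h; exact: h.
apply/funext => M; exact: (remainder_nsq CH Ck k0 kK XL cov sr jm eb M t).
Qed.
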